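(* Let $A$ be an $\mathbb F$-algebra. Let $W$ be a torsionfree complete bornological $V$-module that is fine mod $\pi$. Let $\varrho\colon W\to A$ be a surjective $V$-linear map. Let $I=\ker(\varrho^\#\colon TW\to A)$. There is an extension of pro-algebras $$\widehat{U(I,I^\infty)_{\mathrm{lg}}}\rightarrowtail\widehat{U(TW,I^\infty)_{\mathrm{lg}}}\twoheadrightarrow A,$$ where $\widehat{U(TW,I^\infty)_{\mathrm{lg}}}$ is a pro-dagger algebra that is fine mod $\pi$ and $\widehat{U(I,I^\infty)_{\mathrm{lg}}}$ is analytically nilpotent.
   Context: Let $V$ be a complete discrete valuation ring with uniformiser $\pi$, residue field $\mathbb F$ and fraction field $F$ of characteristic $0$. Algebras are associative, not necessarily unital; an $\mathbb F$-algebra $A$ is also a $V$-algebra with $\pi A=0$; it carries the fine bornology and is viewed as a constant projective system. Bornologies. A bornological $V$-module is a $V$-module $M$ with a family of bounded subsets that contains the finite subsets, is closed under subsets and finite unions, and such that the $V$-submodule generated by a bounded subset is bounded. Morphisms are bounded (mapping bounded sets to bounded sets) $V$-linear maps. Submodules carry the subspace bornology, quotients the quotient bornology (images of bounded subsets). A subset of a direct sum is bounded if it is contained in a finite sum of bounded submodules of the summands. A subset of $M\otimes N$ ($\otimes=\otimes_V$) is bounded if it is contained in the image of $S\otimes T$ for bounded submodules $S\subseteq M$, $T\subseteq N$. A bornological algebra has bounded multiplication. The bounded subsets of $F$ are the subsets of $\pi^{-n}V$, $n\in\mathbb N$. $M$ is torsionfree if multiplication by $\pi$ is a bornological embedding (injective,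 and $S$ is bounded whenever $\pi S$ is). $M$ is complete if every bounded submodule is contained in a $\pi$-adically complete bounded submodule. Fine bornology: bounded means contained in a finitely generated submodule. $M$ is fine mod $\pi$ if the quotient bornology on $M/\pi M$ is fine; a projective system is fine mod $\pi$ if each entry is. $\widehat M$ denotes the bornological completion (left adjoint to the inclusion of complete bornological modules), applied entrywise to projective systems. Linear growth, dagger algebras. For a bornological algebra $R$, a subset has linear growth if it is contained in $\sum_{i\ge0}\pi^iT^{i+1}$ for a bounded submodule $T\subseteq R$; $R_{\mathrm{lg}}$ is $R$ with the bornology of subsets of linear growth. $R$ is semidagger if subsets of linear growth are bounded; a dagger algebra is a complete, torsionfree, semidagger bornological $V$-algebra; a pro-dagger algebra is a projective system of dagger algebras. A pro-algebra is a projective system of bornological $V$-algebras. A projective system $(B_n)_{n\in\mathbb N}$ of bornological algebras is nilpotent mod $\pi$ if for each $n$ there are $m\ge n$, $l\ge1$ such that the structure map $B_m\to B_n$ maps $B_m^l$ into $\pi B_n$; it is analytically nilpotent if it is nilpotent mod $\pi$ and isomorphic to a projective system of dagger algebras. An extension is a diagram $K\xrightarrow{i}E\xrightarrow{p}Q$ where $i$ is a kernel of $p$ and $p$ is a cokernel of $i$ (as projective systems of bornological $V$-modules), with $i,p$ morphisms of pro-algebras. Tensor and tube algebras. $TW=\bigoplus_{n\ge1}W^{\otimes n}$ with concatenation product; $\varrho^\#\colon TW\to A$ is the algebra homomorphism with $\varrho^\#(x_1\otimes\dots\otimes x_n)=\varrho(x_1)\cdots\varrho(x_n)$. For an ideal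 $I$ in a torsionfree bornological algebra $R$ and $l\ge1$, $U(R,I^l)=\sum_{j\ge0}\pi^{-j}I^{lj}\subseteq R\otimes F$ with the subspace bornology, where $I^0:=R$ and for $k\geq 1$, $I^k$ is the $V$-span of $k$-fold products. In particular, for $R=I$, $U(I,I^l)=I+\sum_{j\ge1}\pi^{-j}I^{lj}$. $U(R,I^\infty)=(U(R,I^l))_{l\in\mathbb N^*}$ is the projective system with the inclusions as structure maps. *)

(* Defs.v *)
From HB Require Import structures.
From mathcomp Require Import all_boot all_order all_algebra.
From mathcomp Require Import fraction generic_quotient.
From mathcomp Require Import boolp classical_sets cardinality.
From mathcomp Require Import finmap.
From mathcomp.multinomials Require Import monalg.

Set Implicit Arguments.
Unset Strict Implicit.
Unset Printing Implicit Defensive.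

Import GRing.Theory.
Local Open Scope quotient_scope.
Local Open Scope classical_set_scope.
Local Open Scope ring_scope.

Section Linear.
Context (K : nzRingType) (M N : lmodType K) (f : M -> N) (lf : linear f).

Lemma lin0 : f 0 = 0.
Proof. by have := lf (-1) 0 0; rewrite scaler0 addr0 scaleN1r addNr. Qed.

Lemma linD x y : f (x + y) = f x + f y.
Proof. by have := lf 1 x y; rewrite !scale1r. Qed.

Lemma linZ a x : f (a *: x) = a *: f x.
Proof. by have := lf a x 0; rewrite !addr0 lin0 addr0. Qed.

Lemma linN x : f (- x) = - f x.
Proof. by rewrite -scaleN1r linZ scaleN1r. Qed.

Lemma linB x y : f (x - y) = f x - f y.
Proof. by rewrite linD linN. Qed.

End Linear.

Section Submodules.
Context (K : nzRingType) (M : lmodType K).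

Definition is_submod (S : set M) : Prop :=
  S 0 /\ forall a x y, S x -> S y -> S (a *: x + y).

Definition span (S : set M) : set M := smallest is_submod S.

Lemma span_submod S : is_submod (span S).
Proof.
split=> [N [[N0 _] _] //|a x y Sx Sy N [Nm SN]].
by apply: Nm.2; [exact: (Sx N)|exact: (Sy N)].
Qed.

Lemma sub_span S : S `<=` span S.
Proof. by move=> x Sx N [_]; exact. Qed.

Lemma span_min S N : is_submod N -> S `<=` N -> span S `<=` N.
Proof. by move=> Nm SN; exact: smallest_sub. Qed.

Lemma span_mono S T : S `<=` T -> span S `<=` span T.
Proof.
by move=> ST; apply: span_min (span_submod T) _; apply: subset_trans ST (@sub_span T).
Qed.

Lemma span_idem S : span (span S) = span S.
Proof.
apply/seteqP; split; last exact: sub_span.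
exact: span_min (span_submod S) _.
Qed.

Lemma submodD (S : set M) (hS : is_submod S) x y : S x -> S y -> S (x + y).
Proof. by move=> Sx Sy; have := hS.2 1 x y Sx Sy; rewrite scale1r. Qed.

Lemma submodZ (S : set M) (hS : is_submod S) a x : S x -> S (a *: x).
Proof. by move=> Sx; have := hS.2 a x 0 Sx hS.1; rewrite addr0. Qed.

Lemma submodN (S : set M) (hS : is_submod S) x : S x -> S (- x).
Proof. by move=> /(submodZ hS (-1)); rewrite scaleN1r. Qed.

Lemma submodT : is_submod setT.
Proof. by []. Qed.

Lemma submod_sum (S : set M) (hS : is_submod S) (I : Type) (r : seq I) (P : pred I)
    (F : I -> M) : (forall i, P i -> S (F i)) -> S (\sum_(i <- r | P i) F i).
Proof.
move=> h; apply: (big_ind S) => //; first exact: hS.1.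
by move=> x y; exact: submodD.
Qed.

Record submodule := Submodule {
  sm_set :> set M;
  sm_closed : is_submod sm_set
}.

Definition span_sub (S : set M) : submodule := Submodule (span_submod S).

End Submodules.

Section LinearSpan.
Context (K : nzRingType) (M N : lmodType K).

Lemma preimage_submod (f : M -> N) (S : set N) :
  linear f -> is_submod S -> is_submod [set x | S (f x)].
Proof.
move=> lf hS; split=> /= [|a x y Sx Sy]; first by rewrite (lin0 lf); exact: hS.1.
by rewrite lf; exact: hS.2.
Qed.

Lemma image_submod (f : M -> N) (S : set M) :
  linear f -> is_submod S -> is_submod (f @` S).
Proof.
move=> lf hS; split=> /= [|a _ _ [x Sx <-] [y Sy <-]].
  by exists 0; [exact: hS.1|rewrite (lin0 lf)].
by exists (a *: x + y); [exact: hS.2|rewrite lf].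
Qed.

Lemma eq_submod (f g : M -> N) :
  linear f -> linear g -> is_submod [set x | f x = g x].
Proof.
move=> lf lg; split=> /= [|a x y hx hy]; first by rewrite (lin0 lf) (lin0 lg).
by rewrite lf lg hx hy.
Qed.

Lemma image_span (f : M -> N) (S : set M) (T : set N) :
  linear f -> (forall x, S x -> span T (f x)) ->
  forall x, span S x -> span T (f x).
Proof.
move=> lf h; apply: (span_min (N := [set x | span T (f x)])) => //.
exact: preimage_submod lf (span_submod T).
Qed.

End LinearSpan.

Section SubModule.
Context (K : nzRingType) (M : lmodType K) (S : submodule M).

Definition subm : Type := {x : M | `[< sm_set S x >]}.
HB.instance Definition _ := [isSub of subm for @sval M (fun x => `[< sm_set S x >])].
HB.instance Definition _ := [Choice of subm by <:].

Lemma submP (u : subm) : sm_set S (val u).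
Proof. by case: u => x /= /asboolP. Qed.

Definition mksub x (Sx : sm_set S x) : subm := exist _ x (introT (asboolP _) Sx).

Lemma val_mksub x (Sx : sm_set S x) : val (mksub Sx) = x.
Proof. by []. Qed.

Let hS := sm_closed S.
Definition subm_zero := mksub hS.1.
Definition subm_add (u v : subm) := mksub (submodD hS (submP u) (submP v)).
Definition subm_opp (u : subm) := mksub (submodN hS (submP u)).
Definition subm_scale a (u : subm) := mksub (submodZ hS a (submP u)).

Fact subm_addA : associative subm_add.
Proof. by move=> u v w; apply: val_inj; rewrite /= addrA. Qed.
Fact subm_addC : commutative subm_add.
Proof. by move=> u v; apply: val_inj; rewrite /= addrC. Qed.
Fact subm_add0 : left_id subm_zero subm_add.
Proof. by move=> u; apply: val_inj; rewrite /= add0r. Qed.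
Fact subm_addN : left_inverse subm_zero subm_opp subm_add.
Proof. by move=> u; apply: val_inj; rewrite /= addNr. Qed.
HB.instance Definition _ :=
  GRing.isZmodule.Build subm subm_addA subm_addC subm_add0 subm_addN.

Fact subm_scaleA a b u : subm_scale a (subm_scale b u) = subm_scale (a * b) u.
Proof. by apply: val_inj; rewrite /= scalerA. Qed.
Fact subm_scale1 : left_id 1 subm_scale.
Proof. by move=> u; apply: val_inj; rewrite /= scale1r. Qed.
Fact subm_scaleDr : right_distributive subm_scale +%R.
Proof. by move=> a u v; apply: val_inj; rewrite /= scalerDr. Qed.
Fact subm_scaleDl u : {morph subm_scale^~ u : a b / a + b}.
Proof. by move=> a b; apply: val_inj; rewrite /= scalerDl. Qed.
HB.instance Definition _ := GRing.Zmodule_isLmodule.Build K subm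
  subm_scaleA subm_scale1 subm_scaleDr subm_scaleDl.

Lemma subm_val_linear : linear (val : subm -> M).
Proof. by []. Qed.

End SubModule.

Section QuotientModule.
Context (K : nzRingType) (M : lmodType K) (N : submodule M).

Definition qrel : rel M := fun x y => `[< sm_set N (x - y) >].

Fact qrel_refl : reflexive qrel.
Proof. by move=> x; apply/asboolP; rewrite subrr; exact: (sm_closed N).1. Qed.
Fact qrel_sym : symmetric qrel.
Proof.
by move=> x y; apply/asboolP/asboolP => /(submodN (sm_closed N)); rewrite opprB.
Qed.
Fact qrel_trans : transitive qrel.
Proof.
move=> y x z /asboolP h1 /asboolP h2; apply/asboolP.
by have := submodD (sm_closed N) h1 h2; rewrite addrA subrK.
Qed.
Canonical qequiv := EquivRel qrel qrel_refl qrel_sym qrel_trans.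

Definition quotm : Type := {eq_quot qequiv}.
HB.instance Definition _ := Choice.on quotm.
HB.instance Definition _ : EqQuotient _ qequiv quotm := EqQuotient.on quotm.

Definition qpi (x : M) : quotm := \pi_quotm x.

Lemma qpiP x y : (qpi x = qpi y) <-> sm_set N (x - y).
Proof.
split; first by move=> /eqmodP/asboolP.
by move=> h; apply/eqmodP/asboolP.
Qed.

Lemma qreprK (u : quotm) : qpi (repr u) = u.
Proof. exact: reprK. Qed.

Lemma qrepr_pi x : sm_set N (repr (qpi x) - x).
Proof. by apply/qpiP; rewrite qreprK. Qed.

Definition quot_add (u v : quotm) : quotm := qpi (repr u + repr v).
Definition quot_opp (u : quotm) : quotm := qpi (- repr u).
Definition quot_scale (a : K) (u : quotm) : quotm := qpi (a *: repr u).

Let hN := sm_closed N.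

Lemma quot_addE x y : quot_add (qpi x) (qpi y) = qpi (x + y).
Proof.
by apply/qpiP; rewrite opprD addrACA; apply: submodD => //; exact: qrepr_pi.
Qed.
Lemma quot_oppE x : quot_opp (qpi x) = qpi (- x).
Proof. by apply/qpiP; rewrite -opprD; apply: submodN => //; exact: qrepr_pi. Qed.
Lemma quot_scaleE a x : quot_scale a (qpi x) = qpi (a *: x).
Proof. by apply/qpiP; rewrite -scalerBr; apply: submodZ => //; exact: qrepr_pi. Qed.

Fact quot_addA : associative quot_add.
Proof.
move=> u v w; rewrite -(qreprK u) -(qreprK v) -(qreprK w).
by rewrite !quot_addE addrA.
Qed.
Fact quot_addC : commutative quot_add.
Proof. by move=> u v; rewrite -(qreprK u) -(qreprK v) !quot_addE addrC. Qed.
Fact quot_add0 : left_id (qpi 0) quot_add.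
Proof. by move=> u; rewrite -(qreprK u) !quot_addE add0r. Qed.
Fact quot_addN : left_inverse (qpi 0) quot_opp quot_add.
Proof. by move=> u; rewrite -(qreprK u) quot_oppE quot_addE addNr. Qed.
HB.instance Definition _ :=
  GRing.isZmodule.Build quotm quot_addA quot_addC quot_add0 quot_addN.

Fact quot_scaleA a b u : quot_scale a (quot_scale b u) = quot_scale (a * b) u.
Proof. by rewrite -(qreprK u) !quot_scaleE scalerA. Qed.
Fact quot_scale1 : left_id 1 quot_scale.
Proof. by move=> u; rewrite -(qreprK u) quot_scaleE scale1r. Qed.
Fact quot_scaleDr : right_distributive quot_scale +%R.
Proof.
move=> a u v; rewrite -(qreprK u) -(qreprK v) [qpi _ + qpi _]quot_addE.
by rewrite !quot_scaleE scalerDr [RHS]quot_addE.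
Qed.
Fact quot_scaleDl u : {morph quot_scale^~ u : a b / a + b}.
Proof.
move=> a b; rewrite -(qreprK u) !quot_scaleE scalerDl.
by rewrite [RHS]quot_addE.
Qed.
HB.instance Definition _ := GRing.Zmodule_isLmodule.Build K quotm
  quot_scaleA quot_scale1 quot_scaleDr quot_scaleDl.

Lemma qpi_linear : linear qpi.
Proof.
move=> a x y; rewrite -[a *: qpi x]/(quot_scale _ _) quot_scaleE.
by rewrite [RHS]quot_addE.
Qed.

Lemma qpi_eq0 x : (qpi x = 0) <-> sm_set N x.
Proof. by rewrite -(lin0 qpi_linear) qpiP subr0. Qed.

End QuotientModule.

Definition restr (K L : nzRingType) (f : {rmorphism K -> L}) (M : lmodType L)
  : Type := M.

Section Restriction.
Context (K L : nzRingType) (f : {rmorphism K -> L}) (M : lmodType L).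

Local Notation restr := (restr f M).
HB.instance Definition _ := GRing.Zmodule.on restr.

Definition restr_scale (a : K) (x : restr) : restr := f a *: (x : M).

Fact restr_scaleA a b u : restr_scale a (restr_scale b u) = restr_scale (a * b) u.
Proof. by rewrite /restr_scale scalerA rmorphM. Qed.
Fact restr_scale1 : left_id 1 restr_scale.
Proof. by move=> u; rewrite /restr_scale rmorph1 scale1r. Qed.
Fact restr_scaleDr : right_distributive restr_scale +%R.
Proof. by move=> a u v; rewrite /restr_scale scalerDr. Qed.
Fact restr_scaleDl u : {morph restr_scale^~ u : a b / a + b}.
Proof. by move=> a b; rewrite /restr_scale rmorphD scalerDl. Qed.
HB.instance Definition _ := GRing.Zmodule_isLmodule.Build K restr
  restr_scaleA restr_scale1 restr_scaleDr restr_scaleDl.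

Lemma restrE (a : K) (x : restr) : a *: x = f a *: (x : M).
Proof. by []. Qed.

End Restriction.

(* The module presented by generators [k : K] and relations [R]. *)
Section Presented.
Context (V : comNzRingType).

Definition flift (K : choiceType) (P : lmodType V) (h : K -> P)
  (x : {malg V[K]}) : P := \sum_(k <- msupp x) x@_k *: h k.

Definition fgen (K : choiceType) (k : K) : {malg V[K]} := << (1 : V) *g k >>.

Section Free.
Context (K : choiceType) (P : lmodType V) (h : K -> P).

Lemma flift_widen (d : {fset K}) (x : {malg V[K]}) :
  (msupp x `<=` d)%fset -> flift h x = \sum_(k <- d) x@_k *: h k.
Proof.
move=> sub; rewrite /flift (big_fset_incl _ sub) //= => k _ /mcoeff_outdom ->.
by rewrite scale0r.
Qed.

Lemma flift_linear : linear (flift h).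
Proof.
move=> a x y; pose d := (msupp x `|` msupp y `|` msupp (a *: x + y))%fset.
rewrite (@flift_widen d (_ + _)) ?fsubsetUr // (@flift_widen d x); last first.
  by rewrite /d -fsetUA fsubsetUl.
rewrite (@flift_widen d y); last by rewrite /d fsetUAC fsubsetUr.
rewrite scaler_sumr -big_split /=; apply: eq_bigr => k _.
by rewrite mcoeffD mcoeffZ scalerDl scalerA.
Qed.

Lemma flift_gen k : flift h (fgen k) = h k.
Proof.
rewrite (@flift_widen [fset k]%fset) ?msuppU_le // big_seq_fset1 mcoeffUU.
by rewrite scale1r.
Qed.

End Free.

Lemma fgen_span (K : choiceType) (x : {malg V[K]}) : span (range (@fgen K)) x.
Proof.
rewrite [x]monalgE; apply: submod_sum; first exact: span_submod.
move=> k _; have -> : << x@_k *g k >> = x@_k *: fgen k.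
  by apply/malgP => l; rewrite mcoeffZ !mcoeffU mulrnAr mulr1.
by apply: submodZ (span_submod _) _ _ _; apply: sub_span; exists k.
Qed.

Definition pmod (K : choiceType) (R : set {malg V[K]}) : lmodType V :=
  quotm (span_sub R).

Section Pmod.
Context (K : choiceType) (R : set {malg V[K]}).

Definition pgen (k : K) : pmod R := qpi (span_sub R) (fgen k).

Definition plift (P : lmodType V) (h : K -> P) (x : pmod R) : P :=
  flift h (repr x).

Lemma pgen_span (x : pmod R) : span (range pgen) x.
Proof.
rewrite -(qreprK x); move: (repr x) (fgen_span (repr x)) => y.
apply: image_span; first exact: qpi_linear.
by move=> _ [k _ <-]; apply: sub_span; exists k.
Qed.

Lemma pmod_ext (P : lmodType V) (f g : pmod R -> P) :
  linear f -> linear g -> (forall k, f (pgen k) = g (pgen k)) -> f =1 g.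
Proof.
move=> lf lg h x; apply: (span_min (eq_submod lf lg) _ (pgen_span x)).
by move=> _ [k _ <-] /=.
Qed.

Lemma prel r : R r -> qpi (span_sub R) r = 0.
Proof. by move=> Rr; apply/qpi_eq0; exact: sub_span. Qed.

Section Lift.
Context (P : lmodType V) (h : K -> P).
Hypothesis hR : forall r, R r -> flift h r = 0.

Lemma plift_pi x : plift h (qpi (span_sub R) x) = flift h x.
Proof.
have := @qrepr_pi _ _ (span_sub R) x; rewrite /= => hx; apply/eqP.
rewrite -subr_eq0 -(linB (flift_linear h)); apply/eqP.
have := span_min (preimage_submod (flift_linear h) (S := [set 0]) _) _ hx.
apply; last by move=> r /hR.
by split=> //= a u v -> ->; rewrite scaler0 addr0.
Qed.

Lemma plift_linear : linear (plift h).
Proof.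
move=> a x y; rewrite -(qreprK x) -(qreprK y) -qpi_linear !plift_pi.
exact: flift_linear.
Qed.

Lemma plift_gen k : plift h (pgen k) = h k.
Proof. by rewrite plift_pi flift_gen. Qed.

End Lift.

Lemma plift_comb (P : lmodType V) a (h1 h2 : K -> P) x :
  plift (fun k => a *: h1 k + h2 k) x = a *: plift h1 x + plift h2 x.
Proof.
rewrite /plift /flift scaler_sumr -big_split /=; apply: eq_bigr => k _.
by rewrite scalerDr !scalerA mulrC.
Qed.

Lemma eq_plift (P : lmodType V) (h1 h2 : K -> P) x :
  h1 =1 h2 -> plift h1 x = plift h2 x.
Proof. by move=> h; apply: eq_bigr => k _; rewrite h. Qed.

End Pmod.
End Presented.

Section Tensor.
Context (V : comNzRingType).

Definition tenrel (M N : lmodType V) : set {malg V[(M * N)%type]} := [set r |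
  (exists a x x' y,
     r = fgen V (a *: x + x', y) - (a *: fgen V (x, y) + fgen V (x', y))) \/
  (exists a x y y',
     r = fgen V (x, a *: y + y') - (a *: fgen V (x, y) + fgen V (x, y')))].

Definition ten (M N : lmodType V) : lmodType V := pmod (@tenrel M N).

Definition tens (M N : lmodType V) (x : M) (y : N) : ten M N :=
  pgen (@tenrel M N) (x, y).

Definition bilin (M N P : lmodType V) (f : M -> N -> P) : Prop :=
  (forall x, linear (f x)) /\ (forall y, linear (f^~ y)).

Definition tlift (M N P : lmodType V) (f : M -> N -> P) : ten M N -> P :=
  plift (fun p => f p.1 p.2).

Section Theory.
Context (M N : lmodType V).

Lemma tens_bilin : bilin (@tens M N).
Proof.
split=> [x a y y'|y a x x']; apply/eqP; rewrite -subr_eq0; apply/eqP;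
  rewrite /tens /pgen -!qpi_linear -(linB (qpi_linear _)); apply: prel.
- by right; exists a, x, y, y'.
- by left; exists a, x, x', y.
Qed.

Lemma tens_span (z : ten M N) : span [set t | exists x y, t = tens x y] z.
Proof.
apply: span_mono (pgen_span z) => _ [[x y] _ <-].
by exists x, y.
Qed.

Context (P : lmodType V).

Lemma ten_ext (f g : ten M N -> P) : linear f -> linear g ->
  (forall x y, f (tens x y) = g (tens x y)) -> f =1 g.
Proof. by move=> lf lg h; apply: pmod_ext => // -[x y]; exact: h. Qed.

Context (f : M -> N -> P) (bf : bilin f).

Let tlift_rel r : @tenrel M N r -> flift (fun p => f p.1 p.2) r = 0.
Proof.
have fl := flift_linear (fun p : M * N => f p.1 p.2).
case=> [[a [x [x' [y ->]]]]|[a [x [y [y' ->]]]]];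
  by rewrite (linB fl) fl !flift_gen /= ?(bf.1 x) ?(bf.2 y) subrr.
Qed.

Lemma tlift_linear : linear (tlift f).
Proof. exact: plift_linear tlift_rel. Qed.

Lemma tlift_tens x y : tlift f (tens x y) = f x y.
Proof. exact: plift_gen tlift_rel _. Qed.

End Theory.

Lemma tlift_comb (M N P : lmodType V) a (f g : M -> N -> P) z :
  tlift (fun x y => a *: f x y + g x y) z = a *: tlift f z + tlift g z.
Proof. exact: plift_comb. Qed.

Lemma eq_tlift (M N P : lmodType V) (f g : M -> N -> P) z :
  (forall x y, f x y = g x y) -> tlift f z = tlift g z.
Proof. by move=> h; apply: eq_plift => -[x y]; exact: h. Qed.

End Tensor.

Record nualg (V : comNzRingType) := NuAlg {
  na_mod :> lmodType V;
  na_mul : na_mod -> na_mod -> na_mod;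
  na_bilin : bilin na_mul;
  na_mulA : associative na_mul
}.

Notation "x ** y" := (na_mul x y) (at level 40, left associativity).

Section NuAlgTheory.
Context (V : comNzRingType) (A : nualg V).
Implicit Types x y z : A.

Lemma na_lin1 x : linear (na_mul x).
Proof. exact: (na_bilin A).1. Qed.

Lemma na_lin2 y : linear (fun x => x ** y).
Proof. exact: (na_bilin A).2. Qed.

Definition mulset (S T : set A) : set A :=
  [set z | exists x y, [/\ S x, T y & z = x ** y]].

Definition aprod x (s : seq A) : A := foldl (@na_mul V A) x s.

(* The case [k = 0] follows the convention [I^0 = R] for an ideal [I] of [R]. *)
Definition apow (S : set A) (k : nat) : set A :=
  if k is k'.+1 then
    span [set z | exists x s, [/\ size s = k', S x,
                                 (forall y, y \in s -> S y) & z = aprod x s]]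
  else setT.

Lemma apow_submod S k : is_submod (apow S k).
Proof. by case: k => [|k]; [exact: submodT|exact: span_submod]. Qed.

Lemma aprod_mul x y s : x ** aprod y s = aprod (x ** y) s.
Proof.
rewrite /aprod; elim/last_ind: s => [//|s z IH].
by rewrite -!cats1 !foldl_cat /= na_mulA IH.
Qed.

Lemma aprod_cat x s y t : aprod x (s ++ y :: t) = aprod x s ** aprod y t.
Proof. by rewrite aprod_mul /aprod foldl_cat. Qed.

Lemma span_mulset (S T U : set A) : is_submod U ->
  (forall x y, S x -> T y -> U (x ** y)) ->
  forall x y, span S x -> span T y -> U (x ** y).
Proof.
move=> hU h x y Sx Ty.
apply: (span_min (N := [set x | U (x ** y)]) _ _ Sx).
  exact: preimage_submod (na_lin2 y) hU.
move=> {Sx}x Sx /=.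
apply: (span_min (N := [set y | U (x ** y)]) _ _ Ty).
  exact: preimage_submod (na_lin1 x) hU.
by move=> z Tz /=; exact: h.
Qed.

Lemma apowM S i j x y : apow S i.+1 x -> apow S j.+1 y ->
  apow S (i.+1 + j.+1) (x ** y).
Proof.
apply: span_mulset; first exact: apow_submod.
move=> _ _ [x0 [s [szs Sx0 Ss ->]]] [y0 [t [szt Sy0 St ->]]].
rewrite -aprod_cat addSn; apply: sub_span; exists x0, (s ++ y0 :: t); split=> //.
  by rewrite size_cat /= szs szt.
by move=> z; rewrite mem_cat inE => /or3P[/Ss|/eqP->|/St].
Qed.

Lemma apow_mono S T k : S `<=` T -> apow S k `<=` apow T k.
Proof.
case: k => // k ST; apply: span_mono => z [x [s [? Sx Ss ->]]].
by exists x, s; split=> //; [exact: ST|move=> y /Ss /ST].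
Qed.

End NuAlgTheory.

Record ideal (V : comNzRingType) (A : nualg V) := Ideal {
  id_sub :> submodule A;
  id_mull : forall a x, sm_set id_sub x -> sm_set id_sub (a ** x);
  id_mulr : forall x a, sm_set id_sub x -> sm_set id_sub (x ** a)
}.

Definition full_ideal (V : comNzRingType) (A : nualg V) : ideal A :=
  @Ideal V A (Submodule (submodT A)) (fun _ _ _ => I) (fun _ _ _ => I).

Section IdealPowers.
Context (V : comNzRingType) (A : nualg V) (I : ideal A).

Lemma apow_ideal_l k a x : apow I k x -> apow I k (a ** x).
Proof.
case: k => // k; apply: (image_span (f := na_mul a)); first exact: na_lin1.
move=> _ [x0 [s [szs Ix0 Is ->]]]; rewrite aprod_mul.
by apply: sub_span; exists (a ** x0), s; split=> //; exact: id_mull.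
Qed.

Lemma apow_ideal_r k a x : apow I k x -> apow I k (x ** a).
Proof.
case: k => // k; apply: (image_span (f := fun x => x ** a)); first exact: na_lin2.
move=> _ [x0 [s [szs Ix0 Is ->]]]; apply: sub_span.
case/lastP: s szs Is => [|s z] szs Is.
  by exists (x0 ** a), [::]; split=> //; exact: id_mulr.
exists x0, (rcons s (z ** a)); split=> //.
- by rewrite size_rcons -szs size_rcons.
- move=> y; rewrite mem_rcons inE => /orP[/eqP->|ys].
    by apply: id_mulr; apply: Is; rewrite mem_rcons mem_head.
  by apply: Is; rewrite mem_rcons inE ys orbT.
by rewrite /aprod -!cats1 !foldl_cat /= na_mulA.
Qed.

Lemma apow_idealM i j x y : apow I i x -> apow I j y -> apow I (i + j) (x ** y).
Proof.
case: i j => [|i] [|j] // Ix Iy; [exact: apow_ideal_l| |exact: apowM].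
by rewrite addn0; exact: apow_ideal_r.
Qed.

Lemma apow_decr i j : (i <= j)%N -> apow I j `<=` apow I i.
Proof.
move=> /subnK <-; elim: (j - i)%N => [//|n IH]; rewrite addSn => x hx.
apply: IH; move: (n + i)%N hx => {}n; case: n => // n.
apply: span_min (span_submod _) _ _ => _ [x0 [s [szs Ix0 Is ->]]].
case: s szs Is => [//|x1 s] /= [szs] Is; apply: sub_span; exists (x0 ** x1), s; split=> //.
  exact: id_mulr.
by move=> y ys; apply: Is; rewrite inE ys orbT.
Qed.

End IdealPowers.

Section TensorAlgebraProduct.
Context (V : comNzRingType) (A B : nualg V).

Definition ten_mul (X Y : ten A B) : ten A B :=
  tlift (fun a b => tlift (fun a' b' => tens (a ** a') (b ** b')) Y) X.

Let inner_bilin a b :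
  bilin (fun (a' : A) (b' : B) => tens (a ** a') (b ** b')).
Proof.
have [t1 t2] := tens_bilin A B.
by split=> [a' c x y|b' c x y]; rewrite na_lin1 ?t1 ?t2.
Qed.

Let outer_bilin Y : bilin (fun (a : A) (b : B) =>
  tlift (fun a' b' => tens (a ** a') (b ** b')) Y).
Proof.
have [t1 t2] := tens_bilin A B.
split=> [a c x y|b c x y]; rewrite -tlift_comb; apply: eq_tlift => a' b'.
  by rewrite (na_lin2 b') t1.
by rewrite (na_lin2 a') t2.
Qed.

Lemma ten_mulE a b a' b' :
  ten_mul (tens a b) (tens a' b') = tens (a ** a') (b ** b').
Proof.
by rewrite /ten_mul (tlift_tens (outer_bilin _)) (tlift_tens (inner_bilin _ _)).
Qed.

Lemma ten_mul_bilin : bilin ten_mul.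
Proof.
split=> [X c Y Z|Y]; last exact: tlift_linear (outer_bilin Y).
rewrite /ten_mul -tlift_comb; apply: eq_tlift => a b.
exact: tlift_linear (inner_bilin a b) _ _ _.
Qed.

Lemma comp_linear (M N P : lmodType V) (f : N -> P) (g : M -> N) :
  linear f -> linear g -> linear (fun x => f (g x)).
Proof. by move=> lf lg a x y; rewrite lg lf. Qed.

Lemma ten_mulA : associative ten_mul.
Proof.
have [l1 l2] := ten_mul_bilin.
move=> X Y Z; move: X; apply: ten_ext.
- exact: l2.
- by apply: (comp_linear (f := ten_mul^~ Z)); exact: l2.
move=> a b; move: Y; apply: ten_ext.
- by apply: (comp_linear (f := ten_mul _)) => //; exact: l2.
- by apply: (comp_linear (f := ten_mul^~ Z)); [exact: l2|exact: l1].
move=> a' b'; move: Z; apply: ten_ext.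
- by apply: (comp_linear (f := ten_mul _)); exact: l1.
- exact: l1.
by move=> a'' b''; rewrite !ten_mulE !na_mulA.
Qed.

Definition ten_nualg : nualg V := NuAlg ten_mul_bilin ten_mulA.

End TensorAlgebraProduct.

(* [tmod W] is the direct sum over [n >= 1] of the [n]-fold tensor powers of [W],
   all presented at once: the generators are the nonempty words, the word
   [(x_1, [:: x_2; ...; x_n])] stands for [x_1 (x) ... (x) x_n], and the relations
   are multilinearity in each letter, which never change the length. *)
Section TensorAlgebra.
Context (V : comNzRingType) (W : lmodType V).

Definition word : choiceType := (W * seq W)%type.
Definition letters (w : word) : seq W := w.1 :: w.2.
Definition wcat (w w' : word) : word := (w.1, w.2 ++ letters w').

(* the word [u x v] *)
Definition wslot (u : seq W) (x : W) (v : seq W) : word :=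
  if u is y :: u' then (y, u' ++ x :: v) else (x, v).

Definition wordrel : set {malg V[word]} := [set r |
  exists u v a x y, r = fgen V (wslot u (a *: x + y) v) -
    (a *: fgen V (wslot u x v) + fgen V (wslot u y v))].

Definition tmod : lmodType V := pmod wordrel.
Definition tword (w : word) : tmod := pgen wordrel w.

Lemma wcatA u v w : wcat u (wcat v w) = wcat (wcat u v) w.
Proof. by rewrite /wcat /= -catA. Qed.

Lemma wcat_slot_l w u x v : wcat w (wslot u x v) = wslot (letters w ++ u) x v.
Proof. by rewrite /wcat /letters; case: u => [|y u] /=; rewrite ?cats0 -?catA. Qed.

Lemma wcat_slot_r w u x v : wcat (wslot u x v) w = wslot u x (v ++ letters w).
Proof. by rewrite /wcat /letters; case: u => [|y u] //=; rewrite -?catA. Qed.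

Lemma tword_lin u v a x y : tword (wslot u (a *: x + y) v) =
  a *: tword (wslot u x v) + tword (wslot u y v).
Proof.
apply/eqP; rewrite -subr_eq0; apply/eqP.
rewrite /tword /pgen -!qpi_linear -(linB (qpi_linear _)); apply: prel.
by exists u, v, a, x, y.
Qed.

Definition multilin (P : lmodType V) (f : word -> P) : Prop :=
  forall u v a x y,
    f (wslot u (a *: x + y) v) = a *: f (wslot u x v) + f (wslot u y v).

Lemma multilin_rel (P : lmodType V) (f : word -> P) : multilin f ->
  forall r, wordrel r -> flift f r = 0.
Proof.
move=> mf _ [u [v [a [x [y ->]]]]]; have fl := flift_linear f.
by rewrite (linB fl) fl !flift_gen mf subrr.
Qed.

Definition tmul (X Y : tmod) : tmod :=
  plift (fun w => plift (fun w' => tword (wcat w w')) Y) X.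

Let inner_multilin w : multilin (fun w' => tword (wcat w w')).
Proof. by move=> u v a x y; rewrite !wcat_slot_l tword_lin. Qed.

Let outer_multilin (Y : tmod) :
  multilin (fun w => plift (fun w' => tword (wcat w w')) Y).
Proof.
move=> u v a x y; rewrite -plift_comb; apply: eq_plift => w'.
by rewrite !wcat_slot_r tword_lin.
Qed.

Lemma tmulE w w' : tmul (tword w) (tword w') = tword (wcat w w').
Proof.
rewrite /tmul (plift_gen (multilin_rel (outer_multilin _))).
by rewrite (plift_gen (multilin_rel (inner_multilin _))).
Qed.

Lemma tmul_bilin : bilin tmul.
Proof.
split=> [X c Y Z|Y]; last exact: plift_linear (multilin_rel (outer_multilin Y)).
rewrite /tmul -plift_comb; apply: eq_plift => w.
exact: plift_linear (multilin_rel (inner_multilin w)) _ _ _.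
Qed.

Lemma tmulA : associative tmul.
Proof.
have [l1 l2] := tmul_bilin.
move=> X Y Z; move: X; apply: pmod_ext.
- exact: l2.
- by apply: (comp_linear (f := tmul^~ Z)); exact: l2.
move=> w; move: Y; apply: pmod_ext.
- by apply: (comp_linear (f := tmul _)) => //; exact: l2.
- by apply: (comp_linear (f := tmul^~ Z)); [exact: l2|exact: l1].
move=> w'; move: Z; apply: pmod_ext.
- by apply: (comp_linear (f := tmul _)); exact: l1.
- exact: l1.
by move=> w''; rewrite -!/(tword _) !tmulE wcatA.
Qed.

Definition talg : nualg V := NuAlg tmul_bilin tmulA.

Section Hom.
Context (B : nualg V) (f : W -> B).

Definition wprod (w : word) : B := aprod (f w.1) (map f w.2).

Definition thom : talg -> B := plift wprod.

Lemma wprod_cat w w' : wprod (wcat w w') = wprod w ** wprod w'.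
Proof. by rewrite /wprod /wcat /= map_cat /= aprod_cat. Qed.

Hypothesis lf : linear f.

Lemma wprod_multilin : multilin wprod.
Proof.
have aprod_lin s : linear (fun x : B => aprod x s).
  elim: s => [//|y s IH] a u v.
  by rewrite /aprod /= (na_lin2 y); exact: IH.
move=> [|u0 u] v a x y; rewrite /wprod /= ?lf ?aprod_lin //.
rewrite !map_cat /= !aprod_cat lf aprod_lin.
exact: na_lin1.
Qed.

Lemma thom_linear : linear thom.
Proof. exact: plift_linear (multilin_rel wprod_multilin). Qed.

Lemma thom_word w : thom (tword w) = wprod w.
Proof. exact: plift_gen (multilin_rel wprod_multilin) _. Qed.

Lemma thom_mul x y : thom (x ** y) = thom x ** thom y.
Proof.
have [l1 l2] := tmul_bilin; have lt := thom_linear.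
move: x; apply: pmod_ext.
- by apply: (comp_linear (f := thom)) => //; exact: l2.
- by apply: (comp_linear (f := fun x => x ** thom y)) => //; exact: na_lin2.
move=> w; move: y; apply: pmod_ext.
- by apply: (comp_linear (f := thom)) => //; exact: l1.
- by apply: (comp_linear (f := na_mul _)) => //; exact: na_lin1.
move=> w'; rewrite -!/(tword _) -[_ ** _]/(tmul _ _) tmulE !thom_word.
exact: wprod_cat.
Qed.

Definition thom_ker : set talg := [set x | thom x = 0].

Fact thom_ker_submod : is_submod thom_ker.
Proof.
have lt := thom_linear; split=> [|a x y hx hy]; first exact: lin0.
by rewrite /thom_ker /= lt hx hy scaler0 addr0.
Qed.

Fact thom_ker_mull a x : thom_ker x -> thom_ker (a ** x).
Proof. by rewrite /thom_ker /= thom_mul => ->; exact: lin0 (na_lin1 _). Qed.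

Fact thom_ker_mulr x a : thom_ker x -> thom_ker (x ** a).
Proof. by rewrite /thom_ker /= thom_mul => ->; exact: lin0 (na_lin2 _). Qed.

Definition kernel_ideal : ideal talg :=
  @Ideal V talg (Submodule thom_ker_submod) thom_ker_mull thom_ker_mulr.

End Hom.
End TensorAlgebra.

Section Bornology.
Context (V : comNzRingType).

Record bornology (M : lmodType V) := Bornology {
  bounded : set M -> Prop;
  bounded_finite : forall S, finite_set S -> bounded S;
  bounded_sub : forall S T, S `<=` T -> bounded T -> bounded S;
  bounded_setU : forall S T, bounded S -> bounded T -> bounded (S `|` T);
  bounded_span : forall S, bounded S -> bounded (span S)
}.

Lemma finite_set_ind (T : choiceType) (P : set T -> Prop) :
  P set0 -> (forall x, P [set x]) ->
  (forall S S', P S -> P S' -> P (S `|` S')) ->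
  forall S, finite_set S -> P S.
Proof.
move=> P0 P1 PU S /finite_seqP[s ->]; elim: s => [|x s IH].
  by have -> : [set` [::]] = set0 :> set T by apply/seteqP; split.
have -> : [set` x :: s] = [set x] `|` [set` s] :> set T; last exact: PU.
apply/seteqP; split=> y /=; rewrite inE; first by case/orP=> [/eqP->|]; [left|right].
by case=> [->|->]; rewrite ?eqxx ?orbT.
Qed.

Lemma bounded_bigU (M : lmodType V) (b : bornology M) (F : nat -> set M) n :
  (forall i, bounded b (F i)) -> bounded b [set x | exists2 i, (i < n)%N & F i x].
Proof.
move=> hF; elim: n => [|n IH].
  by apply: bounded_sub (bounded_finite b (finite_set0 _)) => x [].
apply: bounded_sub (bounded_setU IH (hF n)) => x [i].
rewrite ltnS leq_eqVlt => /orP[/eqP->|lt_in] Fx; [by right|left].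
by exists i.
Qed.

Record bornMod := BornMod {
  bm_mod :> lmodType V;
  bm_born : bornology bm_mod
}.

Definition bdd (M : bornMod) (S : set M) : Prop := bounded (bm_born M) S.

Definition bsub (M : bornMod) (S : set M) : Prop := is_submod S /\ bdd S.

Lemma bsub_span (M : bornMod) (S : set M) : bdd S -> bsub (span S).
Proof. by move=> bS; split; [exact: span_submod|exact: bounded_span]. Qed.

Record bhom (M N : bornMod) := BHom {
  bh_fun :> M -> N;
  bh_lin : linear bh_fun;
  bh_bdd : forall S, bdd S -> bdd (bh_fun @` S)
}.

Lemma bhom_id_subproof (M : bornMod) (S : set M) : bdd S -> bdd (id @` S).
Proof. by rewrite image_id. Qed.
Definition bhom_id (M : bornMod) : bhom M M :=
  @BHom M M id (fun _ _ _ => erefl) (@bhom_id_subproof M).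

Lemma bhom_comp_subproof (M N P : bornMod) (g : bhom N P) (f : bhom M N) S :
  bdd S -> bdd ((g \o f) @` S).
Proof. by rewrite -image_comp => bS; do 2 apply: bh_bdd. Qed.
Definition bhom_comp (M N P : bornMod) (g : bhom N P) (f : bhom M N) :
  bhom M P :=
  @BHom M P (g \o f) (comp_linear (bh_lin g) (bh_lin f))
    (@bhom_comp_subproof M N P g f).

Lemma bhom_zero_lin (M N : bornMod) : linear (fun _ : M => 0 : N).
Proof. by move=> a x y; rewrite scaler0 addr0. Qed.
Lemma bhom_zero_subproof (M N : bornMod) (S : set M) :
  bdd S -> bdd ((fun _ : M => 0 : N) @` S).
Proof.
move=> _; apply: bounded_sub (bounded_finite _ (finite_set1 (0 : N))).
by move=> _ [x _ <-].
Qed.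
Definition bhom_zero (M N : bornMod) : bhom M N :=
  BHom (@bhom_zero_lin M N) (@bhom_zero_subproof M N).

Section Fine.
Context (M : lmodType V).
Definition fg_set (S : set M) : Prop := exists2 T, finite_set T & S `<=` span T.
Fact fine_finite S : finite_set S -> fg_set S.
Proof. by move=> fS; exists S => //; exact: sub_span. Qed.
Fact fine_sub S T : S `<=` T -> fg_set T -> fg_set S.
Proof. by move=> ST [U fU TU]; exists U => //; exact: subset_trans TU. Qed.
Fact fine_setU S T : fg_set S -> fg_set T -> fg_set (S `|` T).
Proof.
move=> [S' fS SS] [T' fT TT]; exists (S' `|` T').
  by rewrite finite_setU.
move=> x [/SS|/TT]; apply: span_mono => y; [by left|by right].
Qed.
Fact fine_span S : fg_set S -> fg_set (span S).
Proof.
by move=> [T fT ST]; exists T => //; exact: span_min (span_submod T) ST.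
Qed.
Definition fine_born : bornology M :=
  Bornology fine_finite fine_sub fine_setU fine_span.
End Fine.

Section Subspace.
Context (M : bornMod) (S : submodule M).
Definition sub_bounded (X : set (subm S)) : Prop := bdd (val @` X).
Fact sub_bounded_finite X : finite_set X -> sub_bounded X.
Proof. by move=> fX; apply: bounded_finite; exact: finite_image. Qed.
Fact sub_bounded_sub X Y : X `<=` Y -> sub_bounded Y -> sub_bounded X.
Proof. by move=> XY; apply: bounded_sub; exact: image_subset. Qed.
Fact sub_bounded_setU X Y :
  sub_bounded X -> sub_bounded Y -> sub_bounded (X `|` Y).
Proof. by move=> bX bY; rewrite /sub_bounded image_setU; exact: bounded_setU. Qed.
Fact sub_bounded_span X : sub_bounded X -> sub_bounded (span X).
Proof.
move=> bX; apply: bounded_sub (bounded_span bX) => _ [u Xu <-].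
apply: (image_span (f := val : subm S -> M) (S := X)) Xu => [|v Xv].
  exact: subm_val_linear.
by apply: sub_span; exists v.
Qed.
Definition sub_born : bornology (subm S) := Bornology
  sub_bounded_finite sub_bounded_sub sub_bounded_setU sub_bounded_span.
Definition sub_bmod : bornMod := BornMod sub_born.
End Subspace.

Section Quotient.
Context (M : bornMod) (N : submodule M).
Definition quot_bounded (X : set (quotm N)) : Prop :=
  exists2 S, bdd S & X = qpi N @` S.
Fact quot_bounded_sub X Y : X `<=` Y -> quot_bounded Y -> quot_bounded X.
Proof.
move=> XY [S bS YS]; exists (S `&` [set x | X (qpi N x)]).
  by apply: bounded_sub bS => x [].
apply/seteqP; split=> [u Xu|_ [x [Sx Xx] <-] //].
by have := XY _ Xu; rewrite YS => -[x Sx xu]; exists x => //; split=> //=; rewrite xu.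
Qed.
Fact quot_bounded_finite X : finite_set X -> quot_bounded X.
Proof.
move=> fX; exists (repr @` X); first by apply: bounded_finite; exact: finite_image.
rewrite image_comp; apply/seteqP; split=> [u Xu|_ [u Xu <-]] /=.
  by exists u => //=; exact: qreprK.
by rewrite qreprK.
Qed.
Fact quot_bounded_setU X Y :
  quot_bounded X -> quot_bounded Y -> quot_bounded (X `|` Y).
Proof.
move=> [S bS ->] [T bT ->]; exists (S `|` T); first exact: bounded_setU.
by rewrite image_setU.
Qed.
Fact quot_bounded_span X : quot_bounded X -> quot_bounded (span X).
Proof.
move=> [S bS ->]; apply: (@quot_bounded_sub _ (qpi N @` span S)); last first.
  by exists (span S) => //; exact: bounded_span.
apply: span_min; first exact: image_submod (@qpi_linear _ _ N) (span_submod S).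
by apply: image_subset; exact: sub_span.
Qed.
Definition quot_born : bornology (quotm N) := Bornology
  quot_bounded_finite quot_bounded_sub quot_bounded_setU quot_bounded_span.
Definition quot_bmod : bornMod := BornMod quot_born.
End Quotient.

Section TensorBornology.
Context (M N : bornMod).

(* The image of [S (x) T] in [M (x) N]. *)
Definition tens_img (S : set M) (T : set N) : set (ten M N) :=
  span [set t | exists x y, [/\ S x, T y & t = tens x y]].

Lemma tens_img_mono S S' T T' :
  S `<=` S' -> T `<=` T' -> tens_img S T `<=` tens_img S' T'.
Proof.
move=> SS TT; apply: span_mono => _ [x [y [Sx Ty ->]]].
by exists x, y; split; [exact: SS|exact: TT|].
Qed.

Definition ten_bounded (X : set (ten M N)) : Prop :=
  exists S T, [/\ bsub S, bsub T & X `<=` tens_img S T].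
Fact ten_bounded_sub X Y : X `<=` Y -> ten_bounded Y -> ten_bounded X.
Proof.
move=> XY [S [T [bS bT YST]]]; exists S, T; split=> //.
exact: subset_trans YST.
Qed.
Fact ten_bounded_setU X Y : ten_bounded X -> ten_bounded Y -> ten_bounded (X `|` Y).
Proof.
move=> [S [T [bS bT XST]]] [S' [T' [bS' bT' YST]]].
exists (span (S `|` S')), (span (T `|` T')); split.
- by apply: bsub_span; apply: bounded_setU; [case: bS|case: bS'].
- by apply: bsub_span; apply: bounded_setU; [case: bT|case: bT'].
by move=> x [/XST|/YST]; apply: tens_img_mono => y hy; apply: sub_span;
  (by left) || (by right).
Qed.
Fact ten_bounded_span X : ten_bounded X -> ten_bounded (span X).
Proof.
move=> [S [T [bS bT XST]]]; exists S, T; split=> //.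
exact: span_min (span_submod _) XST.
Qed.
Fact ten_bounded_finite X : finite_set X -> ten_bounded X.
Proof.
have b0 : ten_bounded set0.
  exists (span set0), (span set0); split=> //;
    by apply: bsub_span; exact: bounded_finite.
apply: finite_set_ind => //; last exact: ten_bounded_setU.
move=> z; apply: (span_min (N := [set z | ten_bounded [set z]])) (tens_span z).
  split=> /= [|a x y bx by_].
    apply: ten_bounded_sub (ten_bounded_span b0) => _ ->.
    exact: (span_submod _).1.
  apply: ten_bounded_sub (ten_bounded_span (ten_bounded_setU bx by_)) => _ ->.
  by apply: (span_submod _).2; apply: sub_span; [left|right].
move=> _ [x [y ->]] /=; exists (span [set x]), (span [set y]); split.
- by apply: bsub_span; exact: bounded_finite.
- by apply: bsub_span; exact: bounded_finite.
by move=> _ ->; apply: sub_span; exists x, y; split=> //; exact: sub_span.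
Qed.
Definition ten_born : bornology (ten M N) := Bornology
  ten_bounded_finite ten_bounded_sub ten_bounded_setU ten_bounded_span.
End TensorBornology.

Section TensorAlgebraBornology.
Context (W : bornMod).

(* The image of [B_0 (x) ... (x) B_(n-1)] in the [n]-fold tensor power. *)
Definition word_img (n : nat) (B : nat -> set W) : set (talg W) :=
  span [set t | exists w, [/\ size (letters w) = n,
    (forall i, (i < n)%N -> B i (nth 0 (letters w) i)) & t = tword w]].

(* A finite sum, over [n <= N], of bounded submodules of the tensor powers. *)
Definition talg_bounded (X : set (talg W)) : Prop :=
  exists (N : nat) (B : nat -> nat -> set W),
    (forall n i, bsub (B n i)) /\
    X `<=` span [set t | exists2 n, (n <= N)%N & word_img n (B n) t].

Definition words_le (N : nat) (B : set W) : set (talg W) :=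
  [set t | exists w, [/\ (size (letters w) <= N)%N,
    (forall x, x \in letters w -> B x) & t = tword w]].

Lemma talg_boundedP X : talg_bounded X <->
  exists N B, bsub B /\ X `<=` span (words_le N B).
Proof.
split=> [[N [B [bB XB]]]|[N [B [bB XB]]]].
  pose B' := [set x | exists2 n, (n < N.+1)%N &
                      exists2 i, (i < N.+1)%N & B n i x].
  have bB' : bdd B'.
    by apply: bounded_bigU => n; apply: bounded_bigU => i; case: (bB n i).
  exists N, (span B'); split; first exact: bsub_span.
  apply: subset_trans XB _; apply: span_min; first exact: span_submod.
  move=> t [n nN]; apply: span_mono => _ [w [szw hw ->]].
  exists w; split; rewrite ?szw // => x /(nthP 0)[i]; rewrite szw => lti <-.
  apply: sub_span; exists n => //; exists i; last exact: hw.
  by rewrite ltnS; apply: leq_trans nN; exact: ltnW.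
exists N, (fun _ _ => B); split=> //; apply: subset_trans XB _.
apply: span_mono => _ [w [szw hw ->]]; exists (size (letters w)) => //.
apply: sub_span; exists w; split=> // i lti; apply: hw; exact: mem_nth.
Qed.

Lemma words_le_mono N N' B B' : (N <= N')%N -> B `<=` B' ->
  words_le N B `<=` words_le N' B'.
Proof.
move=> NN BB _ [w [szw hw ->]]; exists w; split=> //; first exact: leq_trans NN.
by move=> x /hw/BB.
Qed.

Fact talg_bounded_sub X Y : X `<=` Y -> talg_bounded Y -> talg_bounded X.
Proof.
by move=> XY [N [B [bB YB]]]; exists N, B; split=> //; exact: subset_trans YB.
Qed.
Fact talg_bounded_setU X Y :
  talg_bounded X -> talg_bounded Y -> talg_bounded (X `|` Y).
Proof.
move=> /talg_boundedP[N [B [bB XB]]] /talg_boundedP[N' [B' [bB' YB]]].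
apply/talg_boundedP; exists (maxn N N'), (span (B `|` B')); split.
  by apply: bsub_span; apply: bounded_setU; [case: bB|case: bB'].
by move=> x [/XB|/YB]; apply: span_mono; apply: words_le_mono;
  rewrite ?leq_maxl ?leq_maxr // => y hy; apply: sub_span;
  (by left) || (by right).
Qed.
Fact talg_bounded_span X : talg_bounded X -> talg_bounded (span X).
Proof.
move=> [N [B [bB XB]]]; exists N, B; split=> //.
exact: span_min (span_submod _) XB.
Qed.
Fact talg_bounded_finite X : finite_set X -> talg_bounded X.
Proof.
have b0 : talg_bounded set0.
  apply/talg_boundedP; exists 0%N, (span set0); split=> //.
  by apply: bsub_span; exact: bounded_finite.
apply: finite_set_ind => //; last exact: talg_bounded_setU.
move=> z; apply: (span_min (N := [set z | talg_bounded [set z]])) (pgen_span z).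
  split=> /= [|a x y bx by_].
    apply: talg_bounded_sub (talg_bounded_span b0) => _ ->.
    exact: (span_submod _).1.
  apply: talg_bounded_sub (talg_bounded_span (talg_bounded_setU bx by_)) => _ ->.
  by apply: (span_submod _).2; apply: sub_span; [left|right].
move=> _ [w _ <-] /=; apply/talg_boundedP.
exists (size (letters w)), (span [set` letters w]); split.
  by apply: bsub_span; apply: bounded_finite; exact: finite_seq.
by move=> _ ->; apply: sub_span; exists w; split=> // x xw; exact: sub_span.
Qed.
Definition talg_born : bornology (talg W) := Bornology
  talg_bounded_finite talg_bounded_sub talg_bounded_setU talg_bounded_span.
End TensorAlgebraBornology.

Record bornAlg := BornAlg {
  ba_alg :> nualg V;
  ba_born : bornology ba_alg;
  ba_bdd : forall S T, bounded ba_born S -> bounded ba_born T ->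
    bounded ba_born (mulset S T)
}.

Definition ba_mod (A : bornAlg) : bornMod := BornMod (ba_born A).

Section FineAlgebra.
Context (A : nualg V).
Fact fine_alg_bdd (S T : set A) :
  fg_set S -> fg_set T -> fg_set (mulset S T).
Proof.
move=> [S' fS SS] [T' fT TT]; exists (mulset S' T').
  have -> : mulset S' T' = (fun p : A * A => p.1 ** p.2) @` (S' `*` T').
    apply/seteqP; split=> [_ [x [y [Sx Ty ->]]]|_ [[x y] [/= Sx Ty] <-]].
      by exists (x, y).
    by exists x, y.
  by apply: finite_image; exact: finite_setX.
move=> _ [x [y [/SS Sx /TT Ty ->]]]; apply: span_mulset Sx Ty.
  exact: span_submod.
by move=> u v Su Tv; apply: sub_span; exists u, v.
Qed.
Definition fine_alg : bornAlg := @BornAlg A (fine_born A) fine_alg_bdd.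
End FineAlgebra.

Section SubAlgebra.
Context (A : bornAlg) (S : submodule A).
Hypothesis Smul : forall x y, sm_set S x -> sm_set S y -> sm_set S (x ** y).

Definition sub_mul (u v : subm S) : subm S :=
  mksub (Smul (submP u) (submP v)).
Fact sub_mul_bilin : bilin sub_mul.
Proof.
by split=> x a u v; apply: val_inj; rewrite /= ?na_lin1 ?(na_lin2 (val x)).
Qed.
Fact sub_mulA : associative sub_mul.
Proof. by move=> u v w; apply: val_inj; rewrite /= na_mulA. Qed.
Definition sub_nualg : nualg V := NuAlg sub_mul_bilin sub_mulA.

Let b := @sub_born (ba_mod A) S.
Fact sub_alg_bdd (X Y : set sub_nualg) :
  bounded b X -> bounded b Y -> bounded b (mulset X Y).
Proof.
move=> bX bY; apply: bounded_sub (ba_bdd bX bY).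
move=> _ [_ [u [v [Xu Yv ->]]] <-]; exists (val u), (val v); split=> //.
- by exists u.
- by exists v.
Qed.
Definition sub_alg : bornAlg := BornAlg sub_alg_bdd.
End SubAlgebra.

Fact ideal_mul (A : bornAlg) (I : ideal A) x y :
  sm_set I x -> sm_set I y -> sm_set I (x ** y).
Proof. by move=> _; exact: id_mull. Qed.
Definition ideal_alg (A : bornAlg) (I : ideal A) : bornAlg :=
  @sub_alg A I (@ideal_mul A I).

Section TensorProductAlgebra.
Context (A B : bornAlg).
Let b := ten_born (ba_mod A) (ba_mod B).
Fact ten_alg_bdd (X Y : set (ten_nualg A B)) :
  bounded b X -> bounded b Y -> bounded b (mulset X Y).
Proof.
move=> [S [T [[_ bS] [_ bT] XST]]] [S' [T' [[_ bS'] [_ bT'] YST]]].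
exists (span (mulset S S')), (span (mulset T T')); split.
- by apply: bsub_span; exact: ba_bdd.
- by apply: bsub_span; exact: ba_bdd.
move=> _ [x [y [/XST Sx /YST Ty ->]]].
apply: (span_mulset (A := ten_nualg A B)) Sx Ty.
  exact: span_submod.
move=> _ _ [s [t [Ss Tt ->]]] [s' [t' [Ss' Tt' ->]]].
rewrite -[_ ** _]/(ten_mul _ _) ten_mulE; apply: sub_span.
exists (s ** s'), (t ** t'); split=> //; apply: sub_span.
- by exists s, s'.
- by exists t, t'.
Qed.
Definition ten_alg : bornAlg := BornAlg ten_alg_bdd.
End TensorProductAlgebra.

Section TensorAlg.
Context (W : bornMod).
Fact talg_bdd (X Y : set (talg W)) :
  talg_bounded X -> talg_bounded Y -> talg_bounded (mulset X Y).
Proof.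
move=> /talg_boundedP[N [B [bB XB]]] /talg_boundedP[N' [B' [bB' YB]]].
apply/talg_boundedP; exists (N + N')%N, (span (B `|` B')); split.
  by apply: bsub_span; apply: bounded_setU; [case: bB|case: bB'].
move=> _ [x [y [/XB Xx /YB Yy ->]]]; apply: span_mulset Xx Yy.
  exact: span_submod.
move=> _ _ [w [szw hw ->]] [w' [szw' hw' ->]].
rewrite -[_ ** _]/(tmul _ _) tmulE; apply: sub_span; exists (wcat w w'); split=> //.
  by rewrite -[letters _]/(letters w ++ letters w') size_cat leq_add.
move=> z; rewrite -[letters _]/(letters w ++ letters w') mem_cat => /orP[/hw|/hw'] hz;
  by apply: sub_span; (by left) || (by right).
Qed.
Definition tensor_alg : bornAlg := @BornAlg (talg W) (talg_born W) talg_bdd.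
End TensorAlg.

End Bornology.

(* [t] plays the role of the uniformiser. *)
Section LinearGrowth.
Context (V : comNzRingType) (t : V) (A : bornAlg V).

Definition lg_sum (T : set A) : set A :=
  span [set x | exists i y, apow T i.+1 y /\ x = t ^+ i *: y].

Definition linear_growth (S : set A) : Prop :=
  exists2 T, bsub (M := ba_mod A) T & S `<=` lg_sum T.

Lemma lg_sum_mono S T : S `<=` T -> lg_sum S `<=` lg_sum T.
Proof.
move=> ST; apply: span_mono => _ [i [y [Sy ->]]]; exists i, y; split=> //.
exact: apow_mono ST _ Sy.
Qed.

Lemma sub_apow1 (S : set A) : S `<=` apow S 1.
Proof. by move=> x Sx; apply: sub_span; exists x, [::]. Qed.

Lemma sub_lg_sum (S : set A) : S `<=` lg_sum S.
Proof.
move=> x Sx; apply: sub_span; exists 0%N, x; split; first exact: sub_apow1.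
by rewrite expr0 scale1r.
Qed.

Fact lg_finite S : finite_set S -> linear_growth S.
Proof.
move=> fS; exists (span S).
  by apply: (bsub_span (M := ba_mod A)); exact: bounded_finite.
by move=> x Sx; apply: sub_lg_sum; exact: sub_span.
Qed.
Fact lg_sub S T : S `<=` T -> linear_growth T -> linear_growth S.
Proof. by move=> ST [U bU TU]; exists U => //; exact: subset_trans TU. Qed.
Fact lg_setU S T : linear_growth S -> linear_growth T -> linear_growth (S `|` T).
Proof.
move=> [S' [_ bS] SS] [T' [_ bT] TT]; exists (span (S' `|` T')).
  by apply: (bsub_span (M := ba_mod A)); exact: bounded_setU.
by move=> x [/SS|/TT]; apply: lg_sum_mono => y hy; apply: sub_span;
  (by left) || (by right).
Qed.
Fact lg_span S : linear_growth S -> linear_growth (span S).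
Proof.
by move=> [T bT ST]; exists T => //; exact: span_min (span_submod _) ST.
Qed.
Definition lg_born : bornology A := Bornology lg_finite lg_sub lg_setU lg_span.

Lemma apow_merge (S T U : set A) i j x y :
  S `<=` U -> T `<=` U -> mulset S T `<=` U ->
  apow S i.+1 x -> apow T j.+1 y -> apow U (i + j).+1 (x ** y).
Proof.
move=> SU TU STU; apply: span_mulset; first exact: apow_submod.
move=> _ _ [x0 [s [szs Sx0 Ss ->]]] [y0 [s' [szs' Ty0 Ts ->]]].
apply: sub_span; rewrite -szs -szs' -aprod_cat.
case/lastP: s szs Ss => [|s z] szs Ss.
  exists (x0 ** y0), s'; split=> //; first by apply: STU; exists x0, y0.
  by move=> v /Ts /TU.
have Sz : S z by apply: Ss; rewrite mem_rcons mem_head.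
exists x0, (s ++ (z ** y0) :: s'); split.
- by rewrite size_rcons size_cat /= addSnnS.
- exact: SU.
- move=> v; rewrite mem_cat inE => /or3P[vs|/eqP->|/Ts/TU //].
    by apply: SU; apply: Ss; rewrite mem_rcons inE vs orbT.
  by apply: STU; exists z, y0.
by rewrite /aprod -cats1 -catA !foldl_cat /= na_mulA.
Qed.

Fact lg_bdd S T : linear_growth S -> linear_growth T ->
  linear_growth (mulset S T).
Proof.
move=> [S' [_ bS] SS] [T' [_ bT] TT].
pose U := S' `|` T' `|` mulset S' T'; exists (span U).
  apply: (bsub_span (M := ba_mod A)); apply: bounded_setU; last exact: ba_bdd.
  exact: bounded_setU.
move=> _ [x [y [/SS Sx /TT Ty ->]]]; apply: span_mulset Sx Ty.
  exact: span_submod.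
move=> _ _ [i [u [Su ->]]] [j [v [Tv ->]]].
rewrite (linZ (na_lin1 _)) (linZ (na_lin2 v)) scalerA -exprD addnC.
apply: sub_span; exists (i + j)%N, (u ** v); split=> //.
apply: apow_merge Su Tv => z hz; apply: sub_span.
- by left; left.
- by left; right.
- by right.
Qed.

Definition lg_alg : bornAlg V := @BornAlg V A lg_born lg_bdd.

End LinearGrowth.

(* [x_n] is a coherent sequence of representatives of an element of
   [lim S / t^n S]. *)
Definition adically_complete (V : comNzRingType) (t : V) (M : lmodType V)
    (S : set M) : Prop :=
  (forall x, S x -> (forall n, exists2 y, S y & x = t ^+ n *: y) -> x = 0) /\
  (forall x : nat -> M, (forall n, S (x n)) ->
     (forall n, exists2 y, S y & x n.+1 - x n = t ^+ n *: y) ->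
     exists2 l, S l & forall n, exists2 y, S y & l - x n = t ^+ n *: y).

(* [unif_factor] is the valuation: [x] has valuation [n]. *)
Record completeDVR := CompleteDVR {
  dvr_ring :> idomainType;
  unif : dvr_ring;
  unif_neq0 : unif != 0;
  unif_nonunit : unif \isn't a GRing.unit;
  unif_factor : forall x, x != 0 ->
    exists u n, u \is a GRing.unit /\ x = u * unif ^+ n;
  dvr_complete : adically_complete unif [set: dvr_ring^o]
}.

(* [res] exhibits the field [k] as the residue field [V / (unif V)]. *)
Definition is_residue_field (V : completeDVR) (k : fieldType)
    (res : {rmorphism V -> k}) : Prop :=
  (forall a, exists x, res x = a) /\
  (forall x, res x = 0 <-> exists y, x = unif V * y).

Section RestrictedAlgebra.
Context (K L : comNzRingType) (f : {rmorphism K -> L}) (A : nualg L).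

Definition restr_mul (x y : restr f A) : restr f A := (x : A) ** (y : A).
Fact restr_bilin : bilin restr_mul.
Proof.
by split=> x a u v; rewrite /restr_mul ?na_lin1 ?(na_lin2 (x : A)).
Qed.
Fact restr_mulA : associative restr_mul.
Proof. exact: na_mulA. Qed.
Definition restr_alg : nualg K := NuAlg restr_bilin restr_mulA.
End RestrictedAlgebra.

Section FractionAlgebra.
Context (V : completeDVR).
Local Notation pi := (unif V).

Definition frac_mod : lmodType V :=
  restr (@FracField.tofrac V) ({fraction V}^o).

Definition frac_mul (x y : frac_mod) : frac_mod :=
  (x : {fraction V}) * (y : {fraction V}).
Fact frac_bilin : bilin frac_mul.
Proof.
split=> x a u v; rewrite /frac_mul.
  by rewrite [LHS]mulrDr [x * _]mulrCA.
by rewrite [LHS]mulrDl -[(a *: u) * _]mulrA.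
Qed.
Fact frac_mulA : associative frac_mul.
Proof. by move=> x y z; rewrite /frac_mul mulrA. Qed.
Definition frac_nualg : nualg V := NuAlg frac_bilin frac_mulA.

Definition frac_pi (n : nat) : frac_mod := (FracField.tofrac pi) ^- n.

Definition frac_bounded (S : set frac_mod) : Prop :=
  exists n, S `<=` [set x | exists v : V, x = v *: frac_pi n].

Lemma frac_piS n m : frac_pi n = pi ^+ m *: frac_pi (n + m).
Proof.
have pi0 : FracField.tofrac pi != 0 by rewrite tofrac_eq0 unif_neq0.
rewrite restrE /frac_pi exprD rmorphXn /=.
rewrite -[_ *: _]/(_ * _) invfM mulrCA mulfV ?mulr1 //.
by rewrite expf_neq0.
Qed.

Lemma frac_pi_submod n : is_submod [set x | exists v : V, x = v *: frac_pi n].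
Proof.
split=> [|a _ _ [u ->] [v ->]] /=; first by exists 0; rewrite scale0r.
by exists (a * u + v); rewrite scalerDl scalerA.
Qed.

Lemma frac_eq (x : {fraction V}) : exists n d : V,
  d != 0 /\ x * FracField.tofrac d = FracField.tofrac n.
Proof.
elim/quotW: x => r; exists \n_r, \d_r; split; first exact: denom_ratioP.
have d0 := denom_ratioP r; unlock FracField.tofrac.
rewrite -[LHS]FracField.pi_mul; apply/eqmodP; rewrite /= FracField.equivfE.
by rewrite !numden_Ratio ?(oner_eq0, mulf_neq0, mulr1) // mulrC.
Qed.

Lemma frac_piE (x : frac_mod) : exists n (v : V), x = v *: frac_pi n.
Proof.
have [c [d [d0 xE]]] := frac_eq x; have [u [n [uu dE]]] := unif_factor d0.
exists n, (u^-1 * c).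
rewrite -[RHS]/(FracField.tofrac (u^-1 * c) * (FracField.tofrac pi) ^- n).
have pn0 : FracField.tofrac pi ^+ n != 0.
  by rewrite expf_neq0 // tofrac_eq0 unif_neq0.
apply: (mulIf pn0); rewrite mulfVK // tofracM -xE dE tofracM tofracXn.
rewrite [RHS]mulrCA; congr (_ * _).
by rewrite mulrA -tofracM mulVr // tofrac1 mul1r.
Qed.

Fact frac_finite S : finite_set S -> frac_bounded S.
Proof.
apply: finite_set_ind => [|x|{}S T [n hS] [m hT]].
- by exists 0%N.
- by have [n [v ->]] := frac_piE x; exists n => _ ->; exists v.
exists (n + m)%N => x [/hS|/hT] [v ->].
  by exists (v * pi ^+ m); rewrite (frac_piS n m) scalerA.
by exists (v * pi ^+ n); rewrite (frac_piS m n) scalerA addnC.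
Qed.
Fact frac_sub S T : S `<=` T -> frac_bounded T -> frac_bounded S.
Proof. by move=> ST [n hT]; exists n; exact: subset_trans hT. Qed.
Fact frac_setU S T : frac_bounded S -> frac_bounded T -> frac_bounded (S `|` T).
Proof.
move=> [n hS] [m hT]; exists (n + m)%N => x [/hS|/hT] [v ->].
  by exists (v * pi ^+ m); rewrite (frac_piS n m) scalerA.
by exists (v * pi ^+ n); rewrite (frac_piS m n) scalerA addnC.
Qed.
Fact frac_span S : frac_bounded S -> frac_bounded (span S).
Proof.
by move=> [n hS]; exists n; exact: span_min (frac_pi_submod n) hS.
Qed.
Definition frac_born : bornology frac_mod :=
  Bornology frac_finite frac_sub frac_setU frac_span.

Fact frac_bdd (S T : set frac_nualg) :
  frac_bounded S -> frac_bounded T -> frac_bounded (mulset S T).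
Proof.
move=> [n hS] [m hT]; exists (n + m)%N.
move=> _ [x [y [/hS[u ->] /hT[v ->] ->]]]; exists (u * v).
rewrite (linZ (na_lin1 _)) (linZ (na_lin2 _)) scalerA [v * u]mulrC.
by congr (_ *: _); rewrite -[LHS]/(_ * _) /frac_pi exprD invfM.
Qed.
Definition frac_alg : bornAlg V := @BornAlg _ frac_nualg frac_born frac_bdd.

End FractionAlgebra.

Section BornologicalProperties.
Context (V : completeDVR).
Local Notation pi := (unif V).

Definition torsionfree (M : bornMod V) : Prop :=
  (forall x : M, pi *: x = 0 -> x = 0) /\
  (forall S : set M, bdd ( *:%R pi @` S) -> bdd S).

Definition complete (M : bornMod V) : Prop :=
  forall S : set M, bsub S ->
  exists T : set M, [/\ S `<=` T, bsub T & adically_complete pi T].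

Fact pi_submod (M : lmodType V) : is_submod [set x : M | exists y, x = pi *: y].
Proof.
split=> [|a _ _ [x ->] [y ->]] /=; first by exists 0; rewrite scaler0.
by exists (a *: x + y); rewrite scalerDr !scalerA mulrC.
Qed.

Definition pi_sub (M : lmodType V) : submodule M := Submodule (pi_submod M).

Definition fine_mod_pi (M : bornMod V) : Prop :=
  forall S : set (quot_bmod (M := M) (pi_sub M)), bdd S <-> fg_set S.

Definition semidagger (A : bornAlg V) : Prop :=
  forall S : set A, linear_growth pi S -> bounded (ba_born A) S.

Definition dagger (A : bornAlg V) : Prop :=
  [/\ complete (ba_mod A), torsionfree (ba_mod A) & semidagger A].

(* [eta] is the unit at [M] of the left adjoint to the inclusion of complete
   modules; it determines [Mh] up to unique isomorphism. *)
Definition is_completion (M Mh : bornMod V) (eta : bhom M Mh) : Prop :=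
  complete Mh /\
  forall N : bornMod V, complete N -> forall f : bhom M N,
  exists g : bhom Mh N, (forall x, g (eta x) = f x) /\
    forall g' : bhom Mh N, (forall x, g' (eta x) = f x) -> g' =1 g.

End BornologicalProperties.

Record ahom (V : comNzRingType) (A B : bornAlg V) := AHom {
  ah_hom :> bhom (ba_mod A) (ba_mod B);
  ah_mul : forall x y : A, ah_hom (x ** y) = (ah_hom x : B) ** (ah_hom y : B)
}.

(* Index sets of projective systems are directed preorders; every cofiltered
   system is isomorphic to one of this form. *)
Record dirset := DirSet {
  dcar :> Type;
  dle : dcar -> dcar -> Prop;
  dle_refl : forall i, dle i i;
  dle_trans : forall i j k, dle i j -> dle j k -> dle i k;
  dir_inhab : inhabited dcar;
  dir_ub : forall i j, exists k, dle i k /\ dle j k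
}.

Section ProSystems.
Context (V : comNzRingType).

Record prosys (J : dirset) := ProSys {
  ps_obj :> J -> bornMod V;
  ps_tr : forall i j, dle i j -> bhom (ps_obj j) (ps_obj i);
  ps_id : forall i (h : dle i i) x, ps_tr h x = x;
  ps_comp : forall i j k (h : dle i j) (h' : dle j k) (h'' : dle i k) x,
    ps_tr h (ps_tr h' x) = ps_tr h'' x
}.

Record proalg (J : dirset) := ProAlg {
  pa_obj :> J -> bornAlg V;
  pa_tr : forall i j, dle i j -> ahom (pa_obj j) (pa_obj i);
  pa_id : forall i (h : dle i i) x, pa_tr h x = x;
  pa_comp : forall i j k (h : dle i j) (h' : dle j k) (h'' : dle i k) x,
    pa_tr h (pa_tr h' x) = pa_tr h'' x
}.

Definition pa_mod (J : dirset) (B : proalg J) : prosys J :=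
  @ProSys J (fun j => ba_mod (B j)) (fun i j h => pa_tr B h)
    (@pa_id J B) (@pa_comp J B).

(* [promor X Y] represents an element of [lim_j colim_i Hom(X_i, Y_j)];
   [promor_eq] is equality of such elements. *)
Record promor (I J : dirset) (X : prosys I) (Y : prosys J) := ProMor {
  pm_idx : J -> I;
  pm_map : forall j, bhom (X (pm_idx j)) (Y j);
  pm_compat : forall j j' (h : dle j j'), exists i
    (h1 : dle (pm_idx j) i) (h2 : dle (pm_idx j') i),
    forall x, pm_map j (ps_tr X h1 x) = ps_tr Y h (pm_map j' (ps_tr X h2 x))
}.

Definition promor_eq (I J : dirset) (X : prosys I) (Y : prosys J)
    (f g : promor X Y) : Prop :=
  forall j, exists i (h1 : dle (pm_idx f j) i) (h2 : dle (pm_idx g j) i),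
  forall x, pm_map f j (ps_tr X h1 x) = pm_map g j (ps_tr X h2 x).

Definition promor_eq0 (I J : dirset) (X : prosys I) (Y : prosys J)
    (f : promor X Y) : Prop :=
  forall j, exists i (h : dle (pm_idx f j) i),
  forall x, pm_map f j (ps_tr X h x) = 0.

Section Composition.
Context (I J K : dirset) (X : prosys I) (Y : prosys J) (Z : prosys K).
Context (g : promor Y Z) (f : promor X Y).

Fact promor_comp_compat k k' (h : dle k k') : exists i
  (h1 : dle (pm_idx f (pm_idx g k)) i) (h2 : dle (pm_idx f (pm_idx g k')) i),
  forall x,
    bhom_comp (pm_map g k) (pm_map f (pm_idx g k)) (ps_tr X h1 x) =
    ps_tr Z h (bhom_comp (pm_map g k') (pm_map f (pm_idx g k')) (ps_tr X h2 x)).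
Proof.
have [j [hj [hj' gE]]] := pm_compat g h.
have [i1 [a1 [b1 f1]]] := pm_compat f hj.
have [i2 [a2 [b2 f2]]] := pm_compat f hj'.
have [i [c1 c2]] := dir_ub i1 i2.
exists i, (dle_trans a1 c1), (dle_trans a2 c2) => x /=.
rewrite -(ps_comp a1 c1) -(ps_comp a2 c2) f1 f2 gE.
by rewrite (ps_comp b1 c1 (dle_trans b1 c1)) (ps_comp b2 c2 (dle_trans b1 c1)).
Qed.

Definition promor_comp : promor X Z :=
  @ProMor I K X Z (fun k => pm_idx f (pm_idx g k))
    (fun k => bhom_comp (pm_map g k) (pm_map f (pm_idx g k)))
    promor_comp_compat.
End Composition.

Fact promor_id_compat (J : dirset) (X : prosys J) j j' (h : dle j j') :
  exists i (h1 : dle j i) (h2 : dle j' i), forall x,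
    bhom_id (X j) (ps_tr X h1 x) = ps_tr X h (bhom_id (X j') (ps_tr X h2 x)).
Proof.
by exists j', h, (dle_refl j') => x /=; rewrite (ps_comp h _ h).
Qed.
Definition promor_id (J : dirset) (X : prosys J) : promor X X :=
  @ProMor J J X X id (fun j => bhom_id (X j)) (@promor_id_compat J X).

Definition is_kernel (I J K : dirset) (X : prosys I) (Y : prosys J)
    (Z : prosys K) (i : promor X Y) (p : promor Y Z) : Prop :=
  promor_eq0 (promor_comp p i) /\
  forall (L : dirset) (T : prosys L) (f : promor T Y),
    promor_eq0 (promor_comp p f) ->
    exists g : promor T X, promor_eq (promor_comp i g) f /\
      forall g', promor_eq (promor_comp i g') f -> promor_eq g' g.

Definition is_cokernel (I J K : dirset) (X : prosys I) (Y : prosys J)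
    (Z : prosys K) (i : promor X Y) (p : promor Y Z) : Prop :=
  promor_eq0 (promor_comp p i) /\
  forall (L : dirset) (T : prosys L) (f : promor Y T),
    promor_eq0 (promor_comp f i) ->
    exists g : promor Z T, promor_eq (promor_comp g p) f /\
      forall g', promor_eq (promor_comp g' p) f -> promor_eq g' g.

Record proalg_mor (I J : dirset) (B : proalg I) (C : proalg J) := ProAlgMor {
  pam_mor :> promor (pa_mod B) (pa_mod C);
  pam_mul : forall j (x y : B (pm_idx pam_mor j)),
    pm_map pam_mor j (x ** y) =
    (pm_map pam_mor j x : C j) ** (pm_map pam_mor j y : C j)
}.

Definition is_extension (I J K : dirset) (B : proalg I) (C : proalg J)
    (D : proalg K) (i : proalg_mor B C) (p : proalg_mor C D) : Prop :=
  is_kernel i p /\ is_cokernel i p.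

Definition pro_iso (I J : dirset) (B : proalg I) (C : proalg J) : Prop :=
  exists (f : proalg_mor B C) (g : proalg_mor C B),
    promor_eq (promor_comp g f) (promor_id (pa_mod B)) /\
    promor_eq (promor_comp f g) (promor_id (pa_mod C)).

End ProSystems.

Definition unit_dir : dirset := @DirSet unit (fun _ _ => True)
  (fun _ => I) (fun _ _ _ _ _ => I) (inhabits tt)
  (fun _ _ => ex_intro _ tt (conj I I)).

Fact nat_dir_ub (m n : nat) : exists k, (m <= k)%N /\ (n <= k)%N.
Proof. by exists (maxn m n); rewrite leq_maxl leq_maxr. Qed.
Definition nat_dir : dirset := @DirSet nat (fun m n => (m <= n)%N)
  leqnn (fun i j k h h' => leq_trans h h') (inhabits 0%N) nat_dir_ub.

Definition ahom_id (V : comNzRingType) (A : bornAlg V) : ahom A A :=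
  @AHom V A A (bhom_id (ba_mod A)) (fun _ _ => erefl).

Definition const_pro (V : comNzRingType) (A : bornAlg V) : proalg V unit_dir :=
  @ProAlg V unit_dir (fun _ => A) (fun _ _ _ => ahom_id A)
    (fun _ _ _ => erefl) (fun _ _ _ _ _ _ _ => erefl).

Section ProProperties.
Context (V : completeDVR).
Local Notation pi := (unif V).

(* The multiplication of [Bh j] is the only one that is bounded and makes
   [eta j] an algebra homomorphism. *)
Definition pro_completion (J : dirset) (B Bh : proalg V J) : Prop :=
  exists eta : forall j, ahom (B j) (Bh j),
    (forall j, is_completion (eta j)) /\
    forall i j (h : dle i j) x, eta i (pa_tr B h x) = pa_tr Bh h (eta j x).

Definition pro_dagger (J : dirset) (B : proalg V J) : Prop :=
  forall j, dagger (B j).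

Definition pro_fine_mod_pi (J : dirset) (B : proalg V J) : Prop :=
  forall j, fine_mod_pi (ba_mod (B j)).

Definition nilpotent_mod_pi (J : dirset) (B : proalg V J) : Prop :=
  forall n, exists m (h : dle n m) l, (0 < l)%N /\
    forall x : B m, apow [set: B m] l x ->
      exists y : B n, pa_tr B h x = pi *: y.

Definition analytically_nilpotent (J : dirset) (B : proalg V J) : Prop :=
  nilpotent_mod_pi B /\
  exists (L : dirset) (D : proalg V L), pro_dagger D /\ pro_iso B D.

End ProProperties.

Section LinearGrowthPro.
Context (V : comNzRingType) (t : V).

Fact lg_hom_bdd (A B : bornAlg V) (f : ahom A B) (S : set A) :
  linear_growth t S -> linear_growth t ((f : A -> B) @` S).
Proof.
move=> [T [mT bT] ST]; exists ((f : A -> B) @` T).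
  by split; [exact: image_submod (bh_lin f) mT|exact: (bh_bdd f)].
have faprod (x : A) s : (f (aprod x s) : B) = aprod (f x : B) (map f s).
  elim/last_ind: s => [//|s z IH].
  by rewrite /aprod in IH *; rewrite -!cats1 map_cat !foldl_cat /= ah_mul IH.
move=> _ [x /ST Tx <-]; move: x Tx.
apply: (image_span (f := f : A -> B)); first exact: (bh_lin f).
move=> _ [i [y [Ty ->]]]; rewrite (linZ (bh_lin f)); apply: sub_span.
exists i, (f y); split=> //; move: y Ty.
apply: (image_span (f := f : A -> B)); first exact: (bh_lin f).
move=> _ [x [s [szs Tx Ts ->]]]; apply: sub_span.
exists (f x), (map f s); split=> //.
  by rewrite size_map.
by move=> _ /mapP[z zs ->]; exists z => //; exact: Ts.
Qed.

Definition lg_ahom (A B : bornAlg V) (f : ahom A B) :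
    ahom (lg_alg t A) (lg_alg t B) :=
  @AHom V (lg_alg t A) (lg_alg t B)
    (@BHom V (ba_mod (lg_alg t A)) (ba_mod (lg_alg t B)) f (bh_lin f)
      (@lg_hom_bdd A B f)) (@ah_mul V A B f).

Definition lg_pro (J : dirset) (B : proalg V J) : proalg V J :=
  @ProAlg V J (fun j => lg_alg t (B j)) (fun i j h => lg_ahom (pa_tr B h))
    (@pa_id V J B) (@pa_comp V J B).

End LinearGrowthPro.

Section Tube.
Context (V : completeDVR) (R : bornAlg V) (I : ideal R).

(* [sum_j pi^(-j) I^(l j)] inside [R (x) F] *)
Definition tube_set (l : nat) : set (ten_alg R (frac_alg V)) :=
  span [set z | exists j r, apow I (l * j) r /\ z = tens r (frac_pi V j)].

Definition tube_sub (l : nat) : submodule (ten_alg R (frac_alg V)) :=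
  Submodule (@span_submod _ _ _ : is_submod (tube_set l)).

Fact tube_mul l x y :
  sm_set (tube_sub l) x -> sm_set (tube_sub l) y -> sm_set (tube_sub l) (x ** y).
Proof.
apply: (span_mulset (A := ten_alg R (frac_alg V))); first exact: span_submod.
move=> _ _ [i [r [Ir ->]]] [j [s [Is ->]]].
rewrite -[_ ** _]/(ten_mul _ _) ten_mulE; apply: sub_span.
exists (i + j)%N, (r ** s); split; first by rewrite mulnDr; exact: apow_idealM.
by congr tens; rewrite -[LHS]/(_ * _) /frac_pi exprD invfM.
Qed.

Definition tube_alg (l : nat) : bornAlg V := sub_alg (@tube_mul l).

Lemma tube_decr l l' : (l <= l')%N -> tube_set l' `<=` tube_set l.
Proof.
move=> ll; apply: span_mono => _ [j [r [Ir ->]]]; exists j, r; split=> //.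
by apply: apow_decr Ir; rewrite leq_mul2r ll orbT.
Qed.

Section Inclusion.
Context (l l' : nat) (h : (l <= l')%N).
Definition tube_incl (u : tube_alg l') : tube_alg l :=
  mksub (S := tube_sub l) (tube_decr h (submP u)).
Fact tube_incl_lin : linear tube_incl.
Proof. by move=> a u v; apply: val_inj. Qed.
Fact tube_incl_bdd (S : set (ba_mod (tube_alg l'))) :
  bdd S -> bdd (M := ba_mod (tube_alg l)) (tube_incl @` S).
Proof.
apply: (@bounded_sub _ _ (ba_born (ten_alg R (frac_alg V)))).
by move=> _ [_ [u Su <-] <-]; exists u.
Qed.
Fact tube_incl_mul (u v : tube_alg l') :
  tube_incl (u ** v) = tube_incl u ** tube_incl v.
Proof. exact: val_inj. Qed.
Definition tube_ahom : ahom (tube_alg l') (tube_alg l) :=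
  @AHom V (tube_alg l') (tube_alg l)
    (@BHom V (ba_mod (tube_alg l')) (ba_mod (tube_alg l))
       tube_incl tube_incl_lin tube_incl_bdd) tube_incl_mul.
End Inclusion.

(* The entry of index [n] is [U(R, I^l)] with [l = n + 1]. *)
Fact tube_id n (h : (n.+1 <= n.+1)%N) x : tube_ahom h x = x.
Proof. exact: val_inj. Qed.
Fact tube_comp i j k (h : (i.+1 <= j.+1)%N) (h' : (j.+1 <= k.+1)%N)
  (h'' : (i.+1 <= k.+1)%N) x : tube_ahom h (tube_ahom h' x) = tube_ahom h'' x.
Proof. exact: val_inj. Qed.
Definition tube_pro : proalg V nat_dir :=
  @ProAlg V nat_dir (fun n => tube_alg n.+1)
    (fun (i j : nat) (h : (i <= j)%N) => @tube_ahom i.+1 j.+1 h)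
    (fun i h => @tube_id i h) (fun i j k h h' h'' => @tube_comp i j k h h' h'').

End Tube.

(* Main.v *)
Require Import Defs.
From HB Require Import structures.
From mathcomp Require Import all_boot all_order all_algebra.
From mathcomp Require Import fraction.
From mathcomp.multinomials Require Import monalg.
From mathcomp Require Import boolp classical_sets functions cardinality.

(** Write [pi] for the uniformiser, [U_l] for U(TW, I^l) and [N_l] for U(I, I^l).

    The completion of a bornological module [M] is built as a quotient of the module of bounded
    sequences [s] in [M], where [s] stands for the series [sum_n pi^n s_n] ([completion_exists]).
    The relations are the smallest submodule that contains [(pi - X) t] for all bounded [t] and is
    closed in a suitable sense; its minimality is used again and again to show that maps, products
    and division by [pi] pass to the quotient. In this way the completion of [R_lg] is a dagger
    algebra as soon as [R] is torsionfree ([compl_lg_dagger]), and it is fine mod [pi] as soon as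
    [R] is. The tube algebras are torsionfree because multiplication by [pi] is invertible on
    [R (x) F]. That [U_l] is fine mod [pi] follows from the same property of [TW] by clearing
    denominators, because [V] is noetherian ([tube_fine]).

    The inclusion of [N_l] in [U_l] satisfies [pi U_l <= N_l <= U_l], and [N_l] carries the subspace
    bornology. This situation is preserved by passing to linear growth ([lg_pi_embedding]) and by
    completion ([compl_pi_embedding]), and the completion of [N_l] is the kernel of the map from the
    completion of [U_l] to [U_l / N_l]. So the heart of the theorem is [U_l / N_l = A] for [l >= 2]:
    if [r] in [TW] equals [sum_(j >= 1) pi^-j r_j] with [r_j] in [I^(l j)], then [r] is in [I]
    ([tube_low_high]).

    For this, represent [TW]. The algebra [A] acts faithfully on its unitalization [Q]. There is
    a torsionfree complete [V]-module [P] with [P / pi P = Q] ([flat_lift]), and [W -> End Q] lifts to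
    a linear map [W -> End P] because [W] is torsionfree and [End P] is complete ([lift_flat]). It
    extends to a homomorphism [phi : TW -> End P] such that [phi x] is divisible by [pi] if and only
    if [x] is in [I] ([detection]). No associative lifting of [A] is involved: any linear
    map from [W] to an algebra extends to the free algebra. Now [phi r_j] is divisible by
    [pi^(l j)], and [l j >= j + 1] when [l >= 2], so [phi r] is divisible by [pi] and [r] is in [I].

    The first level [l = 1] has no map to [A], but a morphism of projective systems to a constant
    system is given by a single level ([pro_extension]). Finally, a product of [l] elements of
    [N_(2 l)] lies in [pi N_l] ([tube_full_nilpotent]), which makes the completed system of the [N_l],
    a projective system of dagger algebras, analytically nilpotent. *)

Set Implicit Arguments.
Unset Strict Implicit.
Unset Printing Implicit Defensive.

Import Defs GRing.Theory.
Local Open Scope classical_set_scope.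
Local Open Scope ring_scope.

(** * Limits of pi-adic series *)

Lemma submodB (K : nzRingType) (M : lmodType K) (S : set M) (hS : is_submod S) x y :
  S x -> S y -> S (x - y).
Proof. by move=> Sx Sy; apply: submodD => //; exact: submodN. Qed.

Section BoundedSubmodules.
Context (V : comNzRingType) (M : bornMod V).

Lemma bsub_span1 (x : M) : bsub (span [set x]).
Proof. by apply: bsub_span; exact: bounded_finite. Qed.

Definition joinset (S T : set M) : set M := span (S `|` T).

Lemma bsub_join (S T : set M) : bsub S -> bsub T -> bsub (joinset S T).
Proof. by move=> [_ bS] [_ bT]; apply: bsub_span; exact: bounded_setU. Qed.

Lemma joinl (S T : set M) : S `<=` joinset S T.
Proof. by move=> x Sx; apply: sub_span; left. Qed.

Lemma joinr (S T : set M) : T `<=` joinset S T.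
Proof. by move=> x Sx; apply: sub_span; right. Qed.

Lemma bsub_image (N : bornMod V) (f : bhom M N) S : bsub S -> bsub (f @` S).
Proof.
by move=> [mS bS]; split; [exact: image_submod (bh_lin f) mS|exact: bh_bdd].
Qed.

End BoundedSubmodules.

Section Limits.
Context (V : completeDVR).
Local Notation pi := (unif V).

(** Adic completeness in terms of the series [sum_n pi^n x_n]: [y n] is the sum of the tail
    [sum_(i >= n) pi^(i - n) x_i]. The recursion between tails replaces partial sums everywhere
    below. *)
Definition series_complete (N : lmodType V) (T : set N) : Prop :=
  (forall x, T x -> (forall n, exists2 y, T y & x = pi ^+ n *: y) -> x = 0) /\
  forall x : nat -> N, (forall n, T (x n)) -> exists2 y : nat -> N,
    (forall n, T (y n)) & forall n, y n = x n + pi *: y n.+1.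

(** A Cauchy sequence is the sequence of partial sums of such a series. Conversely the limits of
    the tails satisfy the recursion because both sides have the same approximations and [T] is
    separated. *)
Lemma series_completeP (N : lmodType V) (T : set N) : is_submod T ->
  adically_complete pi T <-> series_complete T.
Proof.
move=> mT; split=> -[sepT cT]; split=> // x Tx.
  pose p n k : N := \sum_(i < k) pi ^+ i *: x (n + i)%N.
  have Tp n k : T (p n k) by apply: submod_sum => // i _; exact: submodZ.
  have /choice[l hl] n : exists l, T l /\
      forall k, exists2 z, T z & l - p n k = pi ^+ k *: z.
    have [|l Tl hl] := cT (p n) (Tp n); last by exists l.
    move=> k; exists (x (n + k)%N) => //.
    by rewrite /p big_ord_recr /= addrAC subrr add0r.
  exists l => n; first by case: (hl n).
  have [Tl hln] := hl n; have [Tl' hln'] := hl n.+1.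
  apply/eqP; rewrite -subr_eq0; apply/eqP; apply: sepT => [|k].
    by apply: submodB => //; apply: submodD => //; exact: submodZ.
  have [z Tz zE] := hln k.+1; have [z' Tz' zE'] := hln' k.
  exists (pi *: z - pi *: z'); first by apply: submodB => //; exact: submodZ.
  have pE : p n k.+1 = x n + pi *: p n.+1 k.
    rewrite /p big_ord_recl expr0 scale1r addn0 scaler_sumr; congr (_ + _).
    by apply: eq_bigr => i _; rewrite scalerA -exprS addSnnS.
  have {}zE : l n = x n + pi *: p n.+1 k + pi ^+ k.+1 *: z.
    by rewrite -pE -zE addrC subrK.
  have {}zE' : l n.+1 = p n.+1 k + pi ^+ k *: z' by rewrite -zE' addrC subrK.
  rewrite zE zE' scalerDr addrA opprD addrACA subrr add0r.
  by rewrite scalerBr !scalerA -exprSr mulrC -exprSr.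
move=> hx; have /choice[z hz] n : exists z, T z /\ x n.+1 - x n = pi ^+ n *: z.
  by have [z] := hx n; exists z.
have [|y Ty yE] := cT z; first by move=> n; case: (hz n).
exists (x 0%N + y 0%N) => [|n]; first exact: submodD.
exists (y n) => //; elim: n => [|n IH]; first by rewrite addrAC subrr add0r expr0 scale1r.
rewrite -[x n.+1](subrK (x n)) (hz n).2 opprD addrCA IH addrC -scalerBr.
by rewrite yE addrAC subrr add0r scalerA -exprSr.
Qed.

Context (N : bornMod V).

(** [l] is the sum of the series [sum_n pi^n x_n], with tails [y]. *)
Definition series_lim (x : nat -> N) (l : N) : Prop :=
  exists y : nat -> N, [/\ y 0%N = l, (exists2 S, bsub S & forall n, S (y n)) &
    forall n, y n = x n + pi *: y n.+1].

Lemma series_lim_lin a x x' l l' : series_lim x l -> series_lim x' l' ->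
  series_lim (fun n => a *: x n + x' n) (a *: l + l').
Proof.
move=> [y [y0 [S bS Sy] yE]] [y' [y0' [S' bS' Sy'] yE']].
exists (fun n => a *: y n + y' n); split; first by rewrite y0 y0'.
  exists (joinset S S'); first exact: bsub_join.
  by move=> n; apply: (span_submod _).2; [exact: joinl|exact: joinr].
move=> n; rewrite {1}yE {1}yE' [in RHS]scalerDr !scalerDr !scalerA [a * pi]mulrC.
by rewrite addrACA.
Qed.

(** The differences [d n] of two families of tails satisfy [d n = pi d (n+1)], so [d 0] is
    infinitely divisible inside a separated bounded submodule. *)
Lemma series_lim_uniq (cN : complete N) x l l' :
  series_lim x l -> series_lim x l' -> l = l'.
Proof.
move=> [y [<- [S bS Sy] yE]] [y' [<- [S' bS' Sy'] yE']].
have [T [ST bT [sepT _]]] := cN _ (bsub_join bS bS').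
apply/eqP; rewrite -subr_eq0; apply/eqP.
have Td n : T (y n - y' n).
  apply: submodB; first by case: bT.
    by apply: ST; exact: joinl.
  by apply: ST; exact: joinr.
apply: sepT => // n; exists (y n - y' n) => //.
elim: n => [|n ->]; first by rewrite expr0 scale1r.
by rewrite {1}yE {1}yE' opprD addrACA subrr add0r -scalerBr scalerA -exprSr.
Qed.

Lemma series_lim_ex (cN : complete N) S : bsub S ->
  exists T, [/\ bsub T, S `<=` T, adically_complete pi T &
    forall x, (forall n, S (x n)) -> exists2 l, T l & series_lim x l].
Proof.
move=> bS; have [T [ST bT cT]] := cN _ bS; exists T; split=> // x Sx.
have [_ h] := (series_completeP bT.1).1 cT.
have [|y Ty yE] := h x; first by move=> n; exact: ST.
by exists (y 0%N) => //; exists y; split=> //; exists T.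
Qed.

End Limits.

Lemma series_lim_bhom (V : completeDVR) (M N : bornMod V) (g : bhom M N) x l :
  series_lim x l -> series_lim (fun n => g (x n)) (g l).
Proof.
move=> [y [<- [S bS Sy] yE]]; exists (fun n => g (y n)); split=> // [|n].
  by exists (g @` S); [exact: bsub_image|move=> n; exists (y n)].
by rewrite {1}yE (linD (bh_lin g)) (linZ (bh_lin g)).
Qed.

(** * Completion of a bornological module *)

Section Completion.
Context (V : completeDVR) (M : bornMod V).
Local Notation pi := (unif V).

Definition bounded_seq : set (nat -> M) :=
  [set s | exists2 S : set M, bsub S & forall n, S (s n)].

Fact bounded_seq_submod : is_submod bounded_seq.
Proof.
split=> [|a s t [S bS Ss] [T bT Tt]].
  by exists (span [set 0]); [exact: bsub_span1|move=> n; exact: (span_submod _).1].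
exists (joinset S T); first exact: bsub_join.
by move=> n; apply: (span_submod _).2; [exact: joinl|exact: joinr].
Qed.

(** Such a sequence [s] stands for the element [sum_n pi^n s_n] of the completion. *)
Definition bdseq : Type := subm (Submodule bounded_seq_submod).
HB.instance Definition _ := GRing.Lmodule.on bdseq.

Definition terms (s : bdseq) : nat -> M := val s.

Lemma terms_bdd (s : bdseq) : exists2 S, bsub S & forall n, S (terms s n).
Proof. exact: (submP s). Qed.

Lemma bdseq_inj (s t : bdseq) : (forall n, terms s n = terms t n) -> s = t.
Proof. by move=> h; apply: val_inj; apply: funext. Qed.

Lemma termsD s t n : terms (s + t) n = terms s n + terms t n. Proof. by []. Qed.
Lemma termsN s n : terms (- s) n = - terms s n. Proof. by []. Qed.
Lemma termsZ a s n : terms (a *: s) n = a *: terms s n. Proof. by []. Qed.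
Lemma terms0 n : terms 0 n = 0. Proof. by []. Qed.
Definition termsE := (termsD, termsN, termsZ, terms0).

Definition mkbdseq (s : nat -> M) (h : bounded_seq s) : bdseq :=
  mksub (S := Submodule bounded_seq_submod) h.

Lemma mkbdseqE s h n : terms (@mkbdseq s h) n = s n. Proof. by []. Qed.

Definition in_sub (S : set M) : set bdseq := [set s | forall n, S (terms s n)].

Lemma in_sub_submod S : is_submod S -> is_submod (in_sub S).
Proof.
move=> mS; split=> [n|a s t Ss St n]; first exact: mS.1.
by apply: mS.2; [exact: Ss|exact: St].
Qed.

Lemma in_sub_mono S T : S `<=` T -> in_sub S `<=` in_sub T.
Proof. by move=> ST s Ss n; exact: ST. Qed.

Definition bdseq_bounded (X : set bdseq) := exists2 S, bsub S & X `<=` in_sub S.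
Fact bdseq_bounded_sub X Y : X `<=` Y -> bdseq_bounded Y -> bdseq_bounded X.
Proof. by move=> XY [S bS YS]; exists S => //; exact: subset_trans YS. Qed.
Fact bdseq_bounded_setU X Y :
  bdseq_bounded X -> bdseq_bounded Y -> bdseq_bounded (X `|` Y).
Proof.
move=> [S bS XS] [T bT YT]; exists (joinset S T); first exact: bsub_join.
by move=> s [/XS|/YT]; apply: in_sub_mono; [exact: joinl|exact: joinr].
Qed.
Fact bdseq_bounded_span X : bdseq_bounded X -> bdseq_bounded (span X).
Proof.
by move=> [S bS XS]; exists S => //; apply: span_min XS; apply: in_sub_submod bS.1.
Qed.
Fact bdseq_bounded_finite X : finite_set X -> bdseq_bounded X.
Proof.
apply: finite_set_ind; last exact: bdseq_bounded_setU.
  by exists (span [set 0]); [exact: bsub_span1|move=> s].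
by move=> s; have [S bS Ss] := terms_bdd s; exists S => // _ ->.
Qed.
Definition bdseq_born : bornology bdseq := Bornology
  bdseq_bounded_finite bdseq_bounded_sub bdseq_bounded_setU bdseq_bounded_span.
Definition bdseq_bmod : bornMod V := BornMod bdseq_born.

Definition seq_shift (s : nat -> M) (n : nat) : M := if n is m.+1 then s m else 0.

Lemma seq_shift_in (S : set M) s : is_submod S -> (forall n, S (s n)) ->
  forall n, S (seq_shift s n).
Proof. by move=> mS Ss [|n]; [exact: mS.1|exact: Ss]. Qed.

Fact shift_bdd (s : bdseq) : bounded_seq (seq_shift (terms s)).
Proof.
by have [S bS Ss] := terms_bdd s; exists S => //; exact: seq_shift_in bS.1 Ss.
Qed.
(** Multiplication by the variable [X], for sequences seen as power series. *)
Definition shift (s : bdseq) : bdseq := mkbdseq (shift_bdd s).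

Fact tail_bdd (s : bdseq) : bounded_seq (fun n => terms s n.+1).
Proof. by have [S bS Ss] := terms_bdd s; exists S => // n; exact: Ss. Qed.
Definition tail (s : bdseq) : bdseq := mkbdseq (tail_bdd s).

Fact single_bdd (x : M) : bounded_seq (fun n => if n is 0%N then x else 0).
Proof.
exists (span [set x]); first exact: bsub_span1.
by case=> [|n]; [exact: sub_span|exact: (span_submod _).1].
Qed.
Definition single (x : M) : bdseq := mkbdseq (single_bdd x).

Lemma single_linear : linear single.
Proof.
by move=> a x y; apply: bdseq_inj => -[|n] //; rewrite !termsE !mkbdseqE scaler0 addr0.
Qed.

Lemma shift_linear : linear shift.
Proof.
by move=> a x y; apply: bdseq_inj => -[|n] //; rewrite !termsE !mkbdseqE /= scaler0 addr0.
Qed.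

Lemma bdseq_split s : s = single (terms s 0) + shift (tail s).
Proof. by apply: bdseq_inj => -[|n]; rewrite termsE !mkbdseqE ?addr0 ?add0r. Qed.

(** The power series [(pi - X) t], whose value at [X = pi] is zero. *)
Definition carry (t : bdseq) : bdseq := pi *: t - shift t.

Lemma carryE t n : terms (carry t) n = pi *: terms t n - seq_shift (terms t) n.
Proof. by []. Qed.

Lemma carry_linear : linear carry.
Proof.
move=> a x y; rewrite /carry shift_linear scalerDr !scalerA opprD mulrC addrACA.
by rewrite scalerBr !scalerA.
Qed.

(** What the kernel of summation into any complete module satisfies: it contains the obvious
    relations, and inside the sequences with terms in one bounded submodule it is [pi]-adically
    closed. *)
Definition closed_kernel (Z : set bdseq) : Prop :=
  (forall t, Z (carry t)) /\
  forall S, bsub S -> forall s, in_sub S s ->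
    (forall n, exists2 t, in_sub S t & Z (s - pi ^+ n *: t)) -> Z s.

(** The smallest submodule with this property. To prove something about all null sequences, one
    exhibits a closed kernel. *)
Definition null_set : set bdseq :=
  [set s | forall Z, is_submod Z -> closed_kernel Z -> Z s].

Fact null_submod : is_submod null_set.
Proof.
split=> [Z [Z0 _] _ //|a s t hs ht Z mZ cZ].
by apply: mZ.2; [exact: hs|exact: ht].
Qed.
Definition null : submodule bdseq := Submodule null_submod.

Lemma null_closed : closed_kernel null_set.
Proof.
split=> [t Z _ [+ _]|S bS s Ss h Z mZ cZ]; first exact.
apply: (cZ.2 S) => // n; have [t St ht] := h n; exists t => //.
exact: ht.
Qed.

Definition compl : bornMod V := quot_bmod (M := bdseq_bmod) null.
Definition cl (s : bdseq) : compl := qpi null s.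

Lemma cl_linear : linear cl. Proof. exact: qpi_linear. Qed.

Lemma cl_eq s t : cl s = cl t <-> null_set (s - t).
Proof. exact: qpiP. Qed.

Lemma cl_eq0 s : cl s = 0 <-> null_set s.
Proof. exact: qpi_eq0. Qed.

Lemma cl_surj u : exists s, u = cl s.
Proof. by exists (repr u); rewrite -[LHS](qreprK u). Qed.

Lemma compl_bddP (X : set compl) :
  bdd X <-> exists2 S, bsub S & X `<=` cl @` in_sub S.
Proof.
split=> [[Y [S bS YS] ->]|[S bS XS]].
  by exists S => //; exact: image_subset.
apply: bounded_sub XS _; exists (in_sub S) => //; exists S => //.
Qed.

Lemma cl_shift s : cl (shift s) = pi *: cl s.
Proof.
apply/esym/eqP; rewrite -subr_eq0; apply/eqP.
rewrite -(linZ cl_linear) -(linB cl_linear); apply/cl_eq0.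
exact: null_closed.1.
Qed.

Definition eta_fun (x : M) : compl := cl (single x).

Lemma cl_tail s : cl s = eta_fun (terms s 0) + pi *: cl (tail s).
Proof. by rewrite {1}[s]bdseq_split (linD cl_linear) cl_shift. Qed.

Fact eta_lin : linear eta_fun.
Proof. exact: comp_linear cl_linear single_linear. Qed.

Fact eta_bdd S : bdd S -> bdd (eta_fun @` S).
Proof.
move=> bS; apply/compl_bddP; exists (span S); first exact: bsub_span.
move=> _ [x Sx <-]; exists (single x) => // -[|n]; first exact: sub_span.
exact: (span_submod _).1.
Qed.
Definition ceta : bhom M compl := BHom eta_lin eta_bdd.

(** Separatedness is the closedness of [null]; a series of classes of sequences is summed along
    the diagonals of the double sequence of representatives. *)
Lemma image_in_sub_complete S : bsub S -> adically_complete pi (cl @` in_sub S).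
Proof.
move=> bS; have mS := in_sub_submod bS.1.
apply/series_completeP; first exact: image_submod cl_linear mS.
split=> [_ [s Ss <-] h|x Tx].
  apply/cl_eq0; apply: (null_closed.2 S) => // n.
  have [_ [t St <-] E] := h n; exists t => //.
  by apply/cl_eq; rewrite (linZ cl_linear).
have /choice[t ht] n : exists t, in_sub S t /\ cl t = x n.
  by have [t] := Tx n; exists t.
(* [u n] is the power series [sum_j X^j t_(n+j)], so [u n = t_n + X u (n+1)]. *)
pose u : nat -> nat -> M :=
  fix u n k := terms (t n) k + (if k is k'.+1 then u n.+1 k' else 0).
have Su k : forall n, S (u n k).
  elim: k => [|k IH] n /=.
    by apply: (submodD bS.1); [exact: (ht n).1|exact: bS.1.1].
  by apply: (submodD bS.1); [exact: (ht n).1|exact: IH].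
have bu n : bounded_seq (u n) by exists S => // k; exact: Su.
exists (fun n => cl (mkbdseq (bu n))) => [n|n].
  by exists (mkbdseq (bu n)) => // k; exact: Su.
rewrite -(ht n).2 -cl_shift -(linD cl_linear); congr cl.
by apply: bdseq_inj => -[|k]; rewrite !termsE !mkbdseqE.
Qed.

Lemma compl_complete : complete compl.
Proof.
move=> X [mX /compl_bddP[S bS XS]]; exists (cl @` in_sub S); split=> //.
  split; first exact: image_submod cl_linear (in_sub_submod bS.1).
  by apply/compl_bddP; exists S.
exact: image_in_sub_complete.
Qed.

Lemma series_lim_cl s : series_lim (fun n => ceta (terms s n)) (cl s).
Proof.
have [S bS Ss] := terms_bdd s.
have St n : in_sub S (iter n tail s).
  by elim: n => [|n IH] //= k; rewrite mkbdseqE; exact: IH.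
have tE n k : terms (iter n tail s) k = terms s (n + k).
  by elim: n k => [|n IH] k //=; rewrite mkbdseqE IH addnS.
exists (fun n => cl (iter n tail s)); split=> //.
  exists (cl @` in_sub S); last by move=> n; exists (iter n tail s).
  split; last by apply/compl_bddP; exists S.
  exact: image_submod cl_linear (in_sub_submod bS.1).
by move=> n; rewrite {1}cl_tail tE addn0.
Qed.

Section Extension.
Context (N : bornMod V) (cN : complete N) (f : bhom M N).

Definition ext_rel (u : compl) (l : N) : Prop :=
  exists2 s, cl s = u & series_lim (fun n => f (terms s n)) l.

(** The tails are the terms of [- X t], starting with [0]. *)
Lemma series_lim_carry t : series_lim (fun n => f (terms (carry t) n)) 0.
Proof.
have [S bS St] := terms_bdd t; have lf := bh_lin f.
exists (fun n => - f (seq_shift (terms t) n)); split.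
- by rewrite (lin0 lf) oppr0.
- exists (f @` S); first exact: bsub_image.
  move=> n; exists (- seq_shift (terms t) n); last exact: linN.
  by apply: submodN; [exact: bS.1|exact: seq_shift_in bS.1 St n].
by move=> n; rewrite /= termsE (linB lf) termsE (linZ lf) scalerN addrAC subrr add0r.
Qed.

(** The sequences of sum [0] in a complete module form a closed kernel. *)
Lemma null_lim s : null_set s -> series_lim (fun n => f (terms s n)) 0.
Proof.
move/(_ [set s | series_lim (fun n => f (terms s n)) 0]); apply.
  split=> [|a x y hx hy] /=.
    exists (fun=> 0); split=> //; last by move=> n; rewrite terms0 (lin0 (bh_lin f)) scaler0 addr0.
    by exists (span [set 0]); [exact: bsub_span1|move=> n; exact: (span_submod _).1].
  have := series_lim_lin a hx hy; rewrite scaler0 addr0.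
  by under eq_fun do rewrite -(bh_lin f).
split; first exact: series_lim_carry.
move=> S bS s0 Ss h /=.
have [T [bT fST [sepT _] cT]] := series_lim_ex cN (bsub_image f bS).
have fT t : in_sub S t -> exists2 l, T l & series_lim (fun n => f (terms t n)) l.
  by move=> St; apply: cT => n; exists (terms t n).
have [l Tl hl] := fT _ Ss.
suff -> : 0 = l by [].
apply/esym/sepT => // n; have [t St ht] := h n.
have [m Tm hm] := fT _ St; exists m => //.
apply: (series_lim_uniq cN hl); have := series_lim_lin (pi ^+ n) hm ht; rewrite addr0.
by under eq_fun do rewrite -(bh_lin f) addrC subrK.
Qed.

Lemma ext_rel_fun u : {l | ext_rel u l}.
Proof.
apply: cid; have [s us] := cl_surj u; have [S bS Ss] := terms_bdd s.
have [T [_ _ _ cT]] := series_lim_ex cN (bsub_image f bS).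
have [|l _ hl] := cT (fun n => f (terms s n)); first by move=> n; exists (terms s n).
by exists l, s.
Qed.

Lemma ext_rel_uniq u l l' : ext_rel u l -> ext_rel u l' -> l = l'.
Proof.
move=> [s <- hs] [s' /esym/cl_eq us' hs'].
have hn := null_lim us'; apply: (series_lim_uniq cN hs).
have := series_lim_lin 1 hn hs'; rewrite scaler0 add0r.
by under eq_fun do rewrite scale1r -(linD (bh_lin f)) -termsD subrK.
Qed.

Definition ext_fun u : N := sval (ext_rel_fun u).

Lemma ext_funP s l : series_lim (fun n => f (terms s n)) l -> ext_fun (cl s) = l.
Proof. by move=> h; apply: ext_rel_uniq (svalP (ext_rel_fun _)) _; exists s. Qed.

Fact ext_lin : linear ext_fun.
Proof.
move=> a u v; have [s us hs] := svalP (ext_rel_fun u).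
have [t vt ht] := svalP (ext_rel_fun v).
rewrite -{1}us -{1}vt -cl_linear; apply: ext_funP.
have := series_lim_lin a hs ht.
by under eq_fun do rewrite -(bh_lin f).
Qed.

Fact ext_bdd X : bdd X -> bdd (ext_fun @` X).
Proof.
move=> /compl_bddP[S bS XS].
have [T [[_ bT] _ _ cT]] := series_lim_ex cN (bsub_image f bS).
apply: bounded_sub bT => _ [_ /XS[s Ss <-] <-].
have [|l Tl /ext_funP->//] := cT (fun n => f (terms s n)).
by move=> n; exists (terms s n).
Qed.
Definition ext : bhom compl N := BHom ext_lin ext_bdd.

Lemma extE x : ext (ceta x) = f x.
Proof.
apply: ext_funP; exists (fun n => if n is 0%N then f x else 0); split=> //.
  exists (span [set f x]); first exact: bsub_span1.
  by case=> [|n]; [exact: sub_span|exact: (span_submod _).1].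
by case=> [|n]; rewrite mkbdseqE ?(lin0 (bh_lin f)) scaler0 addr0.
Qed.

Lemma ext_unique (g : bhom compl N) : (forall x, g (ceta x) = f x) -> g =1 ext.
Proof.
move=> gf u; have [s ->] := cl_surj u; apply/esym/ext_funP.
by have := series_lim_bhom g (series_lim_cl s); under eq_fun do rewrite gf.
Qed.

End Extension.

(** Bounded maps extend by summation. An extension is unique because [cl s] is itself the sum of
    the series of the images of the terms of [s]. *)
Theorem completion_exists : is_completion ceta.
Proof.
split; first exact: compl_complete.
move=> N cN f; exists (ext cN f); split; first exact: extE.
exact: ext_unique.
Qed.

(** The sequences with first term in [pi M] form a closed kernel. Hence completing does not
    change [M / pi M]. *)
Lemma null_term0 s : null_set s -> exists y, terms s 0 = pi *: y.
Proof.
move/(_ [set s | exists y, terms s 0 = pi *: y]); apply.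
  split=> /= [|a x y [x' hx] [y' hy]]; first by exists 0; rewrite scaler0.
  by exists (a *: x' + y'); rewrite termsD termsZ hx hy scalerDr !scalerA mulrC.
split=> [t|S bS {}s Ss h] /=.
  by exists (terms t 0); rewrite termsE mkbdseqE /= subr0.
have [t _ [y E]] := h 1%N; exists (terms t 0 + y).
by rewrite scalerDr -E expr1 !termsE addrC subrK.
Qed.

End Completion.

(** * Completion and reduction modulo pi *)

Section FineModPi.
Context (V : completeDVR).
Local Notation pi := (unif V).

Lemma fg_bdd (M : bornMod V) (S : set M) : fg_set S -> bdd S.
Proof.
move=> [T fT ST]; apply: bounded_sub ST _; apply: bounded_span.
exact: bounded_finite.
Qed.

Lemma fine_mod_piP (M : bornMod V) : fine_mod_pi M <->
  forall S : set M, bdd S -> exists2 F : set M, finite_set F &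
    forall x, S x -> exists2 u, span F u & exists y, x = u + pi *: y.
Proof.
split=> [fM S bS|h X].
  have /fM[F fF SF] : bdd (M := quot_bmod (pi_sub M)) (qpi (pi_sub M) @` S) by exists S.
  exists (repr @` F); first exact: finite_image.
  move=> x Sx; have : span F (qpi (pi_sub M) x) by apply: SF; exists x.
  move=> /(span_min (N := qpi (pi_sub M) @` span (repr @` F))) [||u Fu ux].
  - exact: image_submod (@qpi_linear _ _ _) (span_submod _).
  - by move=> v Fv; exists (repr v); [apply: sub_span; exists v|exact: qreprK].
  exists u => //; have /qpiP[y E] := esym ux.
  by exists y; rewrite -E addrC subrK.
split; last exact: (@fg_bdd (quot_bmod (pi_sub M))).
move=> [S bS ->]; have [F fF hF] := h S bS.
exists (qpi (pi_sub M) @` F); first exact: finite_image.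
move=> _ [x /hF[u Fu [y ->]] <-].
have -> : qpi (pi_sub M) (u + pi *: y) = qpi (pi_sub M) u.
  by apply/qpiP; exists y; rewrite addrAC subrr add0r.
apply: image_span Fu; first exact: qpi_linear.
by move=> v Fv; apply: sub_span; exists v.
Qed.

End FineModPi.

Section Functor.
Context (V : completeDVR).
Local Notation pi := (unif V).

Section Map.
Context (M N : bornMod V) (f : bhom M N).

Fact bmap_bdd (s : bdseq M) : bounded_seq (fun n => f (terms s n)).
Proof.
have [S bS Ss] := terms_bdd s; exists (f @` S); first exact: bsub_image.
by move=> n; exists (terms s n).
Qed.
Definition bmap (s : bdseq M) : bdseq N := mkbdseq (bmap_bdd s).

Lemma bmapE s n : terms (bmap s) n = f (terms s n). Proof. by []. Qed.

Lemma bmap_linear : linear bmap.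
Proof.
by move=> a s t; apply: bdseq_inj => n; rewrite !(termsE, bmapE) (bh_lin f).
Qed.

Lemma bmap_carry t : bmap (carry t) = carry (bmap t).
Proof.
apply: bdseq_inj => n; rewrite bmapE !carryE (linB (bh_lin f)) (linZ (bh_lin f)).
by case: n => [|n] //=; rewrite (lin0 (bh_lin f)).
Qed.

End Map.

Section Cmap.
Context (M N : bornMod V) (f : bhom M N).

Definition cmap : bhom (compl M) (compl N) :=
  ext (@compl_complete V N) (bhom_comp (ceta N) f).

Lemma cmapE s : cmap (cl s) = cl (bmap f s).
Proof. by apply: ext_funP; exact: (series_lim_cl (bmap f s)). Qed.

Lemma cmap_eta x : cmap (ceta M x) = ceta N (f x).
Proof. exact: extE. Qed.

End Cmap.

End Functor.

Section Torsionfree.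
Context (V : completeDVR) (M : bornMod V) (tM : torsionfree M).
Local Notation pi := (unif V).

Lemma torsionfree_inj (x y : M) : pi *: x = pi *: y -> x = y.
Proof.
move=> E; apply/eqP; rewrite -subr_eq0; apply/eqP/tM.1.
by rewrite scalerBr E subrr.
Qed.

(** Coefficientwise, [pi t_(n+1) - t_n = pi s_(n+1)]. *)
Lemma carry_div (s t : bdseq M) : carry t = pi *: s -> t = pi *: (tail t - tail s).
Proof.
move=> E; apply: bdseq_inj => n; have := congr1 (fun x => terms x n.+1) E.
rewrite /= !termsE !mkbdseqE /= scalerBr => <-.
by rewrite opprB addrCA subrr addr0.
Qed.

Lemma null_div_aux (a z t : bdseq M) :
  pi *: a = pi *: z + carry t -> null_set z -> null_set a.
Proof.
move=> E nz; have ct : carry t = pi *: (a - z) by rewrite scalerBr E addrAC subrr add0r.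
have tE := carry_div ct; rewrite tE (linZ (@carry_linear _ _)) in ct.
rewrite -[a](subrK z); apply: (submodD (null_submod M)) => //.
suff -> : a - z = carry (tail t - tail (a - z)) by exact: (null_closed M).1.
apply: bdseq_inj => n; apply: torsionfree_inj.
by have := congr1 (fun x => terms x n) ct; rewrite /= !termsZ => ->.
Qed.

(** In the torsionfree case the submodule [pi null + (pi - X) l^oo] is a closed kernel, so it
    contains [null]. *)
Lemma null_div (s : bdseq M) : null_set (pi *: s) -> null_set s.
Proof.
pose Y := [set x | exists z t, null_set z /\ x = pi *: z + carry t] : set (bdseq M).
suff [mY cY] : is_submod Y /\ closed_kernel Y.
  by move=> /(_ Y mY cY)[z [t [nz E]]]; exact: null_div_aux E nz.
have n0 := (null_submod M).1; split.
  split=> [|a _ _ [z [t [nz ->]]] [z' [t' [nz' ->]]]].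
    by exists 0, 0; split=> //; rewrite (lin0 (@carry_linear _ _)) scaler0 addr0.
  exists (a *: z + z'), (a *: t + t'); split; first exact: (null_submod M).2.
  by rewrite carry_linear !scalerDr addrACA !scalerA mulrC.
split=> [t|S bS {}s Ss h]; first by exists 0, t; rewrite scaler0 add0r.
have [t1 _ [z1 [u1 [nz1 E1]]]] := h 1%N; rewrite expr1 in E1.
pose a := t1 + z1.
have sE : s = pi *: a + carry u1 by rewrite scalerDr -addrA -E1 addrC subrK.
exists a, u1; split=> //.
have [Sa bSa Saa] := terms_bdd a.
apply: ((null_closed M).2 (joinset S Sa)); first exact: bsub_join.
  by move=> n; exact: joinr.
move=> n; have [t St [z [u [nz E]]]] := h n.+1; exists t.
  by move=> k; exact: joinl.
apply: (null_div_aux (z := z) (t := u - u1)) => //.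
rewrite (linB (@carry_linear _ _)) addrA -E sE scalerBr scalerA -exprS.
by rewrite addrAC -(addrA (pi *: a)) subrr addr0.
Qed.

(** Suppose that [pi x] is represented by [s] with terms in [S]. Then [s 0] is divisible by [pi]
    in [M], and [x] is represented by the sum of [s 0 / pi] and the tail of [s]. *)
Lemma compl_torsionfree : torsionfree (compl M).
Proof.
have pi_inj (x : compl M) : pi *: x = 0 -> x = 0.
  have [s ->] := cl_surj x; rewrite -(linZ (@cl_linear _ _)) => /cl_eq0/null_div h.
  exact/cl_eq0.
split=> // X /compl_bddP[S bS XS].
pose S' := [set m : M | S (pi *: m)].
have bS' : bsub S'.
  split; last by apply: tM.2; apply: bounded_sub bS.2 => _ [m Sm <-].
  split=> [|a x y]; rewrite /S' /= ?scaler0; first exact: bS.1.1.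
  by move=> Sx Sy; rewrite scalerDr scalerA mulrC -scalerA; exact: bS.1.2.
apply/compl_bddP; exists (joinset S' S); first exact: bsub_join.
move=> x Xx; have [|s Ss sE] := XS (pi *: x); first by exists x.
have [a xa] := cl_surj x; move: sE; rewrite xa -(linZ (@cl_linear _ _)).
move=> sE; have /cl_eq/null_term0[y] := sE; rewrite !termsE => yE.
have {}yE : terms s 0 = pi *: (y + terms a 0).
  by rewrite scalerDr -yE subrK.
exists (single (y + terms a 0) + tail s).
  apply: (submodD (in_sub_submod (span_submod _))).
    by case=> [|n]; [apply: joinl; rewrite /S' /= -yE; exact: Ss|exact: (span_submod _).1].
  by move=> n; apply: joinr; exact: Ss.
apply/eqP; rewrite -subr_eq0; apply/eqP/pi_inj.
rewrite scalerBr -!(linZ (@cl_linear _ _)) -sE [cl s]cl_tail yE.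
rewrite scalerDr (linD (@cl_linear _ _)) !(linZ (@cl_linear _ _)).
by rewrite (linZ (@eta_lin _ _)) subrr.
Qed.

End Torsionfree.

Lemma compl_fine (V : completeDVR) (M : bornMod V) :
  fine_mod_pi M -> fine_mod_pi (compl M).
Proof.
move=> /fine_mod_piP h; apply/fine_mod_piP => X /compl_bddP[S bS XS].
have [F fF hF] := h S bS.2; exists (ceta M @` F); first exact: finite_image.
move=> _ /XS[s Ss <-]; have [u Fu [y E]] := hF _ (Ss 0%N).
exists (ceta M u).
  apply: image_span Fu; first exact: (bh_lin (ceta M)).
  by move=> v Fv; apply: sub_span; exists v.
exists (ceta M y + cl (tail s)).
rewrite cl_tail E -[eta_fun _]/(ceta M _) (linD (bh_lin (ceta M))).
by rewrite (linZ (bh_lin (ceta M))) scalerDr addrA.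
Qed.

Section PiEmbedding.
Context (V : completeDVR).
Local Notation pi := (unif V).

(** The inclusion of a submodule between [pi N] and [N], with the subspace bornology, up to
    isomorphism. The kernels of maps to modules killed by [pi] are of this form. *)
Definition pi_embedding (M N : bornMod V) (f : bhom M N) : Prop :=
  [/\ injective f, forall S, bdd (f @` S) -> bdd S &
      forall y, exists x, pi *: y = f x].

Context (M N : bornMod V) (f : bhom M N) (ef : pi_embedding f).
Let lf := bh_lin f.
Let f_inj : injective f. Proof. by case: ef. Qed.

Definition pullback (S : set N) : set M := [set x | S (f x)].

Lemma bsub_pullback S : bsub S -> bsub (pullback S).
Proof.
case: ef => _ eb _ [mS bS]; split; first exact: preimage_submod.
by apply: eb; apply: bounded_sub bS => _ [x Sx <-].
Qed.

Lemma bmap_onto S (t : bdseq N) : bsub S -> in_sub S t ->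
  (forall n, exists x, terms t n = f x) ->
  exists2 t' : bdseq M, in_sub (pullback S) t' & bmap f t' = t.
Proof.
move=> bS St /choice[t' E].
have St' n : pullback S (t' n) by rewrite /pullback /= -E; exact: St.
have h : bounded_seq t' by exists (pullback S) => //; exact: bsub_pullback.
by exists (mkbdseq h) => //; apply: bdseq_inj => n; rewrite !mkbdseqE.
Qed.

Lemma bmap_inj : injective (bmap f).
Proof.
move=> s t E; apply: bdseq_inj => n; apply: f_inj.
by have := congr1 (fun x => terms x n) E.
Qed.

(** The coefficients of [(pi - X) t] being in [M], those of [t] are as well, since [pi N <= M]. *)
Lemma null_bmap_aux (a z : bdseq M) t :
  bmap f a = bmap f z + carry t -> null_set z -> null_set a.
Proof.
move=> E nz; have ct : carry t = bmap f (a - z).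
  by rewrite (linB (bmap_linear f)) E addrAC subrr add0r.
have [S bS St] := terms_bdd t.
have [|t' _ tE] := bmap_onto bS St.
  move=> n; case: ef => _ _ /(_ (terms t n.+1))[x xE].
  exists (x - terms (a - z) n.+1); rewrite (linB lf) -xE.
  have := congr1 (fun x => terms x n.+1) ct.
  by rewrite carryE bmapE => <-; rewrite /= opprB addrCA subrr addr0.
move: ct; rewrite -tE -bmap_carry => /bmap_inj azE.
rewrite -[a](subrK z) -azE; apply: (submodD (null_submod M)) => //.
exact: (null_closed M).1.
Qed.

(** The submodule [null_M + (pi - X) l^oo(N)] is a closed kernel in [l^oo(N)], and it meets
    [l^oo(M)] in [null_M]. *)
Lemma null_bmap (s : bdseq M) : null_set (bmap f s) -> null_set s.
Proof.
pose Y := [set x | exists (z : bdseq M) t, null_set z /\ x = bmap f z + carry t].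
suff [mY cY] : is_submod Y /\ closed_kernel Y.
  by move=> /(_ Y mY cY)[z [t [nz E]]]; exact: null_bmap_aux E nz.
have n0 := (null_submod M).1; split.
  split=> [|a _ _ [z [t [nz ->]]] [z' [t' [nz' ->]]]].
    exists 0, 0; split=> //; rewrite (lin0 (@carry_linear _ _)).
    by rewrite (lin0 (bmap_linear f)) addr0.
  exists (a *: z + z'), (a *: t + t'); split; first exact: (null_submod M).2.
  by rewrite carry_linear bmap_linear scalerDr addrACA.
split=> [t|S bS {}s Ss h]; first by exists 0, t; rewrite (lin0 (bmap_linear f)) add0r.
have pi_onto t : in_sub S t -> exists2 c : bdseq M, in_sub (pullback S) c & bmap f c = pi *: t.
  move=> St; apply: (bmap_onto bS); first by move=> n; apply: (submodZ bS.1); exact: St.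
  by move=> n; case: ef => _ _ /(_ (terms t n)).
have [t1 St1 [z1 [u1 [nz1 E1]]]] := h 1%N; rewrite expr1 in E1.
have [b _ bE] := pi_onto _ St1.
pose a := b + z1.
have sE : s = bmap f a + carry u1.
  by rewrite (linD (bmap_linear f)) -addrA -E1 bE addrC subrK.
exists a, u1; split=> //.
have [Sa bSa Saa] := terms_bdd a.
apply: ((null_closed M).2 (joinset (pullback S) Sa)).
- by apply: bsub_join => //; exact: bsub_pullback.
- by move=> n; exact: joinr.
move=> n; have [t St [z [u [nz E]]]] := h n.+1; have [c Sc cE] := pi_onto _ St.
exists c; first by move=> k; exact: joinl.
apply: (null_bmap_aux (z := z) (t := u - u1)) => //.
rewrite (linB (@carry_linear _ _)) addrA -E sE (linB (bmap_linear f)).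
rewrite (linZ (bmap_linear f)) cE scalerA -exprSr.
by rewrite addrAC -(addrA (bmap f a)) subrr addr0.
Qed.

(** Carrying once turns [s] into [(s_0 + pi s_1, pi s_2, pi s_3, ...)]; beyond the first term this
    has its terms in [pi N]. *)
Lemma cl_push S (s : bdseq N) : bsub S -> in_sub S s -> (exists x, terms s 0 = f x) ->
  exists2 c : bdseq M, in_sub (pullback S) c & cl (bmap f c) = cl s.
Proof.
move=> bS Ss [x0 x0E].
pose s' := s + carry (tail s).
have s'0 : terms s' 0 = terms s 0 + pi *: terms s 1.
  by rewrite !termsE !mkbdseqE subr0.
have s'S n : terms s' n.+1 = pi *: terms s n.+2.
  by rewrite !termsE !mkbdseqE addrCA subrr addr0.
have [|n|c Sc cE] := @bmap_onto S s' bS.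
- case=> [|n]; last by rewrite s'S; exact: (submodZ bS.1).
  by rewrite s'0; apply: (submodD bS.1) => //; exact: (submodZ bS.1).
- case: ef => _ _ ep; case: n => [|n].
    have [x xE] := ep (terms s 1); exists (x0 + x).
    by rewrite (linD lf) s'0 x0E xE.
  by have [x xE] := ep (terms s n.+2); exists x; rewrite s'S.
exists c => //; rewrite cE; apply/cl_eq; rewrite /s' addrAC subrr add0r.
exact: (null_closed N).1.
Qed.

Lemma compl_pi_embedding : pi_embedding (cmap f).
Proof.
have cinj : injective (cmap f).
  move=> u v E; apply/eqP; rewrite -subr_eq0; apply/eqP; move/eqP: E.
  rewrite -subr_eq0 -(linB (bh_lin (cmap f))) => /eqP.
  have [s ->] := cl_surj (u - v); rewrite cmapE => /cl_eq0/null_bmap h.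
  exact/cl_eq0.
split=> // [X /compl_bddP[S bS XS]|y].
  apply/compl_bddP; exists (pullback S); first exact: bsub_pullback.
  move=> x Xx; have [|s Ss sE] := XS (cmap f x); first by exists x.
  have [|c Sc cE] := cl_push bS Ss; last by exists c => //; apply: cinj; rewrite cmapE cE.
  have [a xa] := cl_surj x; move: sE; rewrite xa cmapE => /cl_eq/null_term0[y yE].
  case: ef => _ _ /(_ y)[m mE]; exists (m + terms a 0).
  by rewrite (linD lf) -mE -yE !termsE mkbdseqE subrK.
have [s ->] := cl_surj y; rewrite -(linZ (@cl_linear _ _)).
have [S bS Ss] := terms_bdd s.
have Sps : in_sub S (pi *: s) by move=> n; apply: (submodZ bS.1); exact: Ss.
have [|c _ cE] := cl_push bS Sps; last by exists (cl c); rewrite cmapE.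
by case: ef => _ _ /(_ (terms s 0)).
Qed.

Lemma cmap_image (u : compl N) s : u = cl s -> (exists x, terms s 0 = f x) ->
  exists v, u = cmap f v.
Proof.
move=> -> h; have [S bS Ss] := terms_bdd s.
by have [c _ cE] := cl_push bS Ss h; exists (cl c); rewrite cmapE.
Qed.

End PiEmbedding.

(** * Completion and linear growth of algebras *)

(** Lets unification find the bornological module behind the carrier of an algebra. *)
Canonical ba_mod.

Section CauchyProduct.
Context (V : completeDVR) (B : bornAlg V).
Local Notation pi := (unif V).
Local Notation M := (ba_mod B).
Implicit Types a b c : bdseq M.

(** The Cauchy product, by recursion along [u = u_0 + X u']. *)
Fixpoint cauchy (u v : nat -> B) (n : nat) : B :=
  (u 0 ** v n : B) + (if n is m.+1 then cauchy (fun i => u i.+1) v m else 0).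

Lemma cauchy_in (S T U : set B) u v : is_submod U ->
  (forall x y, S x -> T y -> U (x ** y)) ->
  (forall n, S (u n)) -> (forall n, T (v n)) -> forall n, U (cauchy u v n).
Proof.
move=> mU h Su Tv n; elim: n u Su => [|n IH] u Su /=; apply: (submodD mU).
- exact: h.
- exact: mU.1.
- exact: h.
- by apply: IH => i; exact: Su.
Qed.

Fact bmul_bdd a b : bounded_seq (cauchy (terms a) (terms b) : nat -> M).
Proof.
have [S bS Sa] := terms_bdd a; have [T bT Tb] := terms_bdd b.
exists (span (mulset (A := B) S T)).
  by apply: bsub_span; apply: (ba_bdd bS.2 bT.2).
apply: cauchy_in Sa Tb; first exact: span_submod.
by move=> x y Sx Ty; apply: sub_span; exists x, y.
Qed.
Definition bmul a b : bdseq M := mkbdseq (bmul_bdd a b).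

Lemma bmul0E a b : terms (bmul a b) 0 = (terms a 0 : B) ** terms b 0.
Proof. by rewrite mkbdseqE /= addr0. Qed.

Lemma bmulSE a b n : terms (bmul a b) n.+1 =
  ((terms a 0 : B) ** terms b n.+1 : M) + terms (bmul (tail a) b) n.
Proof. by []. Qed.

Lemma bmul_in (S T U : set M) a b : is_submod U ->
  (forall x y : B, S x -> T y -> U (x ** y)) ->
  in_sub S a -> in_sub T b -> in_sub U (bmul a b).
Proof. by move=> mU h Sa Tb n; exact: (cauchy_in mU h Sa Tb). Qed.

Lemma tail_linear : linear (@tail V M).
Proof. by move=> x s t; apply: bdseq_inj. Qed.

Lemma bmul_bilin : bilin bmul.
Proof.
split=> [a|b] x u v; apply: bdseq_inj => n.
  elim: n a => [|n IH] a; rewrite !termsE ?bmul0E ?bmulSE ?termsE.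
    exact: (na_lin1 (terms a 0 : B)).
  by rewrite (na_lin1 (terms a 0 : B)) IH !termsE scalerDr addrACA.
elim: n u v => [|n IH] u v; rewrite !termsE ?bmul0E ?bmulSE ?termsE.
  exact: (na_lin2 (terms b 0 : B)).
by rewrite (na_lin2 (terms b n.+1 : B)) tail_linear IH !termsE scalerDr addrACA.
Qed.

Lemma bmul_shiftl a b : bmul (shift a) b = shift (bmul a b).
Proof.
apply: bdseq_inj => -[|n]; first by rewrite bmul0E; exact: lin0 (na_lin2 _).
rewrite bmulSE (lin0 (na_lin2 _)) add0r.
by have -> : tail (shift a) = a by exact: bdseq_inj.
Qed.

Lemma bmul_shiftr a b : bmul a (shift b) = shift (bmul a b).
Proof.
apply: bdseq_inj => -[|n]; first by rewrite bmul0E; exact: lin0 (na_lin1 _).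
rewrite [RHS]/(terms (bmul a b) n); elim: n a => [|n IH] a.
  rewrite bmulSE !bmul0E [terms (shift b) 0]/(0 : M) (lin0 (na_lin1 _)) addr0.
  by rewrite -[RHS]/(terms (bmul a b) 0) bmul0E.
by rewrite bmulSE IH.
Qed.

Lemma bmul_single (x : M) b n : terms (bmul (single x) b) n = (x : B) ** terms b n.
Proof.
case: n => [|n]; first by rewrite bmul0E.
rewrite bmulSE; have -> : tail (single x) = 0 by apply: bdseq_inj.
by rewrite (lin0 (bmul_bilin.2 b)) addr0.
Qed.

Lemma bmul_step a b :
  bmul a b = bmul (single (terms a 0)) b + shift (bmul (tail a) b).
Proof.
by rewrite {1}[a]bdseq_split (linD (bmul_bilin.2 b)) bmul_shiftl.
Qed.

Lemma bmul_singleA (x : M) a b :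
  bmul (bmul (single x) a) b = bmul (single x) (bmul a b).
Proof.
apply: bdseq_inj => n; elim: n a => [|n IH] a.
  by rewrite !(bmul0E, bmul_single) na_mulA.
rewrite bmulSE !bmul_single bmulSE (linD (na_lin1 (x : B))) na_mulA.
have -> : tail (bmul (single x) a) = bmul (single x) (tail a).
  by apply: bdseq_inj => i; rewrite bmul_single mkbdseqE bmul_single.
by rewrite IH bmul_single.
Qed.

Lemma bmulA : associative bmul.
Proof.
have [l1 l2] := bmul_bilin; move=> a b c; apply: bdseq_inj => n.
elim: n a => [|n IH] a; rewrite (bmul_step a (bmul b c)) (bmul_step a b).
  by rewrite (linD (l2 _)) bmul_singleA bmul_shiftl.
rewrite (linD (l2 _)) bmul_singleA bmul_shiftl !termsD.
by congr (_ + _); exact: IH.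
Qed.

Definition bdseq_nualg : nualg V := NuAlg bmul_bilin bmulA.

(** For each [a], the sequences that left multiplication by [a] maps into [null] form a closed
    kernel. *)
Fact null_mull a s : null_set s -> null_set (bmul a s).
Proof.
have [l1 l2] := bmul_bilin.
move/(_ [set s | null_set (bmul a s)]); apply.
  exact: preimage_submod (l1 a) (null_submod M).
split=> [t|S bS {}s Ss h] /=.
  rewrite /carry (linB (l1 a)) (linZ (l1 a)) bmul_shiftr.
  exact: (null_closed M).1.
have [T bT Ta] := terms_bdd a.
pose U : set M := span (mulset (A := B) T S).
have bU : bsub (M := M) U by apply: bsub_span; exact: (ba_bdd bT.2 bS.2).
have Um t : in_sub S t -> in_sub U (bmul a t).
  move=> St; apply: bmul_in Ta St => [|x y Tx Sy]; first exact: bU.1.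
  by apply: sub_span; exists x, y.
apply: ((null_closed M).2 U) => // [|n]; first exact: Um.
have [t St ht] := h n; exists (bmul a t); first exact: Um.
by rewrite -(linZ (l1 a)) -(linB (l1 a)).
Qed.

Fact null_mulr s a : null_set s -> null_set (bmul s a).
Proof.
have [l1 l2] := bmul_bilin.
move/(_ [set s | null_set (bmul s a)]); apply.
  exact: preimage_submod (l2 a) (null_submod M).
split=> [t|S bS {}s Ss h] /=.
  rewrite /carry (linB (l2 a)) (linZ (l2 a)) bmul_shiftl.
  exact: (null_closed M).1.
have [T bT Ta] := terms_bdd a.
pose U : set M := span (mulset (A := B) S T).
have bU : bsub (M := M) U by apply: bsub_span; exact: (ba_bdd bS.2 bT.2).
have Um t : in_sub S t -> in_sub U (bmul t a).
  move=> St; apply: bmul_in St Ta => [|x y Sx Ty]; first exact: bU.1.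
  by apply: sub_span; exists x, y.
apply: ((null_closed M).2 U) => // [|n]; first exact: Um.
have [t St ht] := h n; exists (bmul t a); first exact: Um.
by rewrite -(linZ (l2 a)) -(linB (l2 a)).
Qed.

Definition null_ideal : ideal bdseq_nualg :=
  @Ideal V bdseq_nualg (null M) null_mull null_mulr.

End CauchyProduct.

Section QuotientAlgebra.
Context (V : comNzRingType) (A : nualg V) (J : ideal A).

Definition quot_mul (u v : quotm J) : quotm J := qpi J (repr u ** repr v).

Lemma quot_mulE x y : quot_mul (qpi J x) (qpi J y) = qpi J (x ** y).
Proof.
apply/qpiP; set x' := repr _; set y' := repr _.
have -> : x' ** y' - x ** y = x' ** (y' - y) + (x' - x) ** y.
  rewrite (linB (na_lin1 _)) (linB (na_lin2 y)) addrA subrK //.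
apply: (submodD (sm_closed J)); first by apply: id_mull; exact: qrepr_pi.
by apply: id_mulr; exact: qrepr_pi.
Qed.

Fact quot_mul_bilin : bilin quot_mul.
Proof.
split=> [u|v] a x y; rewrite -(qreprK x) -(qreprK y) ?(-(qreprK u)) ?(-(qreprK v)).
  rewrite -[u]qreprK -qpi_linear !quot_mulE -qpi_linear.
  by rewrite (na_lin1 (repr u)).
by rewrite -[v]qreprK -qpi_linear !quot_mulE -qpi_linear (na_lin2 (repr v)).
Qed.

Fact quot_mulA : associative quot_mul.
Proof.
by move=> u v w; rewrite -(qreprK u) -(qreprK v) -(qreprK w) !quot_mulE na_mulA.
Qed.

Definition quot_nualg : nualg V := NuAlg quot_mul_bilin quot_mulA.
End QuotientAlgebra.

Section CompletedAlgebra.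
Context (V : completeDVR) (B : bornAlg V).
Local Notation pi := (unif V).

Definition compl_nualg : nualg V := quot_nualg (null_ideal B).

Lemma cl_mul (s t : bdseq (ba_mod B)) :
  (cl s : compl_nualg) ** cl t = cl (bmul s t).
Proof. exact: quot_mulE. Qed.

Fact compl_alg_bdd (X Y : set compl_nualg) :
  bdd (M := compl (ba_mod B)) X -> bdd (M := compl (ba_mod B)) Y ->
  bdd (M := compl (ba_mod B)) (mulset X Y).
Proof.
move=> /compl_bddP[S bS XS] /compl_bddP[T bT YT]; apply/compl_bddP.
exists (span (mulset (A := B) S T)).
  by apply: bsub_span; exact: (ba_bdd bS.2 bT.2).
move=> _ [x [y [/XS[s Ss <-] /YT[t Tt <-] ->]]]; rewrite cl_mul.
exists (bmul s t) => //; apply: bmul_in Ss Tt; first exact: span_submod.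
by move=> u v Su Tv; apply: sub_span; exists u, v.
Qed.
Definition compl_alg : bornAlg V := @BornAlg V compl_nualg _ compl_alg_bdd.

Lemma ceta_mul (x y : B) :
  (ceta (ba_mod B) (x ** y) : compl_alg) = (ceta (ba_mod B) x : compl_alg) ** ceta (ba_mod B) y.
Proof.
rewrite [RHS]cl_mul; congr cl; apply: bdseq_inj => -[|n]; rewrite bmul_single //.
by rewrite [RHS](lin0 (na_lin1 _)).
Qed.

Definition ceta_ahom : ahom B compl_alg := @AHom V B compl_alg (ceta (ba_mod B)) ceta_mul.

End CompletedAlgebra.

Section CompletedHom.
Context (V : completeDVR) (B C : bornAlg V) (f : ahom B C).

Lemma bmap_bmul s t : bmap f (bmul s t) = bmul (bmap f s) (bmap f t).
Proof.
apply: bdseq_inj => n; elim: n s => [|n IH] s.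
  by rewrite bmapE !bmul0E (ah_mul f).
by rewrite bmapE !bmulSE (linD (bh_lin f)) (ah_mul f) -(bmapE f (bmul (tail s) t)) IH.
Qed.

Lemma cmap_mul (x y : compl_alg B) :
  (cmap f (x ** y) : compl_alg C) = (cmap f x : compl_alg C) ** cmap f y.
Proof.
have [s ->] := cl_surj x; have [t ->] := cl_surj y.
by rewrite cl_mul !cmapE cl_mul bmap_bmul.
Qed.

Definition compl_ahom : ahom (compl_alg B) (compl_alg C) :=
  @AHom V (compl_alg B) (compl_alg C) (cmap f) cmap_mul.
End CompletedHom.

Section CompletedPro.
Context (V : completeDVR) (J : dirset) (B : proalg V J).

Fact compl_pro_id i (h : dle i i) x : compl_ahom (pa_tr B h) x = x.
Proof.
have [s ->] := cl_surj x; rewrite [LHS]cmapE; congr cl.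
by apply: bdseq_inj => n; rewrite bmapE pa_id.
Qed.
Fact compl_pro_comp i j k (h : dle i j) (h' : dle j k) (h'' : dle i k) x :
  compl_ahom (pa_tr B h) (compl_ahom (pa_tr B h') x) = compl_ahom (pa_tr B h'') x.
Proof.
have [s ->] := cl_surj x.
rewrite [compl_ahom (pa_tr B h') _]cmapE [LHS]cmapE [RHS]cmapE; congr cl.
by apply: bdseq_inj => n; rewrite !bmapE (pa_comp h h' h'').
Qed.
Definition compl_pro : proalg V J :=
  @ProAlg V J (fun j => compl_alg (B j)) (fun i j h => compl_ahom (pa_tr B h))
    compl_pro_id compl_pro_comp.

Lemma compl_proP : pro_completion B compl_pro.
Proof.
exists (fun j => ceta_ahom (B j)); split=> [j|i j h x].
  exact: completion_exists.
exact/esym/cmap_eta.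
Qed.
End CompletedPro.

Lemma apow_ind (V : comNzRingType) (A : nualg V) (T : set A) (P : nat -> set A) :
  (forall i, is_submod (P i)) -> T `<=` P 0%N ->
  (forall i x y, P i x -> T y -> P i.+1 (x ** y)) ->
  forall i, apow T i.+1 `<=` P i.
Proof.
move=> mP T0 TS i; apply: span_min => // _ [x [s [<- Tx Ts ->]]].
elim/last_ind: s Ts => [|s z IH] Ts; first exact: T0.
rewrite size_rcons /aprod -cats1 foldl_cat /=; apply: TS.
  by apply: IH => y ys; apply: Ts; rewrite mem_rcons inE ys orbT.
by apply: Ts; rewrite mem_rcons mem_head.
Qed.

Section LinearGrowthSets.
Context (V : comNzRingType) (t : V) (B : bornAlg V).
Implicit Types T : set B.

Lemma sub_apow T i y : apow T i.+1 y -> forall x, T x -> apow T i.+2 (y ** x).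
Proof.
move=> Ty x Tx; rewrite -addn1; apply: apowM => //; exact: sub_apow1.
Qed.

(** A product of [i+1] elements [t^j y], each with [y] in [T^(j+1)], is [t^(sum j)] times an
    element of [T^(i + 1 + sum j)]. *)
Lemma lg_sum_idem T i x :
  apow (lg_sum t T) i.+1 x -> lg_sum t T (t ^+ i *: x).
Proof.
pose G i := span [set z | exists j y, apow T (j + i).+1 y /\ z = t ^+ j *: y].
have : apow (lg_sum t T) i.+1 `<=` G i.
  apply: (apow_ind (P := G)) => [{}i|y|{}i {}x y]; first exact: span_submod.
    by apply: span_mono => _ [j [z [Tz ->]]]; exists j, z; rewrite addn0.
  apply: span_mulset; first exact: span_submod.
  move=> _ _ [j [u [Tu ->]]] [k [v [Tv ->]]].
  rewrite (linZ (na_lin1 _)) (linZ (na_lin2 v)) scalerA -exprD.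
  apply: sub_span; exists (k + j)%N, (u ** v); split=> //.
  have -> : (k + j + i.+1).+1 = ((j + i).+1 + k.+1)%N.
    by rewrite !addSn !addnS -addnA addnC.
  exact: apowM.
move=> /[apply].
apply: (span_min (N := [set x | lg_sum t T (t ^+ i *: x)])) => [|_ [j [y [Ty ->]]]].
  have lZ : linear ( *:%R (t ^+ i) : B -> B).
    by move=> a u v; rewrite scalerDr !scalerA mulrC.
  exact: preimage_submod lZ (span_submod _).
by rewrite /= scalerA -exprD; apply: sub_span; exists (i + j)%N, y; rewrite addnC.
Qed.

(** The terms with [i > 0] are divisible by [t]; to compensate for the lost factor, merge the
    first two letters of each product. *)
Lemma lg_sum_split T x : is_submod T -> lg_sum t T x ->
  exists y u, [/\ T y, lg_sum t (span (T `|` mulset T T)) u & x = y + t *: u].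
Proof.
move=> mT; set U := span _.
pose Q := [set x | exists y u, [/\ T y, lg_sum t U u & x = y + t *: u]].
apply: (span_min (N := Q)); first split.
- by exists 0, 0; split; [exact: mT.1|exact: (span_submod _).1|rewrite scaler0 addr0].
- move=> a _ _ [y [u [Ty Uu ->]]] [y' [u' [Ty' Uu' ->]]].
  exists (a *: y + y'), (a *: u + u'); split; [exact: mT.2|exact: (span_submod _).2|].
  by rewrite !scalerDr !scalerA addrACA mulrC.
move=> _ [[|i] [y [Ty ->]]].
  exists y, 0; split; [|exact: (span_submod _).1|by rewrite expr0 scale1r scaler0 addr0].
  by apply: span_min Ty => // _ [z [s [/size0nil-> Tz _ ->]]].
exists 0, (t ^+ i *: y); split; [exact: mT.1| |by rewrite add0r scalerA exprS].
apply: sub_span; exists i, y; split=> //.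
move: y Ty; apply: span_min => [|_ [x0 [[|x1 s] [//= [szs] Tx0 Ts ->]]]].
  exact: span_submod.
apply: sub_span; exists (x0 ** x1), s; split=> //.
  apply: sub_span; right; exists x0, x1; split=> //; apply: Ts; exact: mem_head.
by move=> z zs; apply: sub_span; left; apply: Ts; rewrite inE zs orbT.
Qed.

End LinearGrowthSets.

Section Dagger.
Context (V : completeDVR) (B : bornAlg V).
Local Notation pi := (unif V).

(** If [pi s = y + pi u] with [y] in [T], then [s - u] lies in the bounded set [pi^-1 T]. *)
Lemma lg_torsionfree : torsionfree (ba_mod B) -> torsionfree (ba_mod (lg_alg pi B)).
Proof.
move=> tB; split; first exact: tB.1.
move=> S [T [mT bT] ST]; pose U := span (T `|` mulset T T).
pose T' := [set x : B | T (pi *: x)].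
have bT' : bounded (ba_born B) T'.
  by apply: tB.2; apply: bounded_sub bT => _ [x Tx <-].
have bU : bounded (ba_born B) U.
  by apply: bounded_span; apply: bounded_setU => //; exact: ba_bdd.
exists (span (T' `|` U)).
  by apply: (bsub_span (M := ba_mod B)); exact: bounded_setU.
move=> s Ss; have [|y [u [Ty Uu E]]] := @lg_sum_split _ pi B T (pi *: s) mT.
  by apply: ST; exists s.
rewrite -[s](subrK u); apply: (submodD (span_submod _)).
  apply: sub_lg_sum; apply: sub_span; left.
  by rewrite /T' /= scalerBr E addrK.
by apply: lg_sum_mono Uu => x Ux; apply: sub_span; right.
Qed.

Lemma lg_fine : fine_mod_pi (ba_mod B) -> fine_mod_pi (ba_mod (lg_alg pi B)).
Proof.
move=> /fine_mod_piP fB; apply/fine_mod_piP => S [T [mT bT] ST].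
have [F fF hF] := fB T bT; exists F => // s /ST Ts.
have [y [u [/hF[v Fv [y' ->]] _ ->]]] := lg_sum_split mT Ts.
by exists v => //; exists (y' + u); rewrite scalerDr addrA.
Qed.

(** A bounded subset consists of classes of sequences with terms in [S' = lg_sum T0], and
    [pi^i S'^(i+1) <= S']. *)
Lemma compl_lg_semidagger : semidagger (compl_alg (lg_alg pi B)).
Proof.
move=> X [T [mT /compl_bddP[S [mS [T0 bT0 ST0]] TS]] XT].
pose S' : set (ba_mod (lg_alg pi B)) := lg_sum (A := B) pi T0.
have mS' : is_submod S' by exact: span_submod.
have bS' : bsub S' by split=> //; exists T0.
apply/compl_bddP; exists S' => //; apply: subset_trans XT _.
apply: span_min => [|_ [i [y [Ty ->]]]].
  exact: image_submod (@cl_linear _ _) (in_sub_submod mS').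
pose P i := @cl V (ba_mod (lg_alg pi B)) @`
  in_sub (M := ba_mod (lg_alg pi B)) (apow (A := B) S' i.+1).
have /(_ _ Ty)[s Ss <-] : apow T i.+1 `<=` P i.
  apply: (apow_ind (A := compl_alg (lg_alg pi B)) (P := P)).
  - move=> j; apply: image_submod; first exact: cl_linear.
    by apply: in_sub_submod; exact: apow_submod.
  - move=> x /TS[s Ss <-]; exists s => // n; apply: sub_apow1; apply: ST0; exact: Ss.
  move=> j _ _ [s Ss <-] /TS[s' Ss' <-]; rewrite cl_mul; exists (bmul s s') => //.
  apply: bmul_in Ss Ss'; first exact: apow_submod.
  by move=> u v Su Sv; apply: sub_apow => //; exact: ST0.
exists (pi ^+ i *: s); last by rewrite (linZ (@cl_linear _ _)).
by move=> n; apply: lg_sum_idem; exact: Ss.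
Qed.

Theorem compl_lg_dagger : torsionfree (ba_mod B) -> dagger (compl_alg (lg_alg pi B)).
Proof.
move=> tB; split; first exact: compl_complete.
  by apply: compl_torsionfree; exact: lg_torsionfree.
exact: compl_lg_semidagger.
Qed.

End Dagger.

Section LinearGrowthEmbedding.
Context (V : completeDVR) (B C : bornAlg V) (f : ahom B C).
Context (ef : pi_embedding f).
Local Notation pi := (unif V).

Lemma apow_pullback (P : set C) : (forall y, P y -> exists x, y = f x) ->
  forall i, apow P i.+1 `<=` (f : B -> C) @` apow (pullback f P : set B) i.+1.
Proof.
move=> Pf; apply: apow_ind => [i|y Py|i _ y [x Px <-] Py].
- exact: image_submod (bh_lin f) (apow_submod _ _).
- by have [x yx] := Pf _ Py; exists x => //; apply: sub_apow1; rewrite /pullback /= -yx.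
have [x' yx] := Pf _ Py; exists (x ** x'); last by rewrite (ah_mul f) yx.
by apply: sub_apow => //; rewrite /pullback /= -yx.
Qed.

(** Let [i > 0]. Split a product of [i+1] letters into [q] groups of two or three letters and
    give one factor [pi] to each group. At least [q - 1] factors [pi] are left, which is what
    linear growth over the groups requires. *)
Lemma lg_sum_pairs (T : set C) : is_submod T ->
  let P := span [set z | exists2 x, (mulset T T `|` mulset (mulset T T) T) x & z = pi *: x] in
  forall x, lg_sum pi T x -> exists y v, [/\ T y, lg_sum pi P v & x = y + v].
Proof.
move=> mT P.
pose Q := [set x | exists y v, [/\ T y, lg_sum pi P v & x = y + v]].
have mQ : is_submod Q.
  split=> [|a _ _ [y [u [Ty Uu ->]]] [y' [u' [Ty' Uu' ->]]]].
    by exists 0, 0; split; [exact: mT.1|exact: (span_submod _).1|rewrite addr0].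
  exists (a *: y + y'), (a *: u + u'); split; [exact: mT.2|exact: (span_submod _).2|].
  by rewrite !scalerDr addrACA.
have P2 x y : T x -> T y -> P (pi *: (x ** y)).
  by move=> Tx Ty; apply: sub_span; exists (x ** y) => //; left; exists x, y.
have P3 x y z : T x -> T y -> T z -> P (pi *: (x ** y ** z)).
  move=> Tx Ty Tz; apply: sub_span; exists (x ** y ** z) => //; right.
  by exists (x ** y), z; split=> //; exists x, y.
have key n : forall x s, (size s <= n)%N -> (0 < size s)%N -> T x ->
    (forall y, y \in s -> T y) -> lg_sum pi P (pi ^+ size s *: aprod x s).
  elim: n => [|n IH] x s; first by case: s.
  case: s => [//|y [|z s]] /= szs _ Tx Ts.
    by rewrite expr1; apply: sub_lg_sum; apply: P2 => //; apply: Ts; exact: mem_head.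
  have Ty : T y by apply: Ts; exact: mem_head.
  have Tz : T z by apply: Ts; rewrite !inE eqxx orbT.
  case: s szs Ts => [|z' s] szs Ts.
    rewrite exprS -scalerA expr1; apply: (submodZ (span_submod _)).
    by apply: sub_lg_sum; exact: P3.
  rewrite -aprod_mul.
  have E m (p w : C) : pi ^+ m.+2 *: (p ** w) = pi *: ((pi *: p) ** (pi ^+ m *: w)).
    rewrite (linZ (na_lin1 (pi *: p))) (linZ (na_lin2 w)) !scalerA; congr (_ *: _).
    by rewrite !exprS [pi ^+ m * pi]mulrC.
  rewrite E.
  have : lg_sum pi P (pi ^+ size (z' :: s) *: aprod z (z' :: s)).
    apply: IH => //; first exact: ltnW.
    by move=> u us; apply: Ts; rewrite !in_cons in us *; rewrite us !orbT.
  move: (pi ^+ size (z' :: s) *: _) => w Pw.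
  move: w Pw; apply: (span_min (N := [set w | lg_sum pi P (pi *: ((pi *: (x ** y)) ** w))])).
    apply: (preimage_submod (f := fun w => pi *: ((pi *: (x ** y)) ** w))).
      by move=> a u v; rewrite na_lin1 scalerDr !scalerA mulrC.
    exact: span_submod.
  move=> _ [j [v [Pv ->]]] /=; rewrite (linZ (na_lin1 _)) scalerA -exprS.
  apply: sub_span; exists j.+1, ((pi *: (x ** y)) ** v); split=> //.
  have := @apowM _ _ P 0 j (pi *: (x ** y)) v; rewrite add1n; apply=> //.
  by apply: sub_apow1; exact: P2.
apply: (span_min mQ) => _ [i [y [Ty ->]]].
move: y Ty; apply: (span_min (N := [set y | Q (pi ^+ i *: y)])) => [|_ [x [s [szs Tx Ts ->]]]].
  apply: (preimage_submod (f := *:%R (pi ^+ i))) mQ.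
  by move=> a u v; rewrite scalerDr !scalerA mulrC.
case: i szs => [|i] szs.
  exists x, 0; split=> //; first exact: (span_submod _).1.
  by case: s szs {Ts} => //; rewrite expr0 scale1r addr0.
exists 0, (pi ^+ i.+1 *: aprod x s); split; [exact: mT.1| |by rewrite add0r].
by rewrite -szs; apply: (key (size s)) => //; rewrite szs.
Qed.

(** The sets [P] in [lg_sum_pairs] consist of multiples of [pi], so they lie in [B]; what is left
    of an element of [B] is then a bounded part that lies in [B] as well. *)
Lemma lg_pi_embedding : pi_embedding (lg_ahom pi f).
Proof.
case: ef => injf embf pif; split=> // S [T [mT bT] ST].
have lf := bh_lin f.
have [T' T'E] : exists T', T' = mulset T T `|` mulset (mulset T T) T by eexists.
pose P := span [set z | exists2 x, T' x & z = pi *: x].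
have bP : bsub (M := ba_mod C) P.
  apply: (bsub_span (M := ba_mod C)).
  apply: (@bounded_sub _ _ (ba_born C) _ (span T')).
    by move=> _ [x T'x ->]; apply: (submodZ (span_submod _)); exact: sub_span.
  apply: bounded_span; rewrite T'E; apply: bounded_setU; first exact: ba_bdd.
  by apply: ba_bdd => //; exact: ba_bdd.
have Pf y : P y -> exists x, y = f x.
  move=> Py; suff [x _ <-] : ((f : B -> C) @` setT) y by exists x.
  apply: span_min Py; first exact: image_submod lf (submodT _).
  by move=> _ [z _ ->]; have [x xE] := pif z; exists x.
have bsT := bsub_pullback ef (conj mT bT : bsub (M := ba_mod C) T).
have bsP := bsub_pullback ef bP.
exists (joinset (M := ba_mod B) (pullback f T) (pullback f P)); first exact: bsub_join.
move=> s Ss; have [|y [v [Ty Pv E]]] := @lg_sum_pairs T mT (f s).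
  by apply: ST; exists s.
rewrite -/T' -T'E -/P in Pv.
have [n Pn nE] : ((f : B -> C) @` lg_sum pi (pullback f P : set B)) v.
  apply: span_min Pv => [|_ [i [z [Pz ->]]]].
    by apply: image_submod lf _; exact: span_submod.
  have [z' Pz' <-] := apow_pullback Pf Pz.
  exists (pi ^+ i *: z'); last by rewrite (linZ lf).
  by apply: sub_span; exists i, z'.
rewrite -[s](subrK n); apply: (submodD (span_submod _)).
  apply: sub_lg_sum; apply: joinl; rewrite /pullback /= (linB lf) E -nE addrK //.
by apply: lg_sum_mono Pn => x; exact: joinr.
Qed.

End LinearGrowthEmbedding.

(** * Lifting modules and actions from the residue field *)

Section PureSubmodules.
Context (V : completeDVR).
Local Notation pi := (unif V).

Lemma unit_or_pi (c : V) : c \is a GRing.unit \/ exists d, c = pi * d.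
Proof.
have [->|c0] := eqVneq c 0; first by right; exists 0; rewrite mulr0.
have [u [[|n] [uu ->]]] := unif_factor c0; first by left; rewrite expr0 mulr1.
by right; exists (u * pi ^+ n); rewrite mulrCA -exprS.
Qed.

(** A maximal [G] that is pure with respect to [C] works. If no [u] were good for [w], then [G + V w]
    would be pure too: for [u + c w] in [C], a unit [c] would make [- c^-1 u] good for [w], and
    otherwise [c w] is in [C]. *)
Lemma pure_submod_ex (X : lmodType V) (H C : set X) :
  is_submod H -> is_submod C -> (forall x, C (pi *: x)) ->
  exists G : set X, [/\ is_submod G, G `<=` H,
    forall x, G x -> C x -> exists2 y, G y & x = pi *: y &
    forall w, H w -> exists2 u, G u & C (w - u)].
Proof.
move=> mH mC piC.
pose pure G := [/\ is_submod G, G `<=` H &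
  forall x, G x -> C x -> exists2 y, G y & x = pi *: y].
have pure0 : pure [set 0].
  split=> [|_ ->|_ -> _]; last by exists 0; rewrite ?scaler0.
    by split=> // a _ _ -> ->; rewrite scaler0 addr0.
  exact: mH.1.
pose pure' G := G = set0 \/ pure G.
have [F FP totF|G [hG maxG]] := @Zorn_bigcup X pure'.
  have [[G0 FG0 pG0]|none] := pselect (exists2 G, F G & pure G); last first.
    left; apply/seteqP; split=> // x [G FG Gx].
    by case: (FP _ FG) => [Ge|pG]; [rewrite Ge in Gx|case: none; exists G].
  right; split.
  - split; first by exists G0 => //; case: pG0 => -[].
    move=> a x y [G FG Gx] [G' FG' Gy].
    have [S [FS Sx Sy]] : exists S, [/\ F S, S x & S y].
      by case: (totF _ _ FG FG') => h; [exists G'|exists G]; split=> //; exact: h.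
    exists S => //; case: (FP _ FS) => [S0|[mS _ _]]; first by rewrite S0 in Sx.
    exact: mS.2.
  - move=> x [G FG Gx]; case: (FP _ FG) => [Ge|[_ GH _]]; last exact: GH.
    by rewrite Ge in Gx.
  move=> x [G FG Gx] Cx; case: (FP _ FG) => [G0'|[_ _ hG]].
    by rewrite G0' in Gx.
  by have [y Gy ->] := hG x Gx Cx; exists y => //; exists G.
have [mG GH pG] : pure G.
  case: hG => // G0; exfalso; apply: (maxG [set 0]); last by right.
  by rewrite G0; split=> // /(_ 0 erefl).
exists G; split=> // w Hw; apply: contrapT => noG.
pose G' := [set x | exists u c, G u /\ x = u + c *: w].
suff pG' : pure G'.
  apply: (maxG G'); last by right.
  split; first by move=> u Gu; exists u, 0; rewrite scale0r addr0.
  move=> G'G; apply: noG; exists w; last by rewrite subrr; exact: mC.1.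
  by apply: G'G; exists 0, 1; rewrite scale1r add0r; split=> //; exact: mG.1.
split.
- split; first by exists 0, 0; rewrite scale0r addr0; split=> //; exact: mG.1.
  move=> a _ _ [u [c [Gu ->]]] [v [d [Gv ->]]].
  exists (a *: u + v), (a * c + d); split; first exact: mG.2.
  by rewrite scalerDr scalerDl scalerA addrACA.
- move=> _ [u [c [Gu ->]]]; apply: (submodD mH); first exact: GH.
  exact: (submodZ mH).
move=> _ [u [c [Gu ->]]] Cx; have [uc|[d cE]] := unit_or_pi c.
  exfalso; apply: noG; exists (- (c^-1 *: u)); first by apply: (submodN mG); exact: (submodZ mG).
  have := submodZ mC c^-1 Cx.
  by rewrite scalerDr scalerA mulVr // scale1r opprK addrC.
have [|y Gy yE] := pG u Gu.
  have Cw : C (c *: w) by rewrite cE -scalerA; exact: piC.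
  by rewrite -[u](addrK (c *: w)); exact: (submodB mC).
exists (y + d *: w); first by exists y, d.
by rewrite yE cE scalerDr scalerA.
Qed.

Lemma pi_pow_torsionfree (X : lmodType V) (tX : forall x : X, pi *: x = 0 -> x = 0)
  n (x y : X) : pi ^+ n *: x = pi ^+ n *: y -> x = y.
Proof.
move=> E; apply/eqP; rewrite -subr_eq0; apply/eqP.
have : pi ^+ n *: (x - y) = 0 by rewrite scalerBr E subrr.
elim: n {E} => [|n IH]; first by rewrite expr0 scale1r.
by rewrite exprS -scalerA => /tX.
Qed.

Section FlatLift.
Context (Q : lmodType V) (piQ : forall q : Q, pi *: q = 0).

(** For this bornology the bornological completion is the [pi]-adic one. *)
Definition indiscrete (M : lmodType V) : bornMod V :=
  BornMod (@Bornology V M (fun _ => True) (fun _ _ => I) (fun _ _ _ _ => I)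
    (fun _ _ _ _ => I) (fun _ _ => I)).

(** A maximal pure submodule [G] of the free module on [Q], with respect to the kernel of the map
    to [Q], satisfies [G / pi G = Q]; [P] is its completion. *)
Lemma flat_lift : exists (P : lmodType V) (sigma : P -> Q),
  [/\ linear sigma, forall q, exists p, sigma p = q,
      forall p, sigma p = 0 -> exists p', p = pi *: p',
      forall p : P, pi *: p = 0 -> p = 0 & adically_complete pi [set: P]].
Proof.
pose X := {malg V[Q]}; pose s0 : X -> Q := flift id.
have ls0 : linear s0 by exact: flift_linear.
have tX (x : X) : pi *: x = 0 -> x = 0.
  move=> E; apply/malgP => q; have := congr1 (mcoeff q) E.
  rewrite mcoeffZ !mcoeff0 => /eqP; rewrite mulf_eq0 (negbTE (unif_neq0 V)).
  by move=> /eqP.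
have mK : is_submod [set x | s0 x = 0].
  by split=> [|a x y hx hy] /=; [exact: lin0|rewrite ls0 hx hy scaler0 addr0].
have [|G [mG _ pG sG]] := pure_submod_ex (submodT X) mK.
  by move=> x /=; rewrite (linZ ls0) piQ.
pose GM := indiscrete (subm (Submodule mG)).
have tG : torsionfree GM.
  split=> // x E; apply: val_inj; apply: tX.
  exact: (congr1 (fun z : subm (Submodule mG) => val z) E).
pose sigma (u : compl GM) : Q := s0 (val (terms (repr u : bdseq GM) 0)).
have sE (s : bdseq GM) : sigma (cl s) = s0 (val (terms s 0)).
  have /null_term0[y E] := @qrepr_pi _ _ (null GM) s.
  rewrite /sigma; apply/eqP; rewrite -subr_eq0 -(linB ls0).
  have := congr1 val E; rewrite /= => ->.
  by rewrite (linZ ls0) piQ.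
exists (compl GM), sigma; split.
- move=> a x y; have [s ->] := cl_surj x; have [t ->] := cl_surj y.
  by rewrite -cl_linear !sE -ls0.
- move=> q; have [u Gu] := sG (fgen V q) I; rewrite /= (linB ls0).
  have -> : s0 (fgen V q) = q by exact: flift_gen.
  move=> E.
  exists (ceta GM (mksub (S := Submodule mG) Gu)); rewrite sE /=.
  by apply/eqP; rewrite eq_sym -subr_eq0 E.
- move=> u; have [s ->] := cl_surj u; rewrite sE => s0E.
  have [y Gy yE] := pG _ (submP (S := Submodule mG) (terms s 0)) s0E.
  exists (ceta GM (mksub (S := Submodule mG) Gy) + cl (tail s)).
  rewrite cl_tail scalerDr -(linZ (bh_lin (ceta GM))); congr (_ + _).
  by congr (ceta GM _); apply: val_inj.
- exact: (compl_torsionfree tG).1.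
have bT : bsub [set: compl GM].
  by split=> //; apply/compl_bddP; exists setT => // u _; have [s ->] := cl_surj u; exists s.
have [T [TT _ cT]] := compl_complete bT.
by have -> : [set: compl GM] = T by apply/seteqP; split.
Qed.

Context (P : lmodType V) (sigma : P -> Q) (ls : linear sigma)
  (sigma_surj : forall q, exists p, sigma p = q)
  (cP : adically_complete pi [set: P]).

(** Take a maximal submodule [G] of [X x P] among those which lie over the graph of [f] and in which
    first components divisible by [pi] only come from [pi G]. It is the graph of a lifting on a
    subspace that is dense for the [pi]-adic topology, and [g] is the extension by continuity. *)
Lemma lift_flat (X : lmodType V) (tX : forall x : X, pi *: x = 0 -> x = 0)
  (f : X -> Q) (lf : linear f) :
  exists2 g : X -> P, linear g & forall x, sigma (g x) = f x.
Proof.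
have [sepP cP'] := (series_completeP (submodT P)).1 cP.
pose H := [set w : X * P | sigma w.2 = f w.1].
pose C := [set w : X * P | exists x, w.1 = pi *: x].
have [||[x p]|G [mG GH pG sG]] := @pure_submod_ex (X * P)%type H C.
- split=> [|a [x p] [y q]] /=; first by rewrite /H /= (lin0 ls) (lin0 lf).
  by rewrite /H /= ls lf => -> ->.
- split=> [|a [x p] [y q]]; first by exists 0; rewrite scaler0.
  move=> /= [x' /= ->] [y' /= ->].
  by exists (a *: x' + y'); rewrite /= scalerDr !scalerA mulrC.
- by exists x.
have step x : exists w : (X * P) * X, G w.1 /\ x = w.1.1 + pi *: w.2.
  have [p pE] := sigma_surj (f x).
  have [[u v] Guv [x' /= E]] := sG (x, p) pE.
  by exists ((u, v), x'); rewrite /= -E addrC subrK.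
have [h hP] := choice step.
pose xs x n := iter n (fun x => (h x).2) x.
pose R x p := forall n, exists w, [/\ G w, exists x', x - w.1 = pi ^+ n *: x' &
  exists p', p - w.2 = pi ^+ n *: p'].
(* Write [x = u_0 + pi x_1], [x_1 = u_1 + pi x_2] and so on, with [(u_n, v_n)] in [G]; then
   [sum_n pi^n v_n] is related to [x]. *)
have exR x : exists p, R x p.
  have [|y _ yE] := cP' (fun n => (h (xs x n)).1.2) => //.
  exists (y 0%N) => n.
  suff [w [Gw xE pE]] : exists w, [/\ G w, x - w.1 = pi ^+ n *: xs x n &
      y 0%N - w.2 = pi ^+ n *: y n].
    by exists w; split=> //; [exists (xs x n)|exists (y n)].
  elim: n => [|n [w [Gw xE pE]]].
    by exists 0; split; [exact: mG.1|rewrite subr0 expr0 scale1r..].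
  have [Gh hE] := hP (xs x n).
  have xsE : pi ^+ n *: xs x n = pi ^+ n *: (h (xs x n)).1.1 + pi ^+ n.+1 *: xs x n.+1.
    by rewrite {1}hE scalerDr scalerA -exprSr.
  have ysE : pi ^+ n *: y n = pi ^+ n *: (h (xs x n)).1.2 + pi ^+ n.+1 *: y n.+1.
    by rewrite {1}yE scalerDr scalerA -exprSr.
  exists (pi ^+ n *: (h (xs x n)).1 + w); split; first exact: mG.2.
    by rewrite /= opprD addrCA xE xsE addKr.
  by rewrite /= opprD addrCA pE ysE addKr.
have pureG n w x : G w -> w.1 = pi ^+ n *: x -> exists2 w', G w' & w = pi ^+ n *: w'.
  elim: n w x => [|n IH] w x Gw E; first by exists w; rewrite // expr0 scale1r.
  have [|w1 Gw1 wE] := pG w Gw; first by exists (pi ^+ n *: x); rewrite scalerA -exprS.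
  have [|w2 Gw2 w1E] := IH w1 x Gw1; last by exists w2; rewrite // wE w1E scalerA -exprS.
  apply: (pi_pow_torsionfree tX (n := 1)).
  by rewrite expr1 scalerA -exprS -E wE.
have linR a x p y q : R x p -> R y q -> R (a *: x + y) (a *: p + q).
  move=> hx hy n; have [w [Gw [x' xE] [p' pE]]] := hx n.
  have [v [Gv [y' yE] [q' qE]]] := hy n.
  exists (a *: w + v); split; first exact: mG.2.
    exists (a *: x' + y'); rewrite /= opprD addrACA -scalerBr xE yE.
    by rewrite scalerDr !scalerA mulrC.
  exists (a *: p' + q'); rewrite /= opprD addrACA -scalerBr pE qE.
  by rewrite scalerDr !scalerA mulrC.
have R0 p : R 0 p -> p = 0.
  move=> hp; apply: sepP => // n; have [w [Gw [x' xE] [p' pE]]] := hp n.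
  have [|w' _ wE] := pureG n w (- x') Gw; first by rewrite scalerN -xE sub0r opprK.
  by exists (p' + w'.2) => //; rewrite scalerDr -pE wE subrK.
have uniqR x p q : R x p -> R x q -> p = q.
  move=> hp hq; apply/eqP; rewrite eq_sym -subr_eq0; apply/eqP/R0.
  by have := linR (-1) _ _ _ _ hp hq; rewrite !scaleN1r addNr addrC.
have [g gP] := choice exR; exists g => [a x y|x].
  exact: uniqR (gP _) (linR _ _ _ _ _ (gP x) (gP y)).
(* Modulo [pi] the first approximation decides. *)
have [w [/GH wH [x' xE] [p' pE]]] := gP x 1%N.
rewrite expr1 in xE pE.
rewrite -[g x](subrK w.2) pE (linD ls) (linZ ls) piQ add0r wH.
by rewrite -[in RHS](subrK w.1 x) xE (linD lf) (linZ lf) piQ add0r.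
Qed.

End FlatLift.
End PureSubmodules.

Section HomModule.
Context (V : completeDVR) (P N : lmodType V).
Local Notation pi := (unif V).

Fact linear_submod : is_submod [set f : P -> N | linear f].
Proof.
split=> [a x y|c f g lf lg a x y]; first by rewrite [RHS]addr0 [RHS]scaler0.
rewrite -[LHS]/(c *: f _ + g _) -[RHS]/(a *: (c *: f x + g x) + (c *: f y + g y)).
by rewrite lf lg !scalerDr !scalerA [c * a]mulrC addrACA.
Qed.
Definition hom : lmodType V := subm (Submodule linear_submod).
Definition happ (f : hom) : P -> N := val f.
Definition mkhom (f : P -> N) (lf : linear f) : hom :=
  mksub (S := Submodule linear_submod) lf.

Lemma happ_lin f : linear (happ f). Proof. exact: (submP f). Qed.
Lemma hom_ext (f g : hom) : happ f =1 happ g -> f = g.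
Proof. by move=> h; apply: val_inj; apply: funext. Qed.
Lemma happD f g x : happ (f + g) x = happ f x + happ g x. Proof. by []. Qed.
Lemma happZ a f x : happ (a *: f) x = a *: happ f x. Proof. by []. Qed.
Lemma mkhomE f lf x : happ (@mkhom f lf) x = f x. Proof. by []. Qed.

(** Tails are formed pointwise; they are linear in the point because families of tails are
    unique. *)
Lemma hom_complete : adically_complete pi [set: N] -> adically_complete pi [set: hom].
Proof.
move=> /(series_completeP (submodT _))[sepN cN].
apply/(series_completeP (submodT _)); split=> [f _ h|f _].
  apply: hom_ext => x; apply: sepN => // n; have [g _ E] := h n.
  by exists (happ g x) => //; rewrite E happZ.
have /choice[y yE] x : exists y, forall n, y n = happ (f n) x + pi *: y n.+1.
  by have [|y _ yE] := cN (fun n => happ (f n) x) => //; exists y.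
have uniq0 (z : nat -> N) : (forall n, z n = pi *: z n.+1) -> forall n, z n = 0.
  move=> zE n; apply: sepN => // m; exists (z (n + m)%N) => //.
  by elim: m => [|m ->]; rewrite ?addn0 ?expr0 ?scale1r // addnS {1}zE scalerA -exprSr.
have ly n : linear (y^~ n).
  move=> a x x'; apply/eqP; rewrite -subr_eq0; apply/eqP.
  apply: (uniq0 (fun n => y (a *: x + x') n - (a *: y x n + y x' n))) => {}n.
  rewrite {1}(yE (a *: x + x') n) {1}(yE x n) {1}(yE x' n) (happ_lin (f n)).
  rewrite [a *: (_ + _)]scalerDr [X in _ - X]addrACA.
  rewrite opprD addrACA subrr add0r scalerBr scalerDr !scalerA.
  by rewrite [a * pi]mulrC.
exists (fun n => mkhom (ly n)) => // n; apply: hom_ext => x.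
by rewrite happD happZ !mkhomE yE.
Qed.

End HomModule.

Section EndAlgebra.
Context (V : completeDVR) (P : lmodType V).

Definition hcomp (f g : hom P P) : hom P P :=
  mkhom (comp_linear (happ_lin f) (happ_lin g)).
Fact hcomp_bilin : bilin hcomp.
Proof.
split=> [f|g] a x y; apply: hom_ext => p; rewrite !(happD, happZ, mkhomE).
  exact: happ_lin.
by [].
Qed.
Fact hcompA : associative hcomp. Proof. by move=> f g h; exact: hom_ext. Qed.
Definition end_alg : nualg V := NuAlg hcomp_bilin hcompA.
End EndAlgebra.

Section Detection.
Context (V : completeDVR) (k : fieldType) (res : {rmorphism V -> k}).
Context (res_pi : res (unif V) = 0) (A : nualg k).
Local Notation pi := (unif V).
Local Notation RA := (restr_alg res A).

(** The unit makes the action of [A] faithful, whatever the product of [A] is. *)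
Definition unitalization : lmodType V := (restr res k^o * restr res A)%type.
Definition uact (a : RA) (q : unitalization) : unitalization :=
  (0, ((q.1 : k) *: (a : A) : A) + ((a : A) ** (q.2 : A))).

Lemma uact_lin1 q : linear (uact^~ q).
Proof.
have E (c x : k) (y a b : A) : x *: (c *: a + b) + (c *: a + b) ** y =
    c *: (x *: a + a ** y) + (x *: b + b ** y).
  by rewrite !scalerDr (na_lin2 y) !scalerA mulrC addrACA.
by move=> c a b; congr (_, _); [rewrite /= scaler0 addr0|exact: E].
Qed.

Lemma uact_lin2 a : linear (uact a).
Proof.
have E (c x x' : k) (y y' : A) : (c * x + x') *: (a : A) + (a : A) ** (c *: y + y') =
    c *: (x *: (a : A) + (a : A) ** y) + (x' *: (a : A) + (a : A) ** y').
  by rewrite scalerDl (na_lin1 (a : A)) !scalerDr scalerA addrACA.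
by move=> c q q'; congr (_, _); [rewrite /= scaler0 addr0|exact: E].
Qed.

Lemma uactM (a b : RA) q : uact (a ** b) q = uact a (uact b q).
Proof.
congr (_, _); rewrite /= scale0r add0r (linD (na_lin1 (a : A))).
by rewrite (linZ (na_lin1 (a : A))) na_mulA.
Qed.

Lemma unitalization_pi (q : unitalization) : pi *: q = 0.
Proof. by congr (_, _); rewrite /= restrE res_pi scale0r. Qed.

Context (W : lmodType V) (tW : forall w : W, pi *: w = 0 -> w = 0).
Context (rho : W -> RA) (lrho : linear rho).

(** By construction [phi x] reduces modulo [pi] to the action of [thom rho x] on the
    unitalization, which is faithful. *)
Lemma detection : exists (D : nualg V) (phi : W -> D),
  [/\ linear phi, forall d : D, pi *: d = 0 -> d = 0 &
    forall x, thom rho x = 0 <-> exists d, thom phi x = pi *: d].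
Proof.
have [P [sigma [ls sP kP tP cP]]] := flat_lift unitalization_pi.
pose Q := unitalization.
pose s' (f : hom P P) : hom P Q := mkhom (comp_linear ls (happ_lin f)).
have ls' : linear s' by move=> a f g; apply: hom_ext => p; rewrite !mkhomE ls.
have s'P (f : hom P Q) : exists g, s' g = f.
  have [g lg gE] := lift_flat unitalization_pi ls sP cP tP (happ_lin f).
  by exists (mkhom lg); apply: hom_ext => p; rewrite mkhomE /= gE.
have piH (f : hom P Q) : pi *: f = 0.
  by apply: hom_ext => p; rewrite happZ unitalization_pi.
pose F w : hom P Q := mkhom (comp_linear (uact_lin2 (rho w)) ls).
have lF : linear F.
  move=> a x y; apply: hom_ext => p.
  by rewrite happD happZ !mkhomE lrho (uact_lin1 (sigma p)).
have [phi lphi phiE] := lift_flat piH ls' s'P (hom_complete P cP) tW lF.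
exists (end_alg P), phi; split=> //.
  by move=> d E; apply: hom_ext => p; apply: tP; rewrite -happZ E.
have key x p : sigma (happ (thom (B := end_alg P) phi x : hom P P) p) =
    uact (thom rho x) (sigma p).
  have lt := thom_linear (B := end_alg P) lphi; have lt' := thom_linear lrho.
  move: x; apply: pmod_ext.
  - by move=> a x y; rewrite (lt a x y) happD happZ ls.
  - by move=> a x y; rewrite (lt' a x y) (uact_lin1 (sigma p)).
  move=> [w s]; rewrite -!/(tword _) !thom_word // /wprod /=.
  elim/last_ind: s p => [|s y IH] p /=.
    by have := congr1 (fun f => happ f p) (phiE w); rewrite !mkhomE.
  rewrite !map_rcons /aprod -!cats1 !foldl_cat /= uactM.
  have := congr1 (fun f => happ f p) (phiE y); rewrite !mkhomE => <-.
  exact: IH.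
move=> x; split=> [x0|[d dE]].
  have /choice[d dE] p : exists p', happ (thom (B := end_alg P) phi x : hom P P) p = pi *: p'.
    by apply: kP; rewrite key x0 (lin0 (uact_lin1 _)).
  have ld : linear d.
    move=> a p q; apply: (pi_pow_torsionfree tP (n := 1)).
    by rewrite expr1 -dE happ_lin !dE scalerDr !scalerA mulrC.
  by exists (mkhom ld); apply: hom_ext => p; rewrite dE.
have [p pE] := sP (1, 0); have := key x p.
rewrite dE happZ (linZ ls) unitalization_pi pE => /esym/(congr1 snd) /=.
by rewrite scale1r (lin0 (na_lin1 _)) addr0.
Qed.

End Detection.

(** * The module R (x) F *)

Section Localisation.
Context (V : completeDVR) (R : lmodType V).
Local Notation pi := (unif V).
Local Notation F := (frac_mod V).
Local Notation fpi := (frac_pi V).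
Implicit Types r s : R.

Let tens1 (f : F) : linear (fun r : R => tens r f) := (tens_bilin R F).2 f.
Let tens2 (r : R) : linear (fun f : F => tens r f) := (tens_bilin R F).1 r.

Lemma frac_pi_inj n (v w : V) : v *: fpi n = w *: fpi n -> v = w.
Proof.
move=> E; apply/eqP; rewrite -tofrac_eq; apply/eqP.
have u : (FracField.tofrac pi ^+ n)^-1 != 0.
  by rewrite invr_eq0 expf_neq0 // tofrac_eq0 unif_neq0.
exact: (mulIf u E).
Qed.

Lemma tens_shift r n m :
  tens (r : R) (fpi n) = tens (pi ^+ m *: r) (fpi (n + m)).
Proof. by rewrite (frac_piS V n m) (linZ (tens1 _)) (linZ (tens2 _)). Qed.

Lemma tens_pi r n : pi *: tens (r : R) (fpi n.+1) = tens (r : R) (fpi n).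
Proof. by rewrite (tens_shift r n 1) addn1 expr1 (linZ (tens1 _)). Qed.

Lemma ten_frac_ex (z : ten R F) : exists r n, z = tens (r : R) (fpi n).
Proof.
move: z (tens_span z); apply: span_min => [|_ [r [f ->]]].
  split=> [|a _ _ [r [n ->]] [s [m ->]]].
    by exists 0, 0%N; rewrite (lin0 (tens1 _)).
  exists (a *: (pi ^+ m *: r) + pi ^+ n *: s), (n + m)%N.
  by rewrite (tens1 _) (tens_shift r n m) (tens_shift s m n) addnC.
have [n [v ->]] := frac_piE f; exists (v *: r), n.
by rewrite (linZ (tens1 _)) (linZ (tens2 _)).
Qed.

Fact ev0_submod : is_submod [set x : nat -> R | exists n, forall m, (n <= m)%N -> x m = 0].
Proof.
split=> [|a x y [n hx] [m hy]]; first by exists 0%N.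
exists (maxn n m) => i; rewrite geq_max => /andP[ni mi].
by rewrite -[LHS]/(a *: x i + y i) hx // hy // scaler0 addr0.
Qed.
Let E := Submodule ev0_submod.

Let num_ex n (f : F) : {v : V | (exists w : V, f = w *: fpi n) -> f = v *: fpi n}.
Proof.
apply: cid; have [[w ->]|none] := pselect (exists w : V, f = w *: fpi n).
  by exists w.
by exists 0.
Qed.
(** The element [pi^n f] of [V] if there is one; an arbitrary value otherwise. *)
Definition numerator n f : V := sval (num_ex n f).

Lemma numeratorE n v : numerator n (v *: fpi n) = v.
Proof.
apply: (@frac_pi_inj n); apply/esym.
by have := svalP (num_ex n (v *: fpi n)); apply; exists v.
Qed.

Lemma frac_eventually (f : F) : exists n (v : V), forall m, f = (pi ^+ m * v) *: fpi (n + m).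
Proof.
have [n [v ->]] := frac_piE f; exists n, v => m.
by rewrite (frac_piS V n m) scalerA mulrC.
Qed.

(** The localisation of [R] at [pi] as a space of germs at infinity of sequences: [r (x) f] becomes
    [n |-> (pi^n f) r], where only large [n] matter. *)
Definition to_loc (r : R) (f : F) : quotm E := qpi E (fun n => numerator n f *: r).

Lemma to_loc_bilin : bilin to_loc.
Proof.
split=> [r a f g|f a r s]; rewrite /to_loc -qpi_linear.
  have [n [v vE]] := frac_eventually f; have [m [w wE]] := frac_eventually g.
  apply/qpiP; exists (n + m)%N => i /subnKC <-.
  rewrite -[LHS]/(_ - (a *: _ + _)) {1}(vE (m + (i - (n + m)))%N).
  rewrite {1}(wE (n + (i - (n + m)))%N) (vE (m + (i - (n + m)))%N) (wE (n + (i - (n + m)))%N).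
  rewrite !addnA [(m + n)%N]addnC scalerA -scalerDl !numeratorE.
  by rewrite scalerDl scalerA subrr.
by congr (qpi E _); apply: funext => n; rewrite -[RHS]/(a *: _ + _) scalerDr !scalerA mulrC.
Qed.

Lemma tens_eq0 r n : tens (r : R) (fpi n) = 0 -> exists k, pi ^+ k *: r = 0.
Proof.
move=> /(congr1 (tlift to_loc)); rewrite (tlift_tens to_loc_bilin).
rewrite (lin0 (tlift_linear to_loc_bilin)) => /qpi_eq0[m /(_ (n + m)%N)].
by rewrite leq_addl (frac_piS V n m) numeratorE => /(_ isT); exists m.
Qed.

Lemma ten_pi_inj (z : ten R F) : pi *: z = 0 -> z = 0.
Proof.
have [r [n ->]] := ten_frac_ex z.
rewrite -(linZ (tens1 _)) => /tens_eq0[k kr].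
by rewrite (tens_shift r n k.+1) exprSr -scalerA kr (lin0 (tens1 _)).
Qed.

End Localisation.

Section TensorBounded.
Context (V : completeDVR) (R : bornAlg V).
Local Notation pi := (unif V).
Local Notation fpi := (frac_pi V).
Local Notation RF := (ten_alg R (frac_alg V)).

Lemma ten_frac_bddP (X : set RF) : bdd (M := ba_mod RF) X <->
  exists N (S : set R), bsub (M := ba_mod R) S /\
    forall z, X z -> exists2 b, S b & z = tens b (fpi N).
Proof.
have t1 f : linear (fun r : R => tens r (f : frac_mod V)) := (tens_bilin _ _).2 f.
have t2 r : linear (fun f : frac_mod V => tens (r : R) f) := (tens_bilin _ _).1 r.
split=> [[S [T [bS [mT [N TN]] XST]]]|[N [S [bS XS]]]].
  exists N, S; split=> // z /XST.
  have /[apply] : tens_img (M := ba_mod R) S T `<=` (fun r => tens r (fpi N)) @` S.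
    apply: span_min => [|_ [x [f [Sx /TN[v ->] ->]]]].
      exact: image_submod (t1 (fpi N)) bS.1.
    exists (v *: x); first exact: (submodZ bS.1).
    by rewrite (linZ (t1 _)) (linZ (t2 _)).
  by case=> b Sb <-; exists b.
exists S, (span [set fpi N]); split=> //.
  by apply: (bsub_span (M := ba_mod (frac_alg V))); exact: bounded_finite.
move=> z /XS[b Sb ->]; apply: sub_span; exists b, (fpi N); split=> //.
exact: sub_span.
Qed.
End TensorBounded.

(** * Tube algebras *)

Section TubeBornology.
Context (V : completeDVR) (R : bornAlg V) (I : ideal R).
Local Notation pi := (unif V).
Local Notation fpi := (frac_pi V).
Local Notation RF := (ten_alg R (frac_alg V)).

Let tens1 (f : frac_mod V) : linear (fun r : R => tens r f) := (tens_bilin _ _).2 f.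

Lemma tube_bddP l (X : set (tube_alg I l)) :
  bdd (M := ba_mod (tube_alg I l)) X <->
  exists N (S : set R), bsub (M := ba_mod R) S /\
    forall u, X u -> exists2 b, S b & val u = tens b (fpi N).
Proof.
have E := ten_frac_bddP (R := R) (val @` X); split=> [/E|] [N [S [bS h]]].
  by exists N, S; split=> // u Xu; apply: h; exists u.
by apply/E; exists N, S; split=> // _ [u Xu <-]; exact: h.
Qed.

Lemma tube_torsionfree l : torsionfree (ba_mod (tube_alg I l)).
Proof.
split=> [u /(congr1 val) E|S /tube_bddP[N [T [bT ST]]]].
  by apply: val_inj; exact: ten_pi_inj E.
apply/tube_bddP; exists N.+1, T; split=> // u Su.
have [|b Tb bE] := ST (pi *: u); first by exists u.
exists b; first exact: Tb.
apply/eqP; rewrite -subr_eq0; apply/eqP; apply: ten_pi_inj.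
by rewrite scalerBr -[pi *: val u]/(val (pi *: u)) bE (tens_pi b N) subrr.
Qed.

Lemma tube_gen l j r : apow I (l * j) r -> tube_set I l (tens r (fpi j)).
Proof. by move=> Ir; apply: sub_span; exists j, r. Qed.

End TubeBornology.

Section TubeEmbedding.
Context (V : completeDVR) (R : bornAlg V) (I : ideal R).
Local Notation pi := (unif V).
Local Notation fpi := (frac_pi V).
Context (piI : forall r : R, sm_set I (pi *: r)).
Local Notation S := (ideal_alg I).
Local Notation J := (full_ideal (ideal_alg I)).
Local Notation F := (frac_mod V).

Definition ival (x : S) : R := val x.

Lemma ival_inj : injective ival. Proof. exact: val_inj. Qed.
Lemma ival_lin : linear ival. Proof. by []. Qed.

Let ival_bilin : bilin (fun (x : S) (f : F) => tens (ival x) f).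
Proof.
have [t1 t2] := tens_bilin R F; split=> [x|f] a u v; first exact: t1.
by rewrite ival_lin t2.
Qed.

Definition tens_ival : ten S F -> ten R F := tlift (fun x f => tens (ival x) f).

Lemma tens_ival_lin : linear tens_ival. Proof. exact: tlift_linear. Qed.
Lemma tens_ivalE x f : tens_ival (tens x f) = tens (ival x) f.
Proof. exact: tlift_tens. Qed.

Lemma tens_ival_mul (x y : ten_alg S (frac_alg V)) :
  tens_ival (x ** y) = (tens_ival x : ten_alg R (frac_alg V)) ** tens_ival y.
Proof.
have [r [n ->]] := ten_frac_ex (x : ten S F).
have [s [m ->]] := ten_frac_ex (y : ten S F).
have -> : (tens r (fpi n) : ten_alg S (frac_alg V)) ** tens s (fpi m) =
    tens (r ** s) ((fpi n : frac_alg V) ** fpi m) by exact: ten_mulE.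
apply: (etrans (tens_ivalE _ _)).
apply: (etrans (esym (@ten_mulE V R (frac_alg V) (ival r) (fpi n) (ival s) (fpi m)))).
by congr ten_mul; exact: (esym (tens_ivalE _ _)).
Qed.

Lemma tens_ival_inj : injective tens_ival.
Proof.
move=> x y E; apply/eqP; rewrite -subr_eq0; apply/eqP; move/eqP: E.
rewrite -subr_eq0 -(linB tens_ival_lin) => /eqP.
have [r [n ->]] := ten_frac_ex (x - y); rewrite tens_ivalE => /tens_eq0[k].
rewrite -(linZ ival_lin) => kr.
rewrite (tens_shift r n k); have -> : pi ^+ k *: r = 0 by exact: ival_inj.
exact: (lin0 ((tens_bilin _ _).2 _)).
Qed.

(** Only positive powers agree: the zeroth powers are [I] and [R]. *)
Lemma apow_ival k : apow J k.+1 = [set x | apow I k.+1 (ival x)].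
Proof.
apply/seteqP; split=> x /=.
  apply: image_span; first exact: ival_lin.
  move=> _ [x0 [s [szs _ _ ->]]]; apply: sub_span.
  exists (ival x0), (map ival s); split.
  - by rewrite size_map.
  - exact: submP.
  - by move=> _ /mapP[y _ ->]; exact: submP.
  rewrite /aprod; elim/last_ind: s {szs} => // s y IH.
  by rewrite map_rcons -!cats1 !foldl_cat /= -IH.
move=> Ix; suff [x' Jx' /ival_inj<-] : (ival @` apow J k.+1) (ival x) by [].
apply: span_min Ix => [|_ [r0 [s [szs Ir0 Is ->]]]].
  exact: image_submod ival_lin (apow_submod _ _).
have [s' sE] : exists s' : seq S, map ival s' = s.
  elim: s Is {szs} => [|y s IH] Is; first by exists [::].
  have [|s' <-] := IH; first by move=> z zs; apply: Is; rewrite inE zs orbT.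
  by exists (mksub (Is y (mem_head _ _)) :: s').
exists (aprod (mksub Ir0 : S) s').
  by apply: sub_span; exists (mksub Ir0), s'; split=> //; rewrite -szs -sE size_map.
rewrite -sE /aprod; elim/last_ind: s' {sE} => // s' y IH.
by rewrite map_rcons -!cats1 !foldl_cat /= -IH.
Qed.

Lemma tens_ival_tube l z : tube_set J l z -> tube_set I l (tens_ival z).
Proof.
apply: (image_span tens_ival_lin) => _ [j [r [Jr ->]]]; rewrite tens_ivalE; apply: tube_gen.
by case: (l * j)%N Jr => // k; rewrite apow_ival.
Qed.

(** A term with a denominator involves a positive power of [I], so it comes from [U(I, I^l)]. *)
Lemma tube_high_image l j r : apow I (l.+1 * j.+1) r ->
  (tens_ival @` tube_set J l.+1) (tens r (fpi j.+1)).
Proof.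
move=> Ir; have Ir1 : sm_set I r.
  have : apow I 1 r by apply: apow_decr Ir; rewrite muln_gt0.
  by apply: span_min (sm_closed I) _ _ => _ [x [s [/size0nil-> Ix _ ->]]].
exists (tens (mksub (S := I) Ir1 : S) (fpi j.+1)); last exact: tens_ivalE.
by apply: tube_gen; rewrite mulSn addSn apow_ival.
Qed.

(** Multiplication by [pi] moves the part in [R] into [I]; the rest is in [U(I, I^l)] already. *)
Lemma tube_pi l z : tube_set I l.+1 z -> exists2 u, tube_set J l.+1 u & pi *: z = tens_ival u.
Proof.
move: z; apply: span_min => [|_ [j [r [Ir ->]]]].
  have mJ : is_submod (tube_set J l.+1) by exact: span_submod.
  split=> [|a x y [u Ju xu] [v Jv yv]].
    by exists 0; [exact: mJ.1|rewrite (lin0 tens_ival_lin) scaler0].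
  by exists (a *: u + v); [exact: mJ.2|rewrite tens_ival_lin -xu -yv scalerDr !scalerA mulrC].
case: j Ir => [|j] Ir.
  exists (tens (mksub (S := I) (piI r) : S) (fpi 0)); first by apply: tube_gen; rewrite muln0.
  apply: etrans (esym (tens_ivalE _ _)).
  exact: (esym (linZ ((tens_bilin R F).2 (fpi 0)) pi r)).
have [w Jw <-] := tube_high_image Ir.
by exists (pi *: w); [exact: (submodZ (span_submod _))|rewrite (linZ tens_ival_lin)].
Qed.

Section Level.
Context (l : nat).

Definition tube_val (u : tube_alg J l.+1) : tube_alg I l.+1 :=
  mksub (S := tube_sub I l.+1) (tens_ival_tube (submP u)).
Fact tube_val_lin : linear tube_val.
Proof. by move=> a u v; apply: val_inj; exact: tens_ival_lin. Qed.
Fact tube_val_bdd (X : set (ba_mod (tube_alg J l.+1))) :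
  bdd X -> bdd (M := ba_mod (tube_alg I l.+1)) (tube_val @` X).
Proof.
move=> /tube_bddP[N [T [bT XT]]]; apply/tube_bddP.
exists N, (ival @` T); split; first by split; [exact: image_submod ival_lin bT.1|exact: bT.2].
move=> _ [u Xu <-]; have [b Tb bE] := XT u Xu; exists (ival b); first by exists b.
exact: (etrans (congr1 tens_ival bE) (tens_ivalE _ _)).
Qed.
Fact tube_val_mul (u v : tube_alg J l.+1) : tube_val (u ** v) = tube_val u ** tube_val v.
Proof. by apply: val_inj; exact: tens_ival_mul. Qed.
Definition tube_val_ahom : ahom (tube_alg J l.+1) (tube_alg I l.+1) :=
  @AHom V (tube_alg J l.+1) (tube_alg I l.+1)
    (@BHom V (ba_mod (tube_alg J l.+1)) (ba_mod (tube_alg I l.+1))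
      tube_val tube_val_lin tube_val_bdd) tube_val_mul.

Lemma tube_val_embedding : pi_embedding tube_val_ahom.
Proof.
have vinj : injective tube_val_ahom.
  by move=> u v /(congr1 val)/tens_ival_inj/val_inj.
split=> // [X /tube_bddP[N [T [bT XT]]]|y].
  apply/tube_bddP; exists N.+1, [set x | T (ival x)]; split.
    split; first exact: preimage_submod ival_lin bT.1.
    by apply: bounded_sub bT.2 => _ [x Tx <-].
  move=> u Xu; have [|b Tb bE] := XT (tube_val u); first by exists u.
  (* [b] need not be in [I], but [pi b] is, and [b (x) pi^-N = pi b (x) pi^-(N+1)]. *)
  exists (mksub (S := I) (piI b) : S); first exact: (submodZ bT.1).
  apply: tens_ival_inj; apply: (etrans bE); apply/esym/(etrans (tens_ivalE _ _)).
  by have /esym := tens_shift b N 1; rewrite addn1 expr1.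
by have [u Ju uE] := tube_pi (submP y); exists (mksub (S := tube_sub J l.+1) Ju); apply: val_inj.
Qed.

End Level.
End TubeEmbedding.

Section Nilpotency.
Context (V : completeDVR) (R : bornAlg V).
Local Notation pi := (unif V).
Local Notation fpi := (frac_pi V).
Local Notation J := (full_ideal R).
Local Notation RF := (ten_alg R (frac_alg V)).

Lemma full_apow1 (r : R) : apow J 1 r.
Proof. exact: sub_apow1. Qed.

(** The product of generators [r_i (x) pi^-(j_i)] is [r (x) pi^-j] with [j] the sum of the [j_i]. If
    [j = 0], then [r] is in [R^(l+1)] and may be divided by [pi]. Otherwise it is in
    [R^(2 (l+1) j)], and [2 j >= j + 1] allows one more division. *)
Lemma tube_full_nilpotent l (x : RF) : apow (tube_set J (2 * l.+1)) l.+1 x ->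
  exists2 y, tube_set J l.+1 y & x = pi *: y.
Proof.
pose P i := span [set z : RF | exists j r, [/\ z = tens r (fpi j),
   j = 0%N -> apow J i.+1 r & apow J (2 * l.+1 * j) r]].
have /[apply] : apow (tube_set J (2 * l.+1)) l.+1 `<=` P l.
  apply: (apow_ind (P := P)) => [i|z|i].
  - exact: span_submod.
  - apply: span_mono => _ [j [r [Jr ->]]]; exists j, r; split=> //.
    by move=> _; exact: full_apow1.
  apply: span_mulset => [|_ _ [j [r [-> r0 Jr]]] [j' [r' [Jr' ->]]]].
    exact: span_submod.
  apply: sub_span; exists (j + j')%N, (r ** r'); split.
  - rewrite -[LHS]/(ten_mul _ _) ten_mulE; congr tens.
    by rewrite -[LHS]/(_ * _) /frac_pi exprD invfM.
  - move=> /eqP; rewrite addn_eq0 => /andP[/eqP/r0 Jr1 _].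
    by rewrite -addn1; apply: apow_idealM => //; exact: full_apow1.
  by rewrite mulnDr; exact: apow_idealM.
move: x; apply: span_min => [|_ [j [r [-> r0 Jr]]]].
  have mU : is_submod (tube_set J l.+1) by exact: span_submod.
  split=> [|a x y [u Uu ->] [v Uv ->]].
    by exists 0; [exact: mU.1|rewrite scaler0].
  by exists (a *: u + v); [exact: mU.2|rewrite scalerDr !scalerA mulrC].
exists (tens r (fpi j.+1)); last by rewrite tens_pi.
apply: tube_gen; case: j r0 Jr => [/(_ erefl)|j _]; first by rewrite muln1.
apply: apow_decr; rewrite (mulnC 2) -mulnA leq_mul2l /=.
by rewrite mul2n -addnn addSn ltnS leq_addl.
Qed.

End Nilpotency.

Section Noetherian.
Context (V : completeDVR).
Local Notation pi := (unif V).

Lemma span_cons (M : lmodType V) (x : M) (s : seq M) y :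
  span [set` x :: s] y -> exists c, span [set` s] (y - c *: x).
Proof.
move: y; apply: span_min => [|y /=].
  split=> [|a u v [c hc] [d hd]].
    by exists 0; rewrite scale0r subrr; exact: (span_submod _).1.
  exists (a * c + d); rewrite scalerDl opprD addrACA -scalerA -scalerBr.
  exact: (span_submod _).2.
rewrite inE => /orP[/eqP->|ys].
  by exists 1; rewrite scale1r subrr; exact: (span_submod _).1.
by exists 0; rewrite scale0r subr0; exact: sub_span.
Qed.

(** Induction on the number of generators: adjoin to generators of [N /\ span s] an element whose
    coefficient at [x] has the least valuation. *)
Lemma noetherian (M : lmodType V) (s : seq M) (N : set M) : is_submod N ->
  N `<=` span [set` s] -> exists t : seq M, (forall y, y \in t -> N y) /\ N `<=` span [set` t].
Proof.
elim: s N => [|x s IH] N mN NS; first by exists [::].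
have mN' : is_submod (N `&` span [set` s]).
  split; first by split; [exact: mN.1|exact: (span_submod _).1].
  by move=> a u v [Nu su] [Nv sv]; split; [exact: mN.2|exact: (span_submod _).2].
have [t [Nt tN]] := IH _ mN' (@subIsetr _ _ _).
pose lead n := `[< exists u z, u \is a GRing.unit /\ N z /\
                  span [set` s] (z - (u * pi ^+ n) *: x) >].
have [[n0 ln0]|none] := pselect (exists n, lead n); last first.
  exists t; split; first by move=> y /Nt[].
  move=> z Nz; apply: tN; split=> //.
  have [c hc] := span_cons (NS _ Nz); have [c0|c0] := eqVneq c 0.
    by move: hc; rewrite c0 scale0r subr0.
  case: none; have [u [n [uu cE]]] := unif_factor c0.
  by exists n; apply/asboolP; exists u, z; rewrite -cE.
have [n /asboolP[u [z [uu [Nz hz]]]] nmin] := ex_minnP (ex_intro lead n0 ln0).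
exists (z :: t); split; first by move=> y; rewrite inE => /orP[/eqP->//|/Nt[]].
move=> y Ny; have [c hc] := span_cons (NS _ Ny).
have [d cE] : exists d, c = d * (u * pi ^+ n).
  have [->|c0] := eqVneq c 0; first by exists 0; rewrite mul0r.
  have [v [m [uv cE]]] := unif_factor c0.
  have /nmin nm : lead m by apply/asboolP; exists v, y; rewrite -cE.
  exists (v * pi ^+ (m - n) * u^-1); rewrite cE mulrA mulrVK // -mulrA -exprD.
  by rewrite subnK.
rewrite -[y](subrK (d *: z)); apply: (submodD (span_submod _)); last first.
  by apply: (submodZ (span_submod _)); apply: sub_span; rewrite /= mem_head.
have : span [set` t] (y - d *: z).
  apply: tN; split; first by apply: (submodB mN) => //; exact: (submodZ mN).
  have -> : y - d *: z = (y - c *: x) - d *: (z - (u * pi ^+ n) *: x).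
    by rewrite scalerBr scalerA -cE opprB addrA subrK.
  by apply: (submodB (span_submod _)) => //; exact: (submodZ (span_submod _)).
by apply: span_mono => w wt /=; rewrite inE wt orbT.
Qed.

End Noetherian.

(** * Tube algebras are fine modulo pi *)

Section FineDecomposition.
Context (V : completeDVR).
Local Notation pi := (unif V).

Definition fine_upto (M : bornMod V) (n : nat) (B : set M) : Prop :=
  exists F B', [/\ finite_set F, bdd B' &
    forall b, B b -> exists u b', [/\ span F u, B' b' & b = u + pi ^+ n *: b']].

(** The remainders [pi y] range over a bounded set, hence so do the [y] when [M] is torsionfree. *)
Lemma fine_upto1 (M : bornMod V) : torsionfree M -> fine_mod_pi M ->
  forall B : set M, bdd B -> fine_upto 1 B.
Proof.
move=> tM /fine_mod_piP fM B bB; have [F fF hF] := fM B bB.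
exists F, [set x | span (B `|` F) (pi *: x)]; split=> //.
  apply: tM.2; apply: (@bounded_sub _ _ (bm_born M) _ (span (B `|` F))).
    by move=> _ [x hx <-].
  by apply: bounded_span; apply: bounded_setU => //; exact: bounded_finite.
move=> b Bb; have [u Fu [y E]] := hF b Bb.
exists u, y; rewrite expr1; split=> //=.
have -> : pi *: y = b - u by rewrite E addrAC subrr add0r.
apply: (submodB (span_submod _)); first by apply: sub_span; left.
by apply: span_mono Fu => x; right.
Qed.

Lemma fine_upto_all (M : bornMod V) : (forall B : set M, bdd B -> fine_upto 1 B) ->
  forall n (B : set M), bdd B -> fine_upto n B.
Proof.
move=> h; elim=> [|n IH] B bB.
  exists set0, B; split=> // b Bb; exists 0, b; rewrite expr0 scale1r add0r.
  by split=> //; exact: (span_submod _).1.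
have [F [B' [fF bB' hF]]] := IH B bB; have [F' [B'' [fF' bB'' hF']]] := h B' bB'.
exists (F `|` (fun x => pi ^+ n *: x) @` F'), B''; split=> //.
  by rewrite finite_setU; split=> //; exact: finite_image.
move=> _ /hF[u [b' [Fu /hF'[u' [b'' [Fu' Bb ->]]] ->]]].
exists (u + pi ^+ n *: u'), b''; split=> //; last first.
  by rewrite scalerDr scalerA expr1 -exprSr addrA.
apply: (submodD (span_submod _)); first by apply: span_mono Fu => x; left.
have lZ : linear (fun x : M => pi ^+ n *: x).
  by move=> a x y; rewrite scalerDr !scalerA mulrC.
by apply: (image_span lZ) Fu' => x F'x; apply: sub_span; right; exists x.
Qed.

Lemma fine_upto_sub (M : bornMod V) n (B C : set M) :
  B `<=` C -> fine_upto n C -> fine_upto n B.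
Proof. by move=> BC [F [B' [fF bB h]]]; exists F, B'; split=> // b /BC/h. Qed.

Lemma fine_upto_span (M : bornMod V) n (B : set M) :
  fine_upto n B -> fine_upto n (span B).
Proof.
move=> [F [B' [fF bB h]]]; exists F, (span B'); split=> //; first exact: bounded_span.
apply: span_min => [|b /h[u [b' [Fu Bb ->]]]]; last first.
  by exists u, b'; split=> //; exact: sub_span.
split=> [|a _ _ [u [v [Fu Bv ->]]] [u' [v' [Fu' Bv' ->]]]].
  exists 0, 0; rewrite scaler0 addr0.
  by split=> //; exact: (span_submod _).1.
exists (a *: u + u'), (a *: v + v'); split; [exact: (span_submod _).2|exact: (span_submod _).2|].
by rewrite !scalerDr addrACA !scalerA mulrC.
Qed.

Lemma fine_upto_image (M N : bornMod V) (f : bhom M N) n (B : set M) :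
  fine_upto n B -> fine_upto n (f @` B).
Proof.
move=> [F [B' [fF bB h]]]; exists (f @` F), (f @` B'); split.
- exact: finite_image.
- exact: bh_bdd.
move=> _ [_ /h[u [b' [Fu Bb ->]]] <-].
exists (f u), (f b'); split; [|by exists b'|by rewrite (linD (bh_lin f)) (linZ (bh_lin f))].
by apply: (image_span (bh_lin f)) Fu => x Fx; apply: sub_span; exists x.
Qed.

Lemma fine_upto_setU (M : bornMod V) n (B C : set M) :
  fine_upto n B -> fine_upto n C -> fine_upto n (B `|` C).
Proof.
move=> [F [B' [fF bB h]]] [G [C' [fG bC g]]]; exists (F `|` G), (B' `|` C'); split.
- by rewrite finite_setU.
- exact: bounded_setU.
move=> b [/h|/g] [u [v [Fu Bv ->]]]; exists u, v; split=> //.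
- by apply: span_mono Fu => x; left.
- by left.
- by apply: span_mono Fu => x; right.
- by right.
Qed.

Lemma fine_upto_mul (A : bornAlg V) (B C : set A) :
  fine_upto (M := ba_mod A) 1 B -> fine_upto (M := ba_mod A) 1 C ->
  fine_upto (M := ba_mod A) 1 (mulset B C).
Proof.
move=> [F [B' [fF bB h]]] [G [C' [fG bC g]]].
have bspan (X : set A) : finite_set X -> bounded (ba_born A) (span X).
  by move=> fX; apply: bounded_span; exact: bounded_finite.
pose D := span (mulset B' C' `|` mulset (span F) C' `|` mulset B' (span G)).
have [E fE EE] := @fine_alg_bdd V A F G (ex_intro2 _ _ F fF (@sub_span _ _ F))
   (ex_intro2 _ _ G fG (@sub_span _ _ G)).
exists E, D; split=> //.
  apply: bounded_span; apply: bounded_setU; first apply: bounded_setU.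
  - exact: (ba_bdd bB bC).
  - exact: (ba_bdd (bspan _ fF) bC).
  - exact: (ba_bdd bB (bspan _ fG)).
move=> _ [_ [_ [/h[u [v [Fu Bv ->]]] /g[u' [v' [Fu' Bv' ->]]] ->]]].
exists (u ** u'), (pi *: (v ** v') + (u ** v' + v ** u')); split.
- apply: span_mulset Fu Fu'; first exact: span_submod.
  by move=> x y Fx Gy; apply: EE; exists x, y.
- apply: (span_submod _).2; first by apply: sub_span; left; left; exists v, v'.
  apply: (submodD (span_submod _)); apply: sub_span; last by right; exists v, u'.
  by left; right; exists u, v'.
rewrite expr1 (linD (na_lin1 (u + pi *: v))) (linZ (na_lin1 (u + pi *: v))).
rewrite (linD (na_lin2 u')) (linD (na_lin2 v')) (linZ (na_lin2 u')) (linZ (na_lin2 v')).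
rewrite -addrA -scalerDr; congr (_ + _ *: _).
by rewrite addrC [RHS]addrA [_ + u ** v']addrC.
Qed.

Section TensorAlgebraFine.
Context (W : bornMod V) (tW : torsionfree W) (fW : fine_mod_pi W).
Local Notation TW := (tensor_alg W).

Definition letter (x : W) : TW := tword (x, [::]).

Lemma letter_lin : linear letter.
Proof. by move=> a x y; have := tword_lin [::] [::] a x y. Qed.

Fact letter_bdd S : bdd S -> bdd (M := ba_mod TW) (letter @` S).
Proof.
move=> bS; apply/talg_boundedP; exists 1%N, (span S); split; first exact: bsub_span.
move=> _ [x Sx <-]; apply: sub_span; exists (x, [::]); split=> // y.
by rewrite inE => /eqP->; exact: sub_span.
Qed.
Definition letter_bhom : bhom W (ba_mod TW) := BHom letter_lin letter_bdd.

Lemma words_leS N (B : set W) : words_le N.+1 B `<=`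
  (letter @` B) `|` mulset (letter @` B : set TW) (words_le N B).
Proof.
move=> _ [[x [|y s]] [/= szw hw ->]].
  by left; exists x => //; apply: hw; exact: mem_head.
right; exists (letter x), (tword (y, s)); split.
- by exists x => //; apply: hw; exact: mem_head.
- exists (y, s); split=> // z zs; apply: hw; move: zs.
  by rewrite /letters /= !inE => ->; rewrite orbT.
by rewrite -[RHS]/(tmul _ _) tmulE.
Qed.

Lemma tensor_alg_fine n (X : set TW) : bdd (M := ba_mod TW) X ->
  fine_upto (M := ba_mod TW) n X.
Proof.
apply: (@fine_upto_all (ba_mod TW)) => {n}{}X /talg_boundedP[N [B [bB XB]]].
apply: (@fine_upto_sub (ba_mod TW) _ _ _ XB); apply: (@fine_upto_span (ba_mod TW)).
have lB : fine_upto (M := ba_mod TW) 1 (letter @` B).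
  by apply: (fine_upto_image letter_bhom); apply: fine_upto1 => //; case: bB.
elim: N {XB} => [|N IH].
  exists set0, set0; split=> //; first exact: bounded_finite.
  by move=> b [w [szw]].
apply: (@fine_upto_sub (ba_mod TW) _ _ _ (@words_leS N B)).
by apply: (@fine_upto_setU (ba_mod TW)) => //; exact: fine_upto_mul.
Qed.

End TensorAlgebraFine.

Section TubeFine.
Context (R : bornAlg V) (I : ideal R).
Local Notation fpi := (frac_pi V).

(** If the denominators are bounded by [pi^N], an approximation of the numerators up to
    [pi^(N+1)] is one up to [pi] in the tube algebra. The finitely many approximants need not lie in
    the tube algebra, but the submodule of their span that does is finitely generated. *)
Lemma tube_fine l :
  (forall n (B : set R), bdd (M := ba_mod R) B -> fine_upto (M := ba_mod R) n B) ->
  fine_mod_pi (ba_mod (tube_alg I l)).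
Proof.
move=> fR; apply/fine_mod_piP => X /tube_bddP[N [S [[_ bS] XS]]].
have t1 f : linear (fun r : R => tens r (f : frac_mod V)) := (tens_bilin _ _).2 f.
have [F [B [/finite_seqP[s ->] _ hF]]] := fR N.+1 S bS.
have mU : is_submod (tube_set I l) by exact: span_submod.
pose s' := [seq tens r (fpi N) | r <- s].
have mN : is_submod (tube_set I l `&` span [set` s']).
  split; first by split; [exact: mU.1|exact: (span_submod _).1].
  by move=> a u v [Nu su] [Nv sv]; split; [exact: mU.2|exact: (span_submod _).2].
have [t [tU Nt]] := noetherian mN (@subIsetr _ _ _).
pose sec z : tube_alg I l :=
  if pselect (tube_set I l z) is left h then mksub (S := tube_sub I l) h else 0.
have secE z : tube_set I l z -> val (sec z) = z by rewrite /sec; case: pselect.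
exists (sec @` [set` t]); first by apply: finite_image; exact: finite_seq.
move=> x Xx; have [b Sb xE] := XS x Xx.
have [u [b' [Fu _ bE]]] := hF b Sb.
have b'U : tube_set I l (tens b' (fpi 0)) by apply: tube_gen; rewrite muln0.
pose y := mksub (S := tube_sub I l) b'U.
have xyE : val (x - pi *: y) = tens u (fpi N).
  rewrite -[LHS]/(val x - pi *: tens b' (fpi 0)) xE bE (linD (t1 _)).
  rewrite (tens_shift b' 0 N) add0n -(linZ (t1 _)) scalerA -exprS.
  by rewrite addrK.
exists (x - pi *: y); last by exists y; rewrite subrK.
have /Nt : (tube_set I l `&` span [set` s']) (val (x - pi *: y)).
  split; first exact: (submP (S := tube_sub I l) (x - pi *: y)).
  rewrite xyE; apply: image_span (t1 (fpi N)) _ _ Fu => r rs.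
  by apply: sub_span; apply/mapP; exists r.
suff H z : span [set` t] z -> exists2 v, span (sec @` [set` t]) v & val v = z.
  by move=> /H[v tv /val_inj<-].
move: z; apply: span_min => [|z zt].
  split=> [|a x1 x2 [v1 tv1 <-] [v2 tv2 <-]].
    by exists 0 => //; exact: (span_submod _).1.
  by exists (a *: v1 + v2) => //; exact: (span_submod _).2.
exists (sec z); last by apply: secE; case: (tU z zt).
by apply: sub_span; exists z.
Qed.

End TubeFine.
End FineDecomposition.

(** * The augmentation of a tube algebra *)

Section TubeAugmentation.
Context (V : completeDVR) (R : bornAlg V) (I : ideal R).
Local Notation pi := (unif V).
Local Notation fpi := (frac_pi V).
Local Notation RF := (ten_alg R (frac_alg V)).
Let tens1 (f : frac_mod V) : linear (fun r : R => tens r f) := (tens_bilin _ _).2 f.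

(** The terms with a denominator. An element of the tube algebra is an element of [R] plus one of
    these. *)
Definition tube_high (l : nat) : set RF :=
  span [set z | exists j r, apow I (l * j.+1) r /\ z = tens r (fpi j.+1)].

Lemma tube_split l z : tube_set I l z ->
  exists r h, tube_high l h /\ z = tens r (fpi 0) + h.
Proof.
have mH : is_submod (tube_high l) by exact: span_submod.
move: z; apply: span_min => [|_ [[|j] [r [Ir ->]]]].
- split=> [|a _ _ [r [h [Hh ->]]] [s [g [Hg ->]]]].
    exists 0, 0; split; first exact: mH.1.
    by rewrite addr0; exact: (esym (lin0 (tens1 _))).
  exists (a *: r + s), (a *: h + g); split; first exact: mH.2.
  by rewrite (tens1 (fpi 0)) scalerDr addrACA.
- by exists r, 0; split; [exact: mH.1|rewrite addr0].
exists 0, (tens r (fpi j.+1)); split; first by apply: sub_span; exists j, r.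
have -> : tens (0 : R) (fpi 0) = 0 by exact: (lin0 (tens1 _)).
by rewrite add0r.
Qed.

Lemma tube_high_mull l z h : tube_set I l z -> tube_high l h -> tube_high l (z ** h).
Proof.
apply: (span_mulset (A := RF)) => [|_ _ [i [r [Ir ->]]] [j [s [Is ->]]]].
  exact: span_submod.
apply: sub_span; exists (i + j)%N, (r ** s); split.
  by rewrite -addnS mulnDr; exact: apow_idealM.
apply: (etrans (@ten_mulE V R (frac_alg V) r (fpi i) s (fpi j.+1))); congr tens.
by rewrite -addnS -[LHS]/(_ * _) /frac_pi exprD invfM.
Qed.

Lemma tube_high_mulr l h z : tube_high l h -> tube_set I l z -> tube_high l (h ** z).
Proof.
apply: (span_mulset (A := RF)) => [|_ _ [j [s [Is ->]]] [i [r [Ir ->]]]].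
  exact: span_submod.
apply: sub_span; exists (j + i)%N, (s ** r); split.
  by rewrite -addSn mulnDr; exact: apow_idealM.
apply: (etrans (@ten_mulE V R (frac_alg V) s (fpi j.+1) r (fpi i))); congr tens.
by rewrite -addSn -[LHS]/(_ * _) /frac_pi exprD invfM.
Qed.

Lemma tube_low l (r : R) : tube_set I l (tens r (fpi 0)).
Proof. by apply: tube_gen; rewrite muln0. Qed.

Lemma tube_high_decr l l' : (l <= l')%N -> tube_high l' `<=` tube_high l.
Proof.
move=> ll; apply: span_mono => _ [j [r [Ir ->]]]; exists j, r; split=> //.
by apply: apow_decr Ir; rewrite leq_mul2r ll orbT.
Qed.

(** Divisibility of [phi r] by [pi] in the torsionfree algebra [D] serves as a test for
    membership of [r] in [I]. *)
Context (D : nualg V) (phi : R -> D) (lphi : linear phi)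
  (phiM : forall x y : R, phi (x ** y) = phi x ** phi y)
  (tD : forall d : D, pi *: d = 0 -> d = 0)
  (phiI : forall x, sm_set I x <-> exists d, phi x = pi *: d).

Lemma phi_apow k x : apow I k x -> exists d, phi x = pi ^+ k *: d.
Proof.
case: k => [|k]; first by exists (phi x); rewrite expr0 scale1r.
move: x; apply: (apow_ind (P := fun i => [set x | exists d, phi x = pi ^+ i.+1 *: d])).
- move=> i; split=> [|a x y [d dE] [e eE]].
    by exists 0; rewrite (lin0 lphi) scaler0.
  by exists (a *: d + e); rewrite lphi dE eE scalerDr !scalerA mulrC.
- by move=> x /phiI[d dE]; exists d; rewrite expr1.
move=> i x y [d dE] /phiI[e eE]; exists (d ** e).
rewrite phiM dE eE (linZ (na_lin1 _)) (linZ (na_lin2 e)) scalerA.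
by rewrite -exprS.
Qed.

(** [phi] maps [I^(l (j+1))] to multiples of [pi^(l (j+1))], and [l (j+1) >= j+2]. *)
Lemma phi_high l z : (1 < l)%N -> tube_high l z ->
  exists N y d, z = tens y (fpi N) /\ phi y = pi ^+ N.+1 *: d.
Proof.
move=> l1; move: z; apply: span_min => [|_ [j [r [Ir ->]]]].
  split=> [|a _ _ [N [y [d [-> yE]]]] [M [x [e [-> xE]]]]].
    exists 0%N, 0, 0; split; first exact: (esym (lin0 (tens1 _))).
    by rewrite (lin0 lphi) scaler0.
  exists (N + M)%N, (a *: (pi ^+ M *: y) + pi ^+ N *: x), (a *: d + e); split.
    have E := tens_shift x M N; rewrite [(M + N)%N]addnC in E.
    apply: etrans (esym (tens1 (fpi (N + M)) a _ _)).
    exact: (f_equal2 (fun u v => a *: u + v) (tens_shift y N M) E).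
  rewrite lphi !(linZ lphi) yE xE scalerDr !scalerA -!exprD.
  by rewrite -mulrA -exprD addnS [(M + N)%N]addnC -[RHS]/(_ + _) -addnS mulrC.
have [d dE] := phi_apow Ir.
exists j.+1, r, (pi ^+ (l * j.+1 - j.+2) *: d); split=> //.
rewrite dE scalerA -exprD subnKC //.
by apply: leq_trans (leq_mul l1 (leqnn j.+1)); rewrite mul2n -addnn addSn ltnS leq_addl.
Qed.

(** The part of a tube element in [R] is well defined modulo [I]. The bound on [l] is necessary:
    for [l = 1] each [r] is [pi^-1 (pi r)], and [pi r] may well be in [I]. *)
Lemma tube_low_high l (r : R) : (1 < l)%N -> tube_high l (tens r (fpi 0)) -> sm_set I r.
Proof.
move=> l1 /(phi_high l1)[N [y [d [E yE]]]]; apply/phiI; exists d.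
have : tens (pi ^+ N *: r - y) (fpi N) = 0.
  rewrite (linB (tens1 (fpi N))) -E; apply/eqP; rewrite subr_eq0; apply/eqP.
  exact: (esym (tens_shift r 0 N)).
move=> /tens_eq0[k]; move=> /(congr1 phi).
rewrite (lin0 lphi) (linZ lphi) (linB lphi) (linZ lphi) yE exprS -scalerA.
rewrite [pi *: _]scalerA mulrC -scalerA -scalerBr scalerA -exprD.
elim: (k + N)%N => [|n IH]; last by rewrite exprS -scalerA => /tD.
by rewrite expr0 scale1r => /eqP; rewrite subr_eq0 => /eqP.
Qed.

Context (A : nualg V) (q : R -> A) (lq : linear q) (qM : forall x y, q (x ** y) = q x ** q y).
Context (qI : forall r, sm_set I r <-> q r = 0) (q_surj : forall a, exists r, q r = a).

Section Level.
Context (l : nat) (l1 : (1 < l)%N).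

Let split_val (u : tube_alg I l) :
  {r | exists2 h, tube_high l h & val u = tens r (fpi 0) + h}.
Proof. by apply: cid; have [r [h [Hh E]]] := tube_split (submP u); exists r, h. Qed.

(** The map that is [q] on [R] and zero on terms with a denominator; it does not depend on the
    chosen decomposition, by [tube_low_high]. *)
Definition tube_aug (u : tube_alg I l) : A := q (sval (split_val u)).

Lemma tube_augE u r h : tube_high l h -> val u = tens r (fpi 0) + h -> tube_aug u = q r.
Proof.
move=> Hh E; rewrite /tube_aug; case: (split_val u) => s [g Hg E'] /=.
apply/eqP; rewrite -subr_eq0 -(linB lq); apply/eqP/qI/(tube_low_high l1).
rewrite (linB (tens1 (fpi 0))).
have -> : tens s (fpi 0) - tens r (fpi 0) = h - g :> RF.
  by apply/eqP; rewrite subr_eq addrAC eq_sym subr_eq addrC -E E' addrC.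
by apply: (submodB (span_submod _)).
Qed.

Lemma tube_aug_split u : exists r h, [/\ tube_high l h, val u = tens r (fpi 0) + h &
  tube_aug u = q r].
Proof.
by have [r [h [Hh E]]] := tube_split (submP u); exists r, h; split=> //; exact: tube_augE E.
Qed.

Lemma tube_aug_lin : linear tube_aug.
Proof.
move=> a u v; have [r [h [Hh uE ->]]] := tube_aug_split u.
have [s [g [Hg vE ->]]] := tube_aug_split v; rewrite -lq.
apply: (tube_augE (h := a *: h + g)); first exact: (span_submod _).2.
rewrite (tens1 (fpi 0)) -[LHS]/(a *: val u + val v) uE vE.
by rewrite scalerDr addrACA.
Qed.

Lemma tube_augM u v : tube_aug (u ** v) = tube_aug u ** tube_aug v.
Proof.
have [r [h [Hh uE ->]]] := tube_aug_split u.
have [s [g [Hg vE ->]]] := tube_aug_split v; rewrite -qM.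
apply: (tube_augE (h := (tens r (fpi 0) : RF) ** g + h ** val v)).
  apply: (submodD (span_submod _)); first exact (tube_high_mull (@tube_low l r) Hg).
  exact (tube_high_mulr Hh (submP v)).
have -> : tens (r ** s) (fpi 0) = (tens r (fpi 0) : RF) ** tens s (fpi 0).
  apply/esym/(etrans (@ten_mulE V R (frac_alg V) r (fpi 0) s (fpi 0))); congr tens.
  by rewrite -[LHS]/(_ * _) /frac_pi expr0 invr1 mulr1.
rewrite addrA -(linD (na_lin1 (tens r (fpi 0) : RF))) -vE.
by rewrite -(linD (na_lin2 (val v : RF))) -uE.
Qed.

Lemma tube_aug_surj a : exists u, tube_aug u = a.
Proof.
have [r rE] := q_surj a; exists (mksub (S := tube_sub I l) (@tube_low l r)).
rewrite -rE; apply: (tube_augE (h := 0)); first exact: (span_submod _).1.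
by rewrite addr0.
Qed.

End Level.

Lemma tube_aug_incl l l' (h : (l <= l')%N) (l1 : (1 < l)%N) (l1' : (1 < l')%N)
    (u : tube_alg I l') :
  tube_aug (tube_incl h u) = tube_aug u.
Proof.
have [r [g [Hg uE ->]]] := tube_aug_split l1' u.
by apply: (tube_augE l1 (h := g)) => //; exact: tube_high_decr h _ Hg.
Qed.

Section Kernel.
Local Notation J := (full_ideal (ideal_alg I)).

Lemma tube_aug_ker l (u : tube_alg I l.+2) :
  tube_aug u = 0 <-> exists v, u = tube_val_ahom I l.+1 v.
Proof.
have mJ : is_submod (tube_set J l.+2) by exact: span_submod.
split=> [u0|[v ->]].
  suff [w Jw wE] : (@tens_ival _ _ I @` tube_set J l.+2) (val u).
    by exists (mksub (S := tube_sub J l.+2) Jw); apply: val_inj; rewrite -wE.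
  have mT : is_submod (@tens_ival _ _ I @` tube_set J l.+2).
    exact: image_submod (@tens_ival_lin _ _ I) mJ.
  have [//|r [h [Hh -> rE]]] := @tube_aug_split l.+2 _ u.
  apply: (submodD mT).
    have Ir : sm_set I r by apply/qI; rewrite -rE.
    exists (tens (mksub (S := I) Ir : ideal_alg I) (fpi 0)); first by apply: tube_gen; rewrite muln0.
    exact: tens_ivalE.
  move: h Hh; apply: span_min => // _ [j [r' [Ir' ->]]].
  exact: tube_high_image.
have [r [h [Ir Hh E]]] : exists r h, [/\ sm_set I r, tube_high l.+2 h &
    tens_ival (val v) = tens r (fpi 0) + h].
  have mH : is_submod (tube_high l.+2) by exact: span_submod.
  have mI := sm_closed I.
  move: (val v) (submP v); apply: span_min => [|_ [[|j] [x [Jx ->]]]].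
  - split=> [|a x y [r [h [Ir Hh xE]]] [s [g [Is Hg yE]]]].
      exists 0, 0; split; [exact: mI.1|exact: mH.1|].
      by rewrite (lin0 (@tens_ival_lin _ _ I)) addr0; exact: (esym (lin0 (tens1 _))).
    exists (a *: r + s), (a *: h + g); split; [exact: mI.2|exact: mH.2|].
    by rewrite (@tens_ival_lin _ _ I) xE yE (tens1 (fpi 0)) scalerDr addrACA.
  - exists (ival x), 0; split; [exact: submP|exact: mH.1|].
    by rewrite addr0; exact: tens_ivalE.
  exists 0, (tens (ival x) (fpi j.+1)); split; first exact: mI.1.
    apply: sub_span; exists j, (ival x); split=> //.
    by move: Jx; rewrite mulSn addSn apow_ival.
  apply: (etrans (tens_ivalE _ _)); have -> : tens (0 : R) (fpi 0) = 0 by exact: (lin0 (tens1 _)).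
  by rewrite add0r.
have -> : tube_aug (tube_val_ahom I l.+1 v) = q r by apply: (@tube_augE l.+2 isT _ _ _ Hh).
exact/qI.
Qed.
End Kernel.
End TubeAugmentation.

(** * Extensions of pro-algebras with constant quotient *)

Section ProExtension.
Context (V : completeDVR) (K E : proalg V nat_dir) (A : nualg V).
Local Notation C := (const_pro (fine_alg A)).

Context (i : forall n, ahom (K n) (E n)).
Hypothesis i_nat : forall m n (h : (m <= n)%N) x,
  pa_tr (J := nat_dir) E h (i n x) = i m (pa_tr (J := nat_dir) K h x).
Hypothesis i_inj : forall n, injective (i n).
Hypothesis i_emb : forall n (S : set (K n)),
  bdd (M := ba_mod (E n)) ((i n : K n -> E n) @` S) -> bdd (M := ba_mod (K n)) S.

Context (p : forall n, ahom (E n.+1) (fine_alg A)).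
Hypothesis p_nat : forall m n (h : (m.+1 <= n.+1)%N) x,
  p m (pa_tr (J := nat_dir) E h x) = p n x.
Hypothesis p_ker : forall n x, p n x = 0 <-> exists v, x = i n.+1 v.
Hypothesis p_surj : forall n a, exists x, p n x = a.

Fact pro_incl_compat j j' (h : dle (d := nat_dir) j j') :
  exists l (h1 : dle (d := nat_dir) j l) (h2 : dle j' l),
  forall x, i j (ps_tr (pa_mod K) h1 x) = ps_tr (pa_mod E) h (i j' (ps_tr (pa_mod K) h2 x)).
Proof.
by exists j', h, (dle_refl j') => x /=; rewrite i_nat (pa_comp _ _ h).
Qed.
Definition pro_incl_mor : promor (pa_mod K) (pa_mod E) :=
  @ProMor V nat_dir nat_dir (pa_mod K) (pa_mod E) id (fun j => i j) pro_incl_compat.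
Definition pro_incl : proalg_mor K E :=
  @ProAlgMor V nat_dir nat_dir K E pro_incl_mor (fun j => ah_mul (i j)).

Fact pro_aug_compat j j' (h : dle (d := unit_dir) j j') :
  exists l (h1 : dle (d := nat_dir) 1%N l) (h2 : dle (d := nat_dir) 1%N l),
  forall x, p 0 (ps_tr (pa_mod E) h1 x) = ps_tr (pa_mod C) h (p 0 (ps_tr (pa_mod E) h2 x)).
Proof. by exists 1%N, (dle_refl (1%N : nat_dir)), (dle_refl (1%N : nat_dir)). Qed.
(** The single level [1] determines the morphism, as the target is constant. *)
Definition pro_aug_mor : promor (pa_mod E) (pa_mod C) :=
  @ProMor V nat_dir unit_dir (pa_mod E) (pa_mod C) (fun _ => 1%N) (fun _ => p 0)
    pro_aug_compat.
Definition pro_aug : proalg_mor E C :=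
  @ProAlgMor V nat_dir unit_dir E C pro_aug_mor (fun _ => ah_mul (p 0)).

Lemma pro_aug_incl0 : promor_eq0 (promor_comp pro_aug pro_incl).
Proof.
move=> j; exists 1%N, (dle_refl (1%N : nat_dir)) => x /=.
by apply/p_ker; exists (pa_tr (J := nat_dir) K (leqnn 1) x).
Qed.

Section Kernel.
Context (L : dirset) (T : prosys V L) (f : promor T (pa_mod E)).
Hypothesis f0 : promor_eq0 (promor_comp pro_aug f).

(** The kernel of [E (n+1) -> A] is the image of [K (n+1)], so [f] at level [n+1] lifts there far out
    in [T]; the lifting is then pushed down to level [n], which avoids the first level, where there
    is no map to [A]. *)
Lemma kernel_lift_ex (n : nat) : exists (l : L) (c : dle (pm_idx f n.+1) l)
    (g : bhom (T l) (ba_mod (K n))),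
  forall x, i n (g x) = pa_tr (J := nat_dir) E (leqnSn n) (pm_map f n.+1 (ps_tr T c x)).
Proof.
have [l0 [h0 f0E]] := f0 tt.
have [l1 [a [b abE]]] := pm_compat f (isT : dle (d := nat_dir) 1%N n.+1).
have [l [c0 c1]] := dir_ub l0 l1; exists l, (dle_trans b c1).
pose F := pm_map f n.+1 : bhom (T (pm_idx f n.+1)) (ba_mod (E n.+1)).
have /choice[v vE] (x : T l) : exists v, F (ps_tr T (dle_trans b c1) x) = i n.+1 v.
  apply/p_ker; rewrite -(@p_nat 0 n isT) -(ps_comp b c1) -[pa_tr _ _ _]abE.
  by rewrite (ps_comp a c1 (dle_trans h0 c0)) -(ps_comp h0 c0); exact: f0E.
have lF : linear (fun x : T l => F (ps_tr T (dle_trans b c1) x)).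
  exact: comp_linear (bh_lin F) (bh_lin _).
have lv : linear v.
  move=> c x y; apply: (@i_inj n.+1); rewrite -vE (bh_lin (i n.+1)) -!vE; exact: lF.
have bv S : bdd S -> bdd (M := ba_mod (K n.+1)) (v @` S).
  move=> bS; apply: i_emb.
  apply: (@bounded_sub _ _ (ba_born (E n.+1)) _ (F @` (ps_tr T (dle_trans b c1) @` S))).
    move=> _ [_ [x Sx <-] <-]; exists (ps_tr T (dle_trans b c1) x); first by exists x.
    exact: vE.
  by do 2 apply: bh_bdd.
exists (bhom_comp (pa_tr (J := nat_dir) K (leqnSn n))
  (@BHom V (T l) (ba_mod (K n.+1)) v lv bv)) => x.
by rewrite /= -i_nat -vE.
Qed.

Definition kernel_idx n : L := projT1 (cid (kernel_lift_ex n)).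
Definition kernel_le n : dle (pm_idx f n.+1) (kernel_idx n) :=
  projT1 (cid (projT2 (cid (kernel_lift_ex n)))).
Definition kernel_map n : bhom (T (kernel_idx n)) (ba_mod (K n)) :=
  projT1 (cid (projT2 (cid (projT2 (cid (kernel_lift_ex n)))))).

Lemma kernel_mapE n x : i n (kernel_map n x) =
  pa_tr (J := nat_dir) E (leqnSn n) (pm_map f n.+1 (ps_tr T (kernel_le n) x)).
Proof. exact: (projT2 (cid (projT2 (cid (projT2 (cid (kernel_lift_ex n))))))). Qed.

Fact kernel_compat j j' (h : dle (d := nat_dir) j j') :
  exists l (h1 : dle (kernel_idx j) l) (h2 : dle (kernel_idx j') l),
  forall x, kernel_map j (ps_tr T h1 x) = ps_tr (pa_mod K) h (kernel_map j' (ps_tr T h2 x)).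
Proof.
have [l0 [a [b abE]]] := pm_compat f (h : dle (d := nat_dir) j.+1 j'.+1).
have [l1 [c d]] := dir_ub (kernel_idx j) (kernel_idx j').
have [l [c0 c1]] := dir_ub l0 l1.
exists l, (dle_trans c c1), (dle_trans d c1) => x; apply: i_inj.
rewrite -[ps_tr (pa_mod K) h _]/(pa_tr (J := nat_dir) K h _) -i_nat !kernel_mapE.
rewrite (ps_comp _ _ (dle_trans a c0)) (ps_comp _ _ (dle_trans b c0)).
rewrite -(ps_comp a c0) -(ps_comp b c0) abE.
rewrite -[ps_tr (pa_mod E) _ _]/(pa_tr (J := nat_dir) E (h : (j.+1 <= j'.+1)%N) _).
have h' : (j <= j'.+1)%N by exact: leqW.
by rewrite (pa_comp (p := E) (leqnSn j) _ (h' : dle (d := nat_dir) j j'.+1))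
           (pa_comp (p := E) h _ (h' : dle (d := nat_dir) j j'.+1)).
Qed.

Definition kernel_mor : promor T (pa_mod K) :=
  @ProMor V L nat_dir T (pa_mod K) kernel_idx kernel_map kernel_compat.

Lemma kernel_morP : promor_eq (promor_comp pro_incl kernel_mor) f.
Proof.
move=> j; have [l0 [a [b abE]]] := pm_compat f (leqnSn j : dle (d := nat_dir) j j.+1).
have [l [c d]] := dir_ub l0 (kernel_idx j).
exists l, d, (dle_trans a c) => x /=; rewrite kernel_mapE.
rewrite (ps_comp _ _ (dle_trans b c)) -(ps_comp a c) -(ps_comp b c) abE.
by congr (pa_tr _ _ _).
Qed.

End Kernel.

Lemma pro_incl_mono (L : dirset) (T : prosys V L) (f : promor T (pa_mod E))
    (g g' : promor T (pa_mod K)) :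
  promor_eq (promor_comp pro_incl g) f -> promor_eq (promor_comp pro_incl g') f ->
  promor_eq g' g.
Proof.
move=> gf gf' j; have [l0 [a [b abE]]] := gf j; have [l1 [a' [b' abE']]] := gf' j.
have [l [c c']] := dir_ub l0 l1; exists l, (dle_trans a' c'), (dle_trans a c) => x.
apply: i_inj; move: (abE (ps_tr T c x)) (abE' (ps_tr T c' x)) => /=.
rewrite (ps_comp a c (dle_trans a c)) (ps_comp a' c' (dle_trans a' c')) => -> ->.
by rewrite (ps_comp b c (dle_trans b c)) (ps_comp b' c' (dle_trans b c)).
Qed.

Lemma pro_incl_kernel : is_kernel pro_incl pro_aug.
Proof.
split; first exact: pro_aug_incl0.
move=> L T f f0; exists (kernel_mor f0); split; first exact: kernel_morP.
by move=> g' hg'; apply: pro_incl_mono hg'; exact: kernel_morP.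
Qed.

Section Cokernel.
Context (L : dirset) (T : prosys V L) (f : promor (pa_mod E) T).
Hypothesis f0 : promor_eq0 (promor_comp f pro_incl).

(** Far out, [f] at index [j] vanishes on the image of [K], hence factors through the surjection to
    [A]. Linear maps from [A] are bounded because [A] is fine. *)
Lemma cokernel_factor_ex (j : L) : exists (m : nat) (h : (pm_idx f j <= m.+1)%N)
  (g : bhom (ba_mod (fine_alg A)) (T j)),
  forall x, g (p m x) = pm_map f j (pa_tr (J := nat_dir) E h x).
Proof.
have [m [h hE]] := f0 j; rewrite /= in hE.
have h' : (pm_idx f j <= m.+1)%N by exact: leqW.
exists m, h'; pose F x := pm_map f j (pa_tr (J := nat_dir) E h' x).
have lF : linear F by exact: comp_linear (bh_lin _) (bh_lin _).
have F0 x : p m x = 0 -> F x = 0.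
  move=> /p_ker[v ->]; rewrite /F i_nat.
  by rewrite -(pa_comp (p := K) h (leqnSn m : dle (d := nat_dir) m m.+1) h'); exact: hE.
have [s sE] := choice (p_surj m).
have gE x : F (s (p m x)) = F x.
  apply/eqP; rewrite -subr_eq0 -(linB lF); apply/eqP/F0.
  by rewrite (linB (bh_lin (p m))) sE subrr.
have lg : linear (fun a => F (s a)).
  move=> c a b; rewrite -lF -[RHS]gE; congr (F (s _)).
  by rewrite (bh_lin (p m)) !sE.
have bg (S : set (ba_mod (fine_alg A))) : bdd S -> bdd ((fun a => F (s a)) @` S).
  move=> [G fG SG].
  apply: (@bounded_sub _ _ (bm_born (T j)) _ (span ((fun a => F (s a)) @` G))).
    move=> _ [a /SG Ga <-]; apply: (image_span lg) Ga => b Gb.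
    by apply: sub_span; exists b.
  by apply: bounded_span; apply: bounded_finite; exact: finite_image.
by exists (@BHom V (ba_mod (fine_alg A)) (T j) _ lg bg).
Qed.

Definition cokernel_map (j : L) : bhom (ba_mod (fine_alg A)) (T j) :=
  projT1 (cid (projT2 (cid (projT2 (cid (cokernel_factor_ex j)))))).

Lemma cokernel_mapP (j : L) : exists (m : nat) (h : (pm_idx f j <= m.+1)%N),
  forall x, cokernel_map j (p m x) = pm_map f j (pa_tr (J := nat_dir) E h x).
Proof.
exists (projT1 (cid (cokernel_factor_ex j))), (projT1 (cid (projT2 (cid (cokernel_factor_ex j))))).
exact: (projT2 (cid (projT2 (cid (projT2 (cid (cokernel_factor_ex j))))))).
Qed.

(** The factorisation holds at all late levels, beyond any given bound. *)
Lemma cokernel_mapE (j : L) N : exists2 M, (N <= M)%N &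
  forall n (h : (pm_idx f j <= n.+1)%N), (M <= n)%N ->
  forall x, cokernel_map j (p n x) = pm_map f j (pa_tr (J := nat_dir) E h x).
Proof.
have [m [h hE]] := cokernel_mapP j; exists (maxn N m); first exact: leq_maxl.
move=> n h' Mn x; have mn : (m.+1 <= n.+1)%N by rewrite ltnS (leq_trans (leq_maxr _ _) Mn).
rewrite -(p_nat mn) hE; congr (pm_map f j _).
exact: (pa_comp (p := E) (h : dle (d := nat_dir) _ _) (mn : dle (d := nat_dir) _ _)).
Qed.

Fact cokernel_compat j j' (h : dle j j') :
  exists l (h1 : dle (d := unit_dir) tt l) (h2 : dle (d := unit_dir) tt l),
  forall x, cokernel_map j (ps_tr (pa_mod C) h1 x) =
    ps_tr T h (cokernel_map j' (ps_tr (pa_mod C) h2 x)).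
Proof.
exists tt, I, I => a /=; have [l [c [d cdE]]] := pm_compat f h.
have [M lM ME] := cokernel_mapE j l; have [M' MM' ME'] := cokernel_mapE j' M.
have lM' : (l <= M'.+1)%N by rewrite leqW // (leq_trans lM MM').
have hj : (pm_idx f j <= M'.+1)%N by exact: leq_trans c lM'.
have hj' : (pm_idx f j' <= M'.+1)%N by exact: leq_trans d lM'.
have [x <-] := p_surj M' a; rewrite (ME _ hj) // (ME' _ hj') //.
rewrite -(pa_comp (p := E) (c : dle (d := nat_dir) _ _) (lM' : dle (d := nat_dir) _ _)).
rewrite -(pa_comp (p := E) (d : dle (d := nat_dir) _ _) (lM' : dle (d := nat_dir) _ _)).
exact: cdE.
Qed.

Definition cokernel_mor : promor (pa_mod C) T :=
  @ProMor V unit_dir L (pa_mod C) T (fun _ => tt) cokernel_map cokernel_compat.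

Lemma cokernel_morP : promor_eq (promor_comp cokernel_mor pro_aug) f.
Proof.
move=> j; have [M NM ME] := cokernel_mapE j (pm_idx f j).
have h : (pm_idx f j <= M.+1)%N by exact: leqW.
exists M.+1, (isT : dle (d := nat_dir) 1%N M.+1), h => x /=.
rewrite -(ME _ h) //; congr (cokernel_map j _); exact: p_nat.
Qed.

End Cokernel.

Lemma pro_aug_epi (L : dirset) (T : prosys V L) (f : promor (pa_mod E) T)
    (g g' : promor (pa_mod C) T) :
  promor_eq (promor_comp g pro_aug) f -> promor_eq (promor_comp g' pro_aug) f ->
  promor_eq g' g.
Proof.
move=> gf gf' j; have [l0 [a [b abE]]] := gf j; have [l1 [a' [b' abE']]] := gf' j.
exists tt, I, I => q /=; pose M := maxn l0 l1.
have h0 : (l0 <= M.+1)%N by rewrite leqW // leq_maxl.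
have h1 : (l1 <= M.+1)%N by rewrite leqW // leq_maxr.
have [x <-] := p_surj M q.
move: (abE (pa_tr (J := nat_dir) E h0 x)) (abE' (pa_tr (J := nat_dir) E h1 x)) => /=.
have h : (1 <= M.+1)%N by [].
rewrite (pa_comp (p := E) _ _ (h : dle (d := nat_dir) 1%N M.+1)).
rewrite [in X in _ -> X -> _](pa_comp (p := E) _ _ (h : dle (d := nat_dir) 1%N M.+1)).
rewrite p_nat => -> ->.
have hb : (pm_idx f j <= M.+1)%N by exact: leq_trans b h0.
by rewrite !(pa_comp (p := E) _ _ (hb : dle (d := nat_dir) _ _)).
Qed.

Lemma pro_aug_cokernel : is_cokernel pro_incl pro_aug.
Proof.
split; first exact: pro_aug_incl0.
move=> L T f f0; exists (cokernel_mor f0); split; first exact: cokernel_morP.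
by move=> g' hg'; apply: pro_aug_epi hg'; exact: cokernel_morP.
Qed.

Theorem pro_extension : is_extension pro_incl pro_aug.
Proof. by split; [exact: pro_incl_kernel|exact: pro_aug_cokernel]. Qed.

End ProExtension.

(** * The extension *)

Section DiscreteTarget.
Context (V : completeDVR) (A : nualg V).
Local Notation pi := (unif V).
Hypothesis piA : forall a : A, pi *: a = 0.

Lemma fine_killed_complete : complete (ba_mod (fine_alg A)).
Proof.
move=> S bS; exists S; split=> //.
apply/series_completeP; first by case: bS.
split=> [x _ /(_ 1%N)[y _ ->]|x Sx]; first by rewrite expr1 piA.
by exists x => // n; rewrite piA addr0.
Qed.

Context (B : bornAlg V) (fB : fine_mod_pi (ba_mod B)).
Context (f : B -> A) (lf : linear f) (fM : forall x y, f (x ** y) = f x ** f y).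

(** [f] factors through [B / pi B], which is fine. *)
Fact killed_bdd (S : set B) : bdd (M := ba_mod B) S -> bdd (M := ba_mod (fine_alg A)) (f @` S).
Proof.
move=> bS; have [F fF hF] := (fine_mod_piP (ba_mod B)).1 fB S bS.
exists (f @` F); first exact: finite_image.
move=> _ [_ /hF[u Fu [y ->]] <-]; rewrite (linD lf) (linZ lf) piA addr0.
by apply: (image_span lf) Fu => v Fv; apply: sub_span; exists v.
Qed.
Definition killed_bhom : bhom (ba_mod B) (ba_mod (fine_alg A)) :=
  @BHom V (ba_mod B) (ba_mod (fine_alg A)) f lf killed_bdd.

Definition killed_ext : bhom (compl (ba_mod B)) (ba_mod (fine_alg A)) :=
  ext fine_killed_complete killed_bhom.

Lemma killed_extE (s : bdseq (ba_mod B)) : killed_ext (cl s) = f (terms s 0).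
Proof.
apply: ext_funP; exists (fun n => f (terms s n)); split=> // [|n].
  have [S bS Ss] := terms_bdd s; exists (killed_bhom @` S); first exact: bsub_image.
  by move=> n; exists (terms s n).
by rewrite [_ *: _]piA addr0.
Qed.

Fact killed_ext_mul (x y : compl_alg B) :
  (killed_ext (x ** y) : A) = (killed_ext x : A) ** killed_ext y.
Proof.
have [s ->] := cl_surj x; have [t ->] := cl_surj y.
by rewrite cl_mul !killed_extE bmul0E fM.
Qed.
Definition killed_ahom : ahom (compl_alg B) (fine_alg A) :=
  @AHom V (compl_alg B) (fine_alg A) killed_ext killed_ext_mul.

End DiscreteTarget.

Section ProIdentity.
Context (V : comNzRingType) (J : dirset) (B : proalg V J).
Definition proalg_id : proalg_mor B B :=
  @ProAlgMor V J J B B (promor_id (pa_mod B)) (fun _ _ _ => erefl).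

Lemma pro_iso_refl : pro_iso B B.
Proof. by exists proalg_id, proalg_id; split=> j; exists j, (dle_refl j), (dle_refl j). Qed.
End ProIdentity.

Section NilpotentCompletion.
Context (V : completeDVR).
Local Notation pi := (unif V).

(** Each factor is [ceta b] modulo [pi], by [cl_tail]. *)
Lemma apow_compl (B : bornAlg V) n (z : compl_alg B) : apow [set: compl_alg B] n.+1 z ->
  exists b w, apow [set: B] n.+1 b /\ z = ceta (ba_mod B) b + pi *: w.
Proof.
move: z; pose P i := [set z : compl_alg B | exists b w,
  apow [set: B] i.+1 b /\ z = ceta (ba_mod B) b + pi *: w].
have le := bh_lin (ceta (ba_mod B)).
have tailE (y : compl_alg B) : exists (b : B) w, y = ceta (ba_mod B) b + pi *: w.
  have [s ->] := cl_surj y; exists (terms s 0), (cl (tail s)); exact: cl_tail.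
apply: (apow_ind (P := P)) => [i|z _|i _ y [b [w [Bb ->]]] _].
- split=> [|a _ _ [b [w [Bb ->]]] [c [v [Bc ->]]]].
    exists 0, 0; split; first exact: (apow_submod _ _).1.
    by rewrite (lin0 le) scaler0 addr0.
  exists (a *: b + c), (a *: w + v); split; first exact: (apow_submod _ _).2.
  by rewrite le !scalerDr addrACA !scalerA mulrC.
- by have [b [w ->]] := tailE z; exists b, w; split=> //; exact: sub_apow1.
have [c [v ->]] := tailE y; set eb := ceta _ b; set ec := ceta _ c.
exists (b ** c), ((eb : compl_alg B) ** v + (w : compl_alg B) ** (ec + pi *: v)).
split; first exact: sub_apow.
rewrite ceta_mul -/eb -/ec (linD (na_lin2 (ec + pi *: v : compl_alg B))).
rewrite (linZ (na_lin2 (ec + pi *: v : compl_alg B))).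
rewrite (linD (na_lin1 (eb : compl_alg B))) (linZ (na_lin1 (eb : compl_alg B))).
by rewrite scalerDr !addrA.
Qed.

Context (R : bornAlg V).
Local Notation J := (full_ideal R).

Lemma apow_tube_val l n (b : tube_alg J l) : apow [set: tube_alg J l] n.+1 b ->
  apow (tube_set J l) n.+1 (val b).
Proof.
pose P i : set (tube_alg J l) := [set b | apow (tube_set J l) i.+1 (val b)].
move: b; apply: (apow_ind (P := P)).
- by move=> i; split=> [|a x y]; [exact: (apow_submod _ _).1|exact: (apow_submod _ _).2].
- move=> x _; apply: (@sub_apow1 _ (ten_alg R (frac_alg V))).
  exact: (submP (S := tube_sub J l) x).
move=> i x y Px _; apply: (@sub_apow _ (ten_alg R (frac_alg V))) => //.
exact: (submP (S := tube_sub J l) y).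
Qed.

(** Modulo [pi] products may be computed in the uncompleted algebras, where
    [tube_full_nilpotent] applies. *)
Lemma compl_tube_nilpotent : nilpotent_mod_pi (compl_pro (lg_pro pi (tube_pro J))).
Proof.
move=> n; have h : (n <= (2 * n.+1).-1)%N.
  by rewrite -ltnS prednK ?muln_gt0 // leq_pmull.
exists (2 * n.+1).-1, h, n.+1; split=> // x /apow_compl[b [w [Jb ->]]].
have /tube_full_nilpotent[y Jy yE] := apow_tube_val Jb.
set f := pa_tr (lg_pro pi (tube_pro J)) (h : dle (d := nat_dir) _ _).
pose c : lg_pro pi (tube_pro J) n := mksub (S := tube_sub J n.+1) Jy.
have fb : f b = pi *: c by apply: val_inj; exact: yE.
exists (ceta (ba_mod (lg_pro pi (tube_pro J) n)) c + cmap f w).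
rewrite -[LHS]/(cmap f _) (linD (bh_lin (cmap f))) (linZ (bh_lin (cmap f))) cmap_eta.
by rewrite fb (linZ (bh_lin (ceta _))) scalerDr.
Qed.

End NilpotentCompletion.

Theorem theorem7p3 (V : completeDVR)
    (V_char0 : [pchar {fraction V}] =i pred0)
    (k : fieldType) (res : {rmorphism V -> k})
    (k_residue : is_residue_field res)
    (A : nualg k)
    (W : bornMod V) (W_torsionfree : torsionfree W) (W_complete : complete W)
    (W_fine : fine_mod_pi W)
    (rho : W -> restr_alg res A) (rho_lin : linear rho)
    (rho_surj : forall a, exists w, rho w = a) :
  let TW := tensor_alg W in
  let I : ideal TW := kernel_ideal rho_lin in
  exists (K E : proalg V nat_dir)
         (i : proalg_mor K E)
         (p : proalg_mor E (const_pro (fine_alg (restr_alg res A)))),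
    [/\ pro_completion (lg_pro (unif V) (tube_pro (full_ideal (ideal_alg I)))) K,
        pro_completion (lg_pro (unif V) (tube_pro I)) E,
        is_extension i p,
        pro_dagger E /\ pro_fine_mod_pi E &
        analytically_nilpotent K].
Proof.
move=> TW I; set RA := restr_alg res A.
have res_pi : res (unif V) = 0 by apply/k_residue.2; exists 1; rewrite mulr1.
have piA (a : RA) : unif V *: a = 0 by rewrite restrE res_pi scale0r.
have lq : linear (thom rho) := thom_linear rho_lin.
have piI (r : TW) : sm_set I (unif V *: r).
  by rewrite /= /thom_ker /= (linZ lq) piA.
have q_surj (a : RA) : exists r : TW, thom rho r = a.
  by have [w wE] := rho_surj a; exists (letter w); rewrite thom_word.
have [D [phi [lphi tD phiI]]] := detection res_pi W_torsionfree.1 rho_lin.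
have ltphi := thom_linear lphi; have tphiM := thom_mul lphi.
have qM := thom_mul rho_lin.
have qI (r : TW) : sm_set I r <-> thom rho r = 0 by [].
pose J := full_ideal (ideal_alg I).
pose K := compl_pro (lg_pro (unif V) (tube_pro J)).
pose E := compl_pro (lg_pro (unif V) (tube_pro I)).
pose i n : ahom (K n) (E n) := compl_ahom (lg_ahom (unif V) (tube_val_ahom I n)).
have ei n : pi_embedding (i n).
  exact: compl_pi_embedding (lg_pi_embedding (tube_val_embedding piI n)).
have fU l : fine_mod_pi (ba_mod (lg_alg (unif V) (tube_alg I l))).
  by apply: lg_fine; apply: tube_fine => n B; exact: tensor_alg_fine.
have al n := @tube_aug_lin V TW I D (thom phi) ltphi tphiM tD phiI RA (thom rho) lq qI _
  (isT : (1 < n.+2)%N).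
have aM n := @tube_augM V TW I D (thom phi) ltphi tphiM tD phiI RA (thom rho) lq qM qI _
  (isT : (1 < n.+2)%N).
pose p n : ahom (E n.+1) (fine_alg RA) := killed_ahom piA (fU n.+2) (al n) (aM n).
have i_nat m n (h : (m <= n)%N) x :
    pa_tr E (h : dle (d := nat_dir) m n) (i n x) = i m (pa_tr K (h : dle (d := nat_dir) m n) x).
  have [s ->] := cl_surj x; rewrite -[LHS]/(cmap _ (cmap _ _)) -[RHS]/(cmap _ (cmap _ _)).
  rewrite !cmapE; congr cl; apply: bdseq_inj => j; rewrite !bmapE; exact: val_inj.
have p_nat m n (h : (m.+1 <= n.+1)%N) x :
    p m (pa_tr E (h : dle (d := nat_dir) m.+1 n.+1) x) = p n x.
  have [s ->] := cl_surj x; rewrite -[pa_tr _ _ _]/(cmap _ _) cmapE.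
  rewrite [LHS]killed_extE [RHS]killed_extE bmapE.
  exact: (@tube_aug_incl V TW I D (thom phi) ltphi tphiM tD phiI RA (thom rho) lq qI).
have p_surj n a : exists x, p n x = a.
  have [u uE] := @tube_aug_surj V TW I D (thom phi) ltphi tphiM tD phiI RA (thom rho)
    lq qI q_surj _ (isT : (1 < n.+2)%N) a.
  by exists (ceta (ba_mod (lg_alg (unif V) (tube_alg I n.+2))) u); rewrite -uE [LHS]killed_extE.
have p_ker n x : p n x = 0 <-> exists v, x = i n.+1 v.
  have kerE := @tube_aug_ker V TW I D (thom phi) ltphi tphiM tD phiI RA (thom rho) lq qI.
  split=> [|[v ->]].
    have [s ->] := cl_surj x; rewrite [X in X = _]killed_extE => /kerE[v vE].
    apply: (cmap_image (lg_pi_embedding (tube_val_embedding piI n.+1)) erefl).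
    by exists v.
  have [s ->] := cl_surj v; rewrite -[i _ _]/(cmap _ _) cmapE [LHS]killed_extE bmapE.
  by apply/kerE; exists (terms s 0).
have i_emb n (S : set (K n)) : bdd (M := ba_mod (E n)) ((i n : K n -> E n) @` S) ->
    bdd (M := ba_mod (K n)) S by case: (ei n) => _ h _; exact: h.
have i_inj n : injective (i n) by case: (ei n).
exists K, E, (pro_incl i_nat), (pro_aug p); split.
- exact: compl_proP.
- exact: compl_proP.
- exact: pro_extension.
- split=> n; last exact: (compl_fine (fU n.+1)).
  by apply: compl_lg_dagger; exact: tube_torsionfree.
split; first exact: compl_tube_nilpotent.
exists nat_dir, K; split; last exact: pro_iso_refl.
by move=> n; apply: compl_lg_dagger; exact: tube_torsionfree.
Qed.
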